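(* Let $\mathcal{B}$ be a unital $C^*$-algebra and let $E^\odot=(E_t)_{t\in\mathbb{R}_+}$ be a continuous product system of correspondences over $\mathcal{B}$ (with respect to a family $i=(i_t)_{t\in\mathbb{R}_+}$ of isometric embeddings $i_t\colon E_t\to\widehat{E}$). Then $E^\odot$ is the continuous product system associated with a strictly continuous $E_0$-semigroup on $\mathscr{B}^a(E)$ for some unital Hilbert $\mathcal{B}$-module $E$. That is: there exist a Hilbert $\mathcal{B}$-module $E$ with a unit vector $\xi\in E$ and a strictly continuous $E_0$-semigroup $\vartheta=(\vartheta_t)_{t\in\mathbb{R}_+}$ on $\mathscr{B}^a(E)$ such that $E^\odot$ is isomorphic, as a product system, to the product system $(\vartheta_t(\xi\xi^* )E)_{t\in\mathbb{R}_+}$ of $\vartheta$, by an isomorphism under which the continuous sections of $E^\odot$ (with respect to $i$) correspond exactly to the continuous sections of the product system of $\vartheta$ (with respect to the canonical embeddings $\vartheta_t(\xi\xi^* )E\hookrightarrow E$).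
   Context: A correspondence over a $C^*$-algebra $\mathcal{B}$ is a (right) Hilbert $\mathcal{B}$-module with a nondegenerate left action of $\mathcal{B}$ by adjointable operators (a $*$-homomorphism); $\odot$ denotes the (completed) internal tensor product over $\mathcal{B}$. A product system over $\mathcal{B}$ is a family $E^\odot=(E_t)_{t\in\mathbb{R}_+}$, $\mathbb{R}_+=[0,\infty)$, of correspondences over $\mathcal{B}$ with $E_0=\mathcal{B}$ and bilinear unitaries $u_{s,t}\colon E_s\odot E_t\to E_{s+t}$ such that, writing $x_sy_t:=u_{s,t}(x_s\odot y_t)$, one has $(x_ry_s)z_t=x_r(y_sz_t)$, and $u_{0,t},u_{t,0}$ are the canonical identifications. An isomorphism of product systems is a family of bilinear unitaries $\varphi_t$ between the members with $\varphi_{s+t}(x_sy_t)=\varphi_s(x_s)\varphi_t(y_t)$ and $\varphi_0=\mathrm{id}_{\mathcal{B}}$ (under $E_0=\mathcal{B}$). Given a Hilbert $\mathcal{B}$-module $\widehat{E}$ and isometric embeddings (inner-product preserving right $\mathcal{B}$-linear maps) $i_t\colon E_t\to\widehat{E}$, the set of continuous sections is $CS_i(E^\odot)=\{x=(x_t)_{t\in\mathbb{R}_+}: x_t\in E_t,\ t\mapsto i_tx_t \text{ is norm continuous}\}$. $E^\odot$ is continuous (with respect to $i$) if (1) for every $t$ and every $y_t\in E_t$ there is $x\in CS_i(E^\odot)$ with $x_t=y_t$; (2) for all $x,y\in CS_i(E^\odot)$ the function $(s,t)\mapsto i_{s+t}(x_sy_t)$ is continuous. $\mathscr{B}^a(E)$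 is the algebra of adjointable operators on $E$. A unit vector in $E$ is $\xi\in E$ with $\langle\xi,\xi\rangle=\mathbf{1}$; $E$ is unital if it has a unit vector. For $x,y\in E$, $xy^*$ denotes the operator $z\mapsto x\langle y,z\rangle$, and $\xi b\xi^*$ the operator $z\mapsto\xi b\langle\xi,z\rangle$. An $E_0$-semigroup on $\mathscr{B}^a(E)$ is a semigroup $\vartheta=(\vartheta_t)_{t\in\mathbb{R}_+}$ (with $\vartheta_0=\mathrm{id}$) of unital $*$-endomorphisms of $\mathscr{B}^a(E)$, each of which is strict, i.e. strictly continuous on bounded subsets (equivalently, $\vartheta_t(\mathscr{K}(E))E$ spans a dense subspace of $E$, $\mathscr{K}(E)$ the compact operators). It is strictly continuous if $t\mapsto\vartheta_t(a)$ is strictly (equivalently, strongly: $t\mapsto\vartheta_t(a)x$ is norm continuous for all $x\in E$) continuous for every $a\in\mathscr{B}^a(E)$. The product system of an $E_0$-semigroup $\vartheta$ on $\mathscr{B}^a(E)$ with unit vector $\xi\in E$: $\vartheta_t(\xi\xi^* )E$ with left action $bx_t:=\vartheta_t(\xi b\xi^* )x_t$ and product $x_sy_t:=\vartheta_t(x_s\xi^* )y_t$ (for $t=0$, $\xi\mathcal{B}$ is identified with $\mathcal{B}$ via $\xi b\mapsto b$). If $\vartheta$ is strictly continuous, this is a continuous product system with respect to the canonical embeddings $\vartheta_t(\xi\xi^* )E\hookrightarrow E=:\widehat{E}$. *)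

(* Defs.v *)
(* MathComp-Analysis, over the complex numbers R[i] of an arbitrary R : realType. *)
From HB Require Import structures.
From mathcomp Require Import all_boot all_order all_algebra.
From mathcomp Require Import complex.
From mathcomp Require Import all_classical all_reals.
From mathcomp Require Import topology normedtype.

Set Implicit Arguments.
Unset Strict Implicit.
Unset Printing Implicit Defensive.

Import Order.TTheory GRing.Theory Num.Theory.
Import numFieldNormedType.Exports.

Local Open Scope classical_set_scope.
Local Open Scope ring_scope.

(* The multiplication is part of this mixin because Hierarchy Builder does not
   support joining the library's rings and normed modules; the ring structure is
   recovered below.  The axiom 1 != 0 is not imposed. *)
HB.mixin Record isUnitalCStarAlgebra (R : realType) A
    & CompleteNormedModule (complex R) A := {
  cmul : A -> A -> A;
  cone : A;
  star : A -> A;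
  cmulA : associative cmul;
  cmul1l : left_id cone cmul;
  cmul1r : right_id cone cmul;
  cmulDl : left_distributive cmul +%R;
  cmulDr : right_distributive cmul +%R;
  cmulZl : forall (k : complex R) (a b : A), cmul (k *: a) b = k *: cmul a b;
  cmulZr : forall (k : complex R) (a b : A), cmul a (k *: b) = k *: cmul a b;
  starK : involutive star;
  starD : {morph star : a b / a + b};
  starZ : forall (k : complex R) (a : A), star (k *: a) = k^* *: star a;
  star_cmul : forall a b : A, star (cmul a b) = cmul (star b) (star a);
  cnormM_le : forall a b : A, `|cmul a b| <= `|a| * `|b|;
  cnorm_star_cmul : forall a : A, `|cmul (star a) a| = `|a| ^+ 2
}.

#[short(type="unitalCStarAlgType")]
HB.structure Definition UnitalCStarAlgebra (R : realType) :=
  {A of CompleteNormedModule (complex R) A & isUnitalCStarAlgebra R A}.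

HB.instance Definition _ (R : realType) (B : unitalCStarAlgType R) :=
  GRing.Zmodule_isPzRing.Build (UnitalCStarAlgebra.sort B)
    cmulA cmul1l cmul1r cmulDl cmulDr.

Section CStarTheory.
Context {R : realType} {B : unitalCStarAlgType R}.
Implicit Types a b : B.

Lemma cscalerAl (k : complex R) a b : k *: (a * b) = (k *: a) * b.
Proof. by rewrite [RHS]cmulZl. Qed.
Lemma cscalerAr (k : complex R) a b : k *: (a * b) = a * (k *: b).
Proof. by rewrite [RHS]cmulZr. Qed.
Lemma starM a b : star (a * b) = star b * star a.
Proof. exact: star_cmul. Qed.
Lemma cnorm_starM a : `|star a * a| = `|a| ^+ 2.
Proof. exact: cnorm_star_cmul. Qed.

End CStarTheory.

Definition cstar_pos (R : realType) (B : unitalCStarAlgType R) (b : B) : Prop :=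
  exists c : B, b = star c * c.

(* Right Hilbert modules; MathComp's lmodType is a left structure, hence the
   separate right action [ract].  Completeness is that of the norm
   |<x, x>|^(1/2), by [norm_inner]. *)
HB.mixin Record isHilbertModule (R : realType) (B : unitalCStarAlgType R) E
    & CompleteNormedModule (complex R) E := {
  ract : E -> B -> E;
  ractDl : forall (x y : E) (b : B), ract (x + y) b = ract x b + ract y b;
  ractDr : forall (x : E) (a b : B), ract x (a + b) = ract x a + ract x b;
  ractA : forall (x : E) (a b : B), ract x (a * b) = ract (ract x a) b;
  ract1 : forall x : E, ract x 1 = x;
  ractZl : forall (k : complex R) (x : E) (b : B),
    ract (k *: x) b = k *: ract x b;
  ractZr : forall (k : complex R) (x : E) (b : B),
    ract x (k *: b) = k *: ract x b;
  inner : E -> E -> B;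
  innerDr : forall x y z : E, inner x (y + z) = inner x y + inner x z;
  innerZr : forall (k : complex R) (x y : E), inner x (k *: y) = k *: inner x y;
  inner_ractr : forall (x y : E) (b : B), inner x (ract y b) = inner x y * b;
  star_inner : forall x y : E, star (inner x y) = inner y x;
  inner_pos : forall x : E, cstar_pos (inner x x);
  norm_inner : forall x : E, `|x| ^+ 2 = `|inner x x|
}.

#[short(type="hilbertModType")]
HB.structure Definition HilbertModule (R : realType) (B : unitalCStarAlgType R) :=
  {E of CompleteNormedModule (complex R) E & isHilbertModule R B E}.

Section HilbertModuleTheory.
Context {R : realType} {B : unitalCStarAlgType R}.
Implicit Types E : hilbertModType B.

Lemma star0 : star (0 : B) = 0.
Proof. by apply: (addrI (star (0 : B))); rewrite -starD !addr0. Qed.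

Lemma starN (b : B) : star (- b) = - star b.
Proof. by apply: (addrI (star b)); rewrite -starD !subrr star0. Qed.

Lemma star1 : star (1 : B) = 1.
Proof. by rewrite -[LHS]mulr1 -[X in _ * X]starK -starM mulr1 starK. Qed.

Lemma innerDl E (x y z : E) : inner (x + y) z = inner x z + inner y z.
Proof. by rewrite -star_inner innerDr starD !star_inner. Qed.

Lemma innerZl E (k : complex R) (x y : E) :
  inner (k *: x) y = k^* *: inner x y.
Proof. by rewrite -star_inner innerZr starZ star_inner. Qed.

Lemma innerNr E (x y : E) : inner x (- y) = - inner x y.
Proof. by rewrite -scaleN1r innerZr scaleN1r. Qed.

Lemma innerNl E (x y : E) : inner (- x) y = - inner x y.
Proof. by rewrite -star_inner innerNr starN star_inner. Qed.

Lemma inner_ractl E (x y : E) (b : B) :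
  inner (ract x b) y = star b * inner x y.
Proof. by rewrite -star_inner inner_ractr starM star_inner. Qed.

Lemma inner_inj E (x y : E) : (forall z, inner z x = inner z y) -> x = y.
Proof.
move=> h; apply/eqP; rewrite -subr_eq0 -normr_eq0 -sqrf_eq0 norm_inner.
by rewrite innerDr innerNr h subrr normr0.
Qed.

Fact inner_pol E (x y : E) :
  inner (x + y) (x + y) = inner x x + inner y y + (inner x y + inner y x).
Proof.
by rewrite innerDl !innerDr (addrC (inner y x)) addrACA.
Qed.

Fact inner_pol6 E (x y : E) : `|x| <= 1 -> `|y| <= 1 ->
  `|inner x y + inner y x| <= 6.
Proof.
move=> x1 y1; rewrite -[_ + _](addKr (inner x x + inner y y)) -inner_pol addrC.
have sq (u : E) n : `|u| <= n%:R -> `|inner u u| <= (n ^ 2)%:R.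
  by move=> un; rewrite -norm_inner natrX lerXn2r ?nnegrE.
rewrite -[6]/((4 + (1 + 1))%:R) natrD.
apply: (le_trans (ler_normB _ _)); apply: lerD.
  apply: (sq _ 2%N); apply: (le_trans (ler_normD _ _)).
  by rewrite -[2]/((1 + 1)%:R) natrD lerD.
apply: (le_trans (ler_normD _ _)); rewrite natrD.
by apply: lerD; exact: (sq _ 1%N).
Qed.

Fact inner_bound1 E (x y : E) : `|x| <= 1 -> `|y| <= 1 -> `|inner x y| <= 6.
Proof.
move=> x1 y1; rewrite -(@ler_pMn2r _ 2)// -normrMn.
have -> : inner x y *+ 2 = (inner x y + inner y x) +
    (- 'i) *: (inner x ('i *: y) + inner ('i *: y) x).
  rewrite innerZr innerZl conjCi scalerDr !scalerA mulNr mulrN mulNr -expr2 sqrCi.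
  by rewrite !opprK scale1r scaleN1r addrACA subrr addr0.
apply: (le_trans (ler_normD _ _)); rewrite mulr2n; apply: lerD.
  exact: inner_pol6.
rewrite normrZ normrN normCi mul1r; apply: inner_pol6 => //.
by rewrite normrZ normCi mul1r.
Qed.

Lemma inner_bound E (x y : E) : `|inner x y| <= 6 * `|x| * `|y|.
Proof.
have inner0 (u v : E) : `|u| = 0 \/ `|v| = 0 -> inner u v = 0.
  move=> [/eqP|/eqP]; rewrite normr_eq0 => /eqP ->.
    by rewrite -(scale0r (0 : E)) innerZl conjC0 scale0r.
  by rewrite -(scale0r (0 : E)) innerZr scale0r.
have [x0|x0] := eqVneq `|x| 0.
  by rewrite inner0 ?normr0 ?mulr_ge0//; left.
have [y0|y0] := eqVneq `|y| 0.
  by rewrite inner0 ?normr0 ?mulr_ge0//; right.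
have n1 (u : E) : `|u| != 0 -> `| (`|u|^-1 *: u) | <= 1.
  by move=> u0; rewrite normrZ ger0_norm ?invr_ge0// mulVf.
have := inner_bound1 (n1 _ x0) (n1 _ y0).
rewrite innerZl innerZr !normrZ norm_conjC !ger0_norm ?invr_ge0//.
rewrite ler_pdivrMl ?lt_def ?x0 ?normr_ge0//.
rewrite ler_pdivrMl ?lt_def ?y0 ?normr_ge0//.
by move/le_trans; apply; rewrite mulrC (mulrC _ 6).
Qed.
End HilbertModuleTheory.

(* Since [opadj] is uniquely determined by [op], elements of [adjointable E] are
   exactly the adjointable operators on E; see [adjointableP]. *)
Record adjointable (R : realType) (B : unitalCStarAlgType R)
    (E : hilbertModType B) := Adjointable {
  op :> E -> E;
  opadj : E -> E;
  op_inner : forall x y, inner (op x) y = inner x (opadj y)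
}.

Section Adjointable.
Context {R : realType} {B : unitalCStarAlgType R} (E : hilbertModType B).
Implicit Types a b c : adjointable E.

Lemma adjointableP a b : op a =1 op b -> a = b.
Proof.
case: a b => [f f' fP] [g g' gP] /= fg.
have {}fg : f = g by apply/funext.
case: _ / fg in gP *.
have f'g' : f' = g'.
  by apply/funext => y; apply: inner_inj => z; rewrite -fP gP.
by case: _ / f'g' in gP *; congr Adjointable; exact: Prop_irrelevance.
Qed.

HB.instance Definition _ := gen_eqMixin (adjointable E).
HB.instance Definition _ := gen_choiceMixin (adjointable E).

Fact opadj_inner a x y : inner (opadj a x) y = inner x (op a y).
Proof. by rewrite -star_inner -op_inner star_inner. Qed.
Definition ba_star a : adjointable E := Adjointable (opadj_inner a).

Fact ba_zero_inner (x y : E) : inner 0 y = inner x 0.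
Proof. by rewrite -(scale0r x) innerZl innerZr conjC0 !scale0r. Qed.
Definition ba_zero : adjointable E := Adjointable ba_zero_inner.

Fact ba_opp_inner a x y : inner (- op a x) y = inner x (- opadj a y).
Proof.
by rewrite -[LHS]star_inner !innerNr starN star_inner op_inner.
Qed.
Definition ba_opp a : adjointable E := Adjointable (ba_opp_inner a).

Fact ba_add_inner a b x y :
  inner (op a x + op b x) y = inner x (opadj a y + opadj b y).
Proof. by rewrite innerDl innerDr !op_inner. Qed.
Definition ba_add a b : adjointable E := Adjointable (ba_add_inner a b).

Fact ba_scale_inner (k : complex R) a x y :
  inner (k *: op a x) y = inner x (k^* *: opadj a y).
Proof. by rewrite innerZl innerZr op_inner. Qed.
Definition ba_scale k a : adjointable E := Adjointable (ba_scale_inner k a).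

Definition ba_one : adjointable E := @Adjointable _ _ E id id (fun _ _ => erefl).

Fact ba_mul_inner a b x y :
  inner (op a (op b x)) y = inner x (opadj b (opadj a y)).
Proof. by rewrite !op_inner. Qed.
Definition ba_mul a b : adjointable E := Adjointable (ba_mul_inner a b).

Lemma opD a x y : op a (x + y) = op a x + op a y.
Proof. by apply: inner_inj => z; rewrite innerDr -!opadj_inner innerDr. Qed.

Lemma opZ a (k : complex R) x : op a (k *: x) = k *: op a x.
Proof. by apply: inner_inj => z; rewrite innerZr -!opadj_inner innerZr. Qed.

Lemma opN a x : op a (- x) = - op a x.
Proof. by rewrite -scaleN1r opZ scaleN1r. Qed.

Lemma op_ract a x (b : B) : op a (ract x b) = ract (op a x) b.
Proof.
by apply: inner_inj => z; rewrite inner_ractr -!opadj_inner inner_ractr.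
Qed.

Fact ba_addA : associative ba_add.
Proof. by move=> a b c; apply: adjointableP => x /=; rewrite addrA. Qed.
Fact ba_addC : commutative ba_add.
Proof. by move=> a b; apply: adjointableP => x /=; rewrite addrC. Qed.
Fact ba_add0 : left_id ba_zero ba_add.
Proof. by move=> a; apply: adjointableP => x /=; rewrite add0r. Qed.
Fact ba_addN : left_inverse ba_zero ba_opp ba_add.
Proof. by move=> a; apply: adjointableP => x /=; rewrite addNr. Qed.
HB.instance Definition _ := GRing.isZmodule.Build (adjointable E)
  ba_addA ba_addC ba_add0 ba_addN.

Fact ba_mulA : associative ba_mul.
Proof. by move=> a b c; exact: adjointableP. Qed.
Fact ba_mul1 : left_id ba_one ba_mul.
Proof. by move=> a; exact: adjointableP. Qed.
Fact ba_mulr1 : right_id ba_one ba_mul.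
Proof. by move=> a; exact: adjointableP. Qed.
Fact ba_mulDl : left_distributive ba_mul +%R.
Proof. by move=> a b c; exact: adjointableP. Qed.
Fact ba_mulDr : right_distributive ba_mul +%R.
Proof. by move=> a b c; apply: adjointableP => x /=; rewrite opD. Qed.
HB.instance Definition _ := GRing.Zmodule_isPzRing.Build (adjointable E)
  ba_mulA ba_mul1 ba_mulr1 ba_mulDl ba_mulDr.

Fact ba_scaleA k l a : ba_scale k (ba_scale l a) = ba_scale (k * l) a.
Proof. by apply: adjointableP => x /=; rewrite scalerA. Qed.
Fact ba_scale1 : left_id 1 ba_scale.
Proof. by move=> a; apply: adjointableP => x /=; rewrite scale1r. Qed.
Fact ba_scaleDr : right_distributive ba_scale +%R.
Proof. by move=> k a b; apply: adjointableP => x /=; rewrite scalerDr. Qed.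
Fact ba_scaleDl a : {morph ba_scale^~ a : k l / k + l}.
Proof. by move=> k l; apply: adjointableP => x /=; rewrite scalerDl. Qed.
HB.instance Definition _ := GRing.Zmodule_isLmodule.Build (complex R)
  (adjointable E) ba_scaleA ba_scale1 ba_scaleDr ba_scaleDl.

(* The topology put on [adjointable E] is the strict one, generated by the
   seminorms a |-> |a x| and a |-> |a^* x|, x in E. *)
HB.instance Definition _ := Topological.copy (adjointable E)
  (initial_topology
    (fun a => (fun x => (op a x, opadj a x)) : {ptws E -> (E * E)%type})).

Definition ba_bounded (S : set (adjointable E)) : Prop :=
  exists M : complex R, forall a, S a -> forall x, `|op a x| <= M * `|x|.

Fact rank1_inner (x y z w : E) :
  inner (ract x (inner y z)) w = inner z (ract y (inner x w)).
Proof. by rewrite inner_ractl inner_ractr star_inner. Qed.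
(* x y^* : z |-> x <y, z> *)
Definition rank1 (x y : E) : adjointable E := Adjointable (rank1_inner x y).

End Adjointable.

Section Spans.
Context {K : numFieldType} {E : normedModType K}.

Definition lin_span (A : set E) : set E :=
  [set v | exists n (k : 'I_n -> K) (w : 'I_n -> E),
     (forall i, A (w i)) /\ v = \sum_(i < n) k i *: w i].

Definition spans_densely (A : set E) : Prop := closure (lin_span A) = setT.

End Spans.

Lemma dense_unital (R : realType) (B : unitalCStarAlgType R)
    (E : hilbertModType B) (l : B -> adjointable E) :
  op (l 1) =1 id -> spans_densely [set y | exists b x, y = op (l b) x].
Proof.
move=> l1; apply/seteqP; split => // x _; apply: subset_closure.
exists 1%N, (fun=> 1), (fun=> x); split.
  by move=> _; exists 1, x; rewrite l1.
by rewrite big_ord1 scale1r.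
Qed.

(* Nondegeneracy: the elements b x span a dense subspace. *)
Record correspondence (R : realType) (B : unitalCStarAlgType R) := Correspondence {
  corr_mod :> hilbertModType B;
  lact : B -> adjointable corr_mod;
  lact_linear : linear lact;
  lactM : {morph lact : a b / a * b};
  lact_star : {morph lact : a / star a >-> ba_star a};
  lact_nondegenerate : spans_densely [set y | exists b x, y = op (lact b) x]
}.

Section Maps.
Context {R : realType} {B : unitalCStarAlgType R}.

Definition isometric_embedding (E F : hilbertModType B) (f : E -> F) : Prop :=
  [/\ {morph f : x y / x + y},
      forall x (b : B), f (ract x b) = ract (f x) b
    & forall x y, inner (f x) (f y) = inner x y].

Definition bilinear_unitary (E F : correspondence B) (f : E -> F) : Prop :=
  [/\ isometric_embedding f,
      forall y, exists x, f x = y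
    & forall (b : B) x, f (op (lact E b) x) = op (lact F b) (f x)].

(* T, with its elementary tensors [tens x y], is the internal tensor product of
   E and F over B: the correspondence (unique up to bilinear unitary) generated
   by elements x (.) y with the inner products and left action below. *)
Definition internal_tensor (E F T : correspondence B) (tens : E -> F -> T) : Prop :=
  [/\ forall x x' y y', inner (tens x y) (tens x' y') =
                        inner y (op (lact F (inner x x')) y'),
      forall (b : B) x y, op (lact T b) (tens x y) = tens (op (lact E b) x) y
    & spans_densely [set z | exists x y, z = tens x y]].

End Maps.

Section TrivialCorrespondence.
Context {R : realType} (B : unitalCStarAlgType R).

Definition self_mod : Type := B.
HB.instance Definition _ := CompleteNormedModule.on self_mod.

Definition self_ract (x : self_mod) (b : B) : self_mod := (x : B) * b.
Definition self_inner (x y : self_mod) : B := star (x : B) * (y : B).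

Fact self_ractDl (x y : self_mod) b :
  self_ract (x + y) b = self_ract x b + self_ract y b.
Proof. exact: mulrDl. Qed.
Fact self_ractDr (x : self_mod) a b :
  self_ract x (a + b) = self_ract x a + self_ract x b.
Proof. exact: mulrDr. Qed.
Fact self_ractA (x : self_mod) a b :
  self_ract x (a * b) = self_ract (self_ract x a) b.
Proof. exact: mulrA. Qed.
Fact self_ract1 (x : self_mod) : self_ract x 1 = x.
Proof. exact: mulr1. Qed.
Fact self_ractZl (k : complex R) (x : self_mod) b :
  self_ract (k *: x) b = k *: self_ract x b.
Proof. by rewrite /self_ract [RHS]cscalerAl. Qed.
Fact self_ractZr (k : complex R) (x : self_mod) b :
  self_ract x (k *: b) = k *: self_ract x b.
Proof. by rewrite /self_ract [RHS]cscalerAr. Qed.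
Fact self_innerDr (x y z : self_mod) :
  self_inner x (y + z) = self_inner x y + self_inner x z.
Proof. exact: mulrDr. Qed.
Fact self_innerZr (k : complex R) (x y : self_mod) :
  self_inner x (k *: y) = k *: self_inner x y.
Proof. by rewrite /self_inner [RHS]cscalerAr. Qed.
Fact self_inner_ractr (x y : self_mod) b :
  self_inner x (self_ract y b) = self_inner x y * b.
Proof. exact: mulrA. Qed.
Fact self_star_inner (x y : self_mod) : star (self_inner x y) = self_inner y x.
Proof. by rewrite /self_inner starM starK. Qed.
Fact self_inner_pos (x : self_mod) : cstar_pos (self_inner x x).
Proof. by exists x. Qed.
Fact self_norm_inner (x : self_mod) : `|x| ^+ 2 = `|self_inner x x|.
Proof. by rewrite /self_inner cnorm_starM. Qed.
HB.instance Definition _ := isHilbertModule.Build R B self_mod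
  self_ractDl self_ractDr self_ractA self_ract1 self_ractZl self_ractZr
  self_innerDr self_innerZr self_inner_ractr self_star_inner self_inner_pos
  self_norm_inner.

Fact self_lact_inner (b : B) (x y : self_mod) :
  inner ((b * (x : B)) : self_mod) y = inner x ((star b * (y : B)) : self_mod).
Proof. by rewrite /inner /= /self_inner starM mulrA. Qed.
Definition self_lact (b : B) : adjointable self_mod :=
  Adjointable (self_lact_inner b).

Fact self_lact_linear : linear self_lact.
Proof.
move=> k a b; apply: adjointableP => x /=.
by rewrite mulrDl -cscalerAl.
Qed.
Fact self_lactM : {morph self_lact : a b / a * b}.
Proof. by move=> a b; apply: adjointableP => x /=; rewrite mulrA. Qed.
Fact self_lact_star : {morph self_lact : a / star a >-> ba_star a}.
Proof. by move=> a; exact: adjointableP. Qed.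

Fact self_nondegenerate :
  spans_densely [set y | exists b x, y = op (self_lact b) x].
Proof. by apply: dense_unital => x /=; rewrite mul1r. Qed.
Definition self_corr : correspondence B :=
  Correspondence self_lact_linear self_lactM self_lact_star self_nondegenerate.

End TrivialCorrespondence.

(* The additive monoid R_+ = [0, oo[ with the topology induced from R. *)
Record Rplus (R : realType) := MkRplus { rpval :> R; rpval_ge0 : 0 <= rpval }.
HB.instance Definition _ (R : realType) := [isSub for @rpval R].
HB.instance Definition _ (R : realType) := [Choice of Rplus R by <:].

Section RplusMonoid.
Variable R : realType.
Implicit Types s t : Rplus R.

Definition rp_zero : Rplus R := MkRplus (lexx 0).
Definition rp_add s t : Rplus R :=
  MkRplus (addr_ge0 (rpval_ge0 s) (rpval_ge0 t)).

Fact rp_addA : associative rp_add.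
Proof. by move=> r s t; apply: val_inj; exact: addrA. Qed.
Fact rp_addC : commutative rp_add.
Proof. by move=> s t; apply: val_inj; exact: addrC. Qed.
Fact rp_add0 : left_id rp_zero rp_add.
Proof. by move=> t; apply: val_inj; exact: add0r. Qed.
HB.instance Definition _ := GRing.isNmodule.Build (Rplus R)
  rp_addA rp_addC rp_add0.

End RplusMonoid.

HB.instance Definition _ (R : realType) :=
  Topological.copy (Rplus R) (initial_topology (@rpval R)).

Section ProductSystems.
Context {R : realType} {B : unitalCStarAlgType R}.

(* The data of a product system.  E_0 = B is recorded by the identification
   [ps_id : B -> E_0]. *)
Record ps_data := PsData {
  ps_fib :> Rplus R -> correspondence B;
  ps_id : self_corr B -> ps_fib 0;
  ps_mul : forall s t : Rplus R, ps_fib s -> ps_fib t -> ps_fib (s + t)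
}.

Definition ps_cast (P : ps_data) (s t : Rplus R) (e : s = t) : P s -> P t :=
  fun x => ecast r (P r) e x.

Record is_product_system (P : ps_data) : Prop := IsProductSystem {
  ps_id_unitary : bilinear_unitary (ps_id P);
  ps_mul_unitary : forall s t : Rplus R,
    exists (T : correspondence B) (tens : P s -> P t -> T) (u : T -> P (s + t)),
      [/\ internal_tensor tens, bilinear_unitary u
        & forall x y, ps_mul x y = u (tens x y)];
  ps_mulA : forall (r s t : Rplus R) (x : P r) (y : P s) (z : P t),
    ps_cast (addrA r s t) (ps_mul x (ps_mul y z)) = ps_mul (ps_mul x y) z;
  ps_mul0l : forall (t : Rplus R) (b : B) (y : P t),
    ps_cast (add0r t) (ps_mul (ps_id P b) y) = op (lact (P t) b) y;
  ps_mul0r : forall (t : Rplus R) (x : P t) (b : B),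
    ps_cast (addr0 t) (ps_mul x (ps_id P b)) = ract x b
}.

Definition ps_isomorphism (P Q : ps_data) (phi : forall t, P t -> Q t) : Prop :=
  [/\ forall t, bilinear_unitary (phi t),
      forall s t (x : P s) (y : P t),
        phi (s + t) (ps_mul x y) = ps_mul (phi s x) (phi t y)
    & forall b : B, phi 0 (ps_id P b) = ps_id Q b].

Definition cont_sections (P : ps_data) (F : hilbertModType B)
    (i : forall t, P t -> F) : set (forall t, P t) :=
  [set x | continuous (fun t : Rplus R => i t (x t))].

Definition is_continuous_ps (P : ps_data) (F : hilbertModType B)
    (i : forall t, P t -> F) : Prop :=
  (forall t (y : P t), exists2 x, cont_sections i x & x t = y) /\
  (forall x y, cont_sections i x -> cont_sections i y ->
     continuous (fun st : Rplus R * Rplus R =>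
       i (st.1 + st.2) (ps_mul (x st.1) (y st.2)))).

End ProductSystems.
Arguments ps_data {R} B.

(* The closed submodule {x | p x = x} of E, i.e. the range of p if p is a
   projection. *)
Section FixedSubmodule.
Context {R : realType} {B : unitalCStarAlgType R} {E : hilbertModType B}.
Variable p : adjointable E.

Definition fixed_pred : {pred E} := fun x => op p x == x.

Fact fixed_submod_closed : submod_closed fixed_pred.
Proof.
split=> [|k x y].
  by rewrite unfold_in -(scale0r (0 : E)) opZ !scale0r.
by rewrite !unfold_in opD opZ => /eqP -> /eqP ->.
Qed.
HB.instance Definition _ := GRing.isSubmodClosed.Build (complex R) E fixed_pred
  fixed_submod_closed.

Record fixed_mod := FixedMod { fval : E; fvalP : fval \in fixed_pred }.
Local Notation M := fixed_mod.
HB.instance Definition _ := [isSub for fval].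
HB.instance Definition _ := [Choice of fixed_mod by <:].
HB.instance Definition _ := [SubChoice_isSubLmodule of fixed_mod by <:].

Fact fixed_normD (x y : fixed_mod) : `|fval (x + y)| <= `|fval x| + `|fval y|.
Proof. exact: ler_normD. Qed.
Fact fixed_normZ (k : complex R) (x : fixed_mod) :
  `|fval (k *: x)| = `|k| * `|fval x|.
Proof. exact: normrZ. Qed.
Fact fixed_norm0 (x : fixed_mod) : `|fval x| = 0 -> x = 0.
Proof. by move=> /eqP; rewrite normr_eq0 => /eqP x0; apply: val_inj. Qed.
HB.instance Definition _ := Lmodule_isNormed.Build (complex R) fixed_mod
  fixed_normD fixed_normZ fixed_norm0.

Fact fixed_complete (F : set_system M) : ProperFilter F -> cauchy F -> cvg F.
Proof.
move=> FF /cauchy_ballP Fc.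
have Gc : cauchy (fval @ F).
  apply/cauchy_ballP => e e0; have := Fc e e0.
  by rewrite /= !near_simpl -!ball_normE.
have /cvg_ex[/= l Fl] : cvg (fval @ F) by exact: cauchy_cvg.
have lp : l \in fixed_pred.
  rewrite unfold_in -subr_eq0; apply/eqP/inner_inj => z.
  have -> : inner z 0 = 0 :> B by rewrite -(scale0r (0 : E)) innerZr scale0r.
  set w := opadj p z - z.
  have ww x : inner z (op p x - x) = inner w x.
    by rewrite innerDr innerNr -opadj_inner innerDl innerNl.
  apply/eqP; rewrite -normr_eq0; apply/negPn/negP => a0.
  set a := `|_| in a0; have {}a0 : 0 < a by rewrite lt_def a0 normr_ge0.
  have c0 : 0 < 6 * `|w| + 1 by rewrite ltr_wpDl// mulr_ge0.
  have d0 : 0 < a / (6 * `|w| + 1) by rewrite divr_gt0.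
  have /cvgrPdist_lt/(_ _ d0) /filter_ex[x /= lx] := Fl.
  have : a < a; last by rewrite ltxx.
  have ax : a = `|inner w (l - fval x)|.
    rewrite /a -ww; congr (`|inner z _|).
    have /eqP px : op p (fval x) == fval x := fvalP x.
    by rewrite opD opN px opprD opprK addrACA addNr addr0.
  rewrite [X in X < _]ax; apply: (le_lt_trans (inner_bound _ _)).
  apply: (@le_lt_trans _ _ (6 * `|w| * (a / (6 * `|w| + 1)))).
    by rewrite ler_wpM2l ?mulr_ge0// ltW.
  rewrite mulrCA -[ltRHS]mulr1 ltr_pM2l// ltr_pdivrMr// mul1r.
  by rewrite ltrDl.
apply/cvg_ex; exists (FixedMod lp); apply/cvgrPdist_lt => e e0.
by have /cvgrPdist_lt/(_ e e0) := Fl.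
Qed.
HB.instance Definition _ := Uniform_isComplete.Build M fixed_complete.

Fact fixed_ract_subproof (x : M) (b : B) : ract (fval x) b \in fixed_pred.
Proof.
have /eqP px : op p (fval x) == fval x := fvalP x.
by rewrite unfold_in op_ract px.
Qed.
Definition fixed_ract (x : M) (b : B) : M := FixedMod (fixed_ract_subproof x b).
Definition fixed_inner (x y : M) : B := inner (fval x) (fval y).

Fact fixed_ractDl (x y : M) b :
  fixed_ract (x + y) b = fixed_ract x b + fixed_ract y b.
Proof. by apply: val_inj; exact: ractDl. Qed.
Fact fixed_ractDr (x : M) a b :
  fixed_ract x (a + b) = fixed_ract x a + fixed_ract x b.
Proof. by apply: val_inj; exact: ractDr. Qed.
Fact fixed_ractA (x : M) a b :
  fixed_ract x (a * b) = fixed_ract (fixed_ract x a) b.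
Proof. by apply: val_inj; exact: ractA. Qed.
Fact fixed_ract1 (x : M) : fixed_ract x 1 = x.
Proof. by apply: val_inj; exact: ract1. Qed.
Fact fixed_ractZl (k : complex R) (x : M) b :
  fixed_ract (k *: x) b = k *: fixed_ract x b.
Proof. by apply: val_inj; exact: ractZl. Qed.
Fact fixed_ractZr (k : complex R) (x : M) b :
  fixed_ract x (k *: b) = k *: fixed_ract x b.
Proof. by apply: val_inj; exact: ractZr. Qed.
Fact fixed_innerDr (x y z : M) :
  fixed_inner x (y + z) = fixed_inner x y + fixed_inner x z.
Proof. exact: innerDr. Qed.
Fact fixed_innerZr (k : complex R) (x y : M) :
  fixed_inner x (k *: y) = k *: fixed_inner x y.
Proof. exact: innerZr. Qed.
Fact fixed_inner_ractr (x y : M) b :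
  fixed_inner x (fixed_ract y b) = fixed_inner x y * b.
Proof. exact: inner_ractr. Qed.
Fact fixed_star_inner (x y : M) : star (fixed_inner x y) = fixed_inner y x.
Proof. exact: star_inner. Qed.
Fact fixed_inner_pos (x : M) : cstar_pos (fixed_inner x x).
Proof. exact: inner_pos. Qed.
Fact fixed_norm_inner (x : M) : `|x| ^+ 2 = `|fixed_inner x x|.
Proof. exact: norm_inner. Qed.
HB.instance Definition _ := isHilbertModule.Build R B M
  fixed_ractDl fixed_ractDr fixed_ractA fixed_ract1 fixed_ractZl fixed_ractZr
  fixed_innerDr fixed_innerZr fixed_inner_ractr fixed_star_inner
  fixed_inner_pos fixed_norm_inner.

End FixedSubmodule.

Section E0Semigroups.
Context {R : realType} {B : unitalCStarAlgType R}.

(* Continuity is with respect to the strict topology of [adjointable E]. *)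
Definition strict (E : hilbertModType B) (f : adjointable E -> adjointable E) :
    Prop :=
  forall S : set (adjointable E), ba_bounded S -> {within S, continuous f}.

Record E0_semigroup (E : hilbertModType B) := E0Semigroup {
  e0sg :> Rplus R -> adjointable E -> adjointable E;
  e0sg0 : forall a, e0sg 0 a = a;
  e0sgD : forall s t a, e0sg (s + t) a = e0sg s (e0sg t a);
  e0sg_linear : forall t, linear (e0sg t);
  e0sg_monoid : forall t, monoid_morphism (e0sg t);
  e0sg_star : forall t a, e0sg t (ba_star a) = ba_star (e0sg t a);
  e0sg_strict : forall t, strict (e0sg t)
}.

Definition strictly_continuous (E : hilbertModType B) (theta : E0_semigroup E) :
    Prop :=
  forall a, continuous (fun t : Rplus R => theta t a).

Definition unit_vector (E : hilbertModType B) (xi : E) : Prop := inner xi xi = 1.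

Section SemigroupProductSystem.
Context {E : hilbertModType B} (theta : E0_semigroup E) (xi : E).
Hypothesis xi1 : unit_vector xi.

Let proj t : adjointable E := theta t (rank1 xi xi).

Lemma e0sgM t a b : theta t (a * b) = theta t a * theta t b.
Proof. by rewrite (e0sg_monoid theta t).2. Qed.

Lemma rank1_mul (x y z w : E) :
  rank1 x y * rank1 z w = rank1 (ract x (inner y z)) w.
Proof.
apply: adjointableP => v /=.
by rewrite inner_ractr ractA.
Qed.

(* theta_t(xi xi^* )E as a Hilbert submodule of E; see [sg_fib_range]. *)
Definition sg_fib (t : Rplus R) : hilbertModType B := fixed_mod (proj t).

Lemma sg_fib_range (t : Rplus R) :
  range (@fval _ _ _ _ : sg_fib t -> E) = range (op (theta t (rank1 xi xi))).
Proof.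
apply/seteqP; split=> [_ [x _ <-]|_ [x _ <-]].
  by exists (fval x) => //; exact/eqP/(fvalP x).
have px : op (proj t) x \in fixed_pred (proj t).
  rewrite unfold_in -[op _ (op _ _)]/(op (proj t * proj t) x) -e0sgM.
  by rewrite rank1_mul xi1 ract1.
by exists (FixedMod px).
Qed.

Fact sg_lact_subproof t (b : B) (x : sg_fib t) :
  op (theta t (rank1 (ract xi b) xi)) (fval x) \in fixed_pred (proj t).
Proof.
rewrite unfold_in -[op _ (op _ _)]/(op (proj t * theta t _) (fval x)) -e0sgM.
by rewrite rank1_mul inner_ractr xi1 mul1r.
Qed.
Definition sg_lact_fun t (b : B) (x : sg_fib t) : sg_fib t :=
  FixedMod (sg_lact_subproof b x).

Lemma star_rank1 (b : B) : ba_star (rank1 (ract xi b) xi) = rank1 (ract xi (star b)) xi.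
Proof.
apply: adjointableP => z /=.
by rewrite inner_ractl ractA.
Qed.

Fact sg_lact_inner t (b : B) (x y : sg_fib t) :
  inner (sg_lact_fun b x) y = inner x (sg_lact_fun (star b) y).
Proof.
rewrite /inner /= /fixed_inner /= op_inner; congr (inner _ _).
by rewrite -star_rank1 e0sg_star.
Qed.
(* b x_t = theta_t(xi b xi^* ) x_t *)
Definition sg_lact t (b : B) : adjointable (sg_fib t) :=
  Adjointable (@sg_lact_inner t b).

Fact sg_lact_linear t : linear (@sg_lact t).
Proof.
move=> k a b; apply: adjointableP => x; apply: val_inj => /=.
have -> : rank1 (ract xi (k *: a + b)) xi =
    k *: rank1 (ract xi a) xi + rank1 (ract xi b) xi.
  by apply: adjointableP => z /=; rewrite ractDr ractZr ractDl ractZl.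
by rewrite e0sg_linear.
Qed.

Fact sg_lactM t : {morph @sg_lact t : a b / a * b}.
Proof.
move=> a b; apply: adjointableP => x; apply: val_inj => /=.
rewrite -[RHS]/(op (theta t _ * theta t _) (fval x)) -e0sgM.
by rewrite rank1_mul inner_ractr xi1 mul1r ractA.
Qed.

Fact sg_lact_star t : {morph @sg_lact t : a / star a >-> ba_star a}.
Proof. by move=> a; apply: adjointableP => x. Qed.

Fact sg_nondegenerate t : spans_densely [set y | exists b x, y = op (@sg_lact t b) x].
Proof.
apply: dense_unital => x; apply: val_inj => /=.
by rewrite ract1; exact/eqP/(fvalP x).
Qed.

Definition sg_corr (t : Rplus R) : correspondence B :=
  Correspondence (@sg_lact_linear t) (@sg_lactM t) (@sg_lact_star t)
    (@sg_nondegenerate t).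

Fact sg_id_subproof (b : B) : ract xi b \in fixed_pred (proj 0).
Proof. by rewrite unfold_in /proj e0sg0 /= inner_ractr xi1 mul1r. Qed.
Definition sg_id (b : self_corr B) : sg_corr 0 := FixedMod (sg_id_subproof b).

Fact sg_mul_subproof s t (x : sg_corr s) (y : sg_corr t) :
  op (theta t (rank1 (fval x) xi)) (fval y) \in fixed_pred (proj (s + t)).
Proof.
rewrite unfold_in /proj addrC e0sgD.
rewrite -[op _ (op _ _)]/(op (theta t _ * theta t _) (fval y)) -e0sgM.
have -> : theta s (rank1 xi xi) * rank1 (fval x) xi = rank1 (fval x) xi.
  apply: adjointableP => z /=; rewrite op_ract; congr (ract _ _).
  exact/eqP/(fvalP x).
by [].
Qed.
(* x_s y_t = theta_t(x_s xi^* ) y_t *)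
Definition sg_mul s t (x : sg_corr s) (y : sg_corr t) : sg_corr (s + t) :=
  FixedMod (sg_mul_subproof x y).

Definition sg_ps : ps_data B := PsData sg_id sg_mul.

Definition sg_embed (t : Rplus R) : sg_ps t -> E := @fval _ _ _ _.

End SemigroupProductSystem.
End E0Semigroups.

Arguments sg_ps {R B E} theta {xi} xi1.
Arguments sg_embed {R B E} theta {xi} xi1 t x.

(* Main.v *)
Require Import Defs.
From HB Require Import structures.
From mathcomp Require Import all_boot all_order all_algebra.
From mathcomp Require Import complex.
From mathcomp Require Import all_classical all_reals.
From mathcomp Require Import topology normedtype.
From mathcomp Require Import ring lra.

(* Fix a unit vector z in some fibre P_a with a > 0 (it exists because a continuous
   section through 1 in P_0 = B has invertible inner square near 0).  A section
   x = (x_t) is called stable if it is eventually continuous and eventually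
   satisfies x_(a+t) = z x_t; then t |-> <x_t, y_t> is eventually a-periodic, and
   its mean over a period is a semi-inner product on stable sections.  Let E be
   the completion.  The shift (x y)_(t+s) = x_t y for y in P_s gives maps
   v_s : E x P_s -> E that induce unitaries from the internal tensor product of E
   and P_s onto E, compatibly with the product system; theta_s(a) v_s(x, y) =
   v_s(a x, y) then defines the semigroup, and phi_s(y) = v_s(xi, y) the
   isomorphism, for any unit vector xi of E.  Density of the range of v_s is local:
   x_t is near a finite sum of elementary products for t in a short interval, and
   the approximants are glued by tent functions summing to 1.

   Positivity in B (a sum or limit of elements c^* c is again of this form) is
   obtained from a convergent iteration for the square root and the criterion
   |r - a| <= r, without spectral theory. *)

Set Implicit Arguments.
Unset Strict Implicit.
Unset Printing Implicit Defensive.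

Import Order.TTheory GRing.Theory Num.Theory.
Import numFieldNormedType.Exports.

Local Open Scope classical_set_scope.
Local Open Scope ring_scope.

Local Notation "x %:C" := (real_complex _ x) : ring_scope.

(** * Real-valued norms and limits of sequences *)

(** For integer multiples of a alone, the inductive limit of the isometries x |-> z x would do as
    [E]. The difficulty is to interpolate to all times. Averaging over a period replaces a direct
    integral over [0, a[, and left multiplication by z commutes with right multiplication by
    elements of [P s] by associativity, so stability survives the shift. Only large times may count:
    a product x y carries information from time s on, and an initial piece of a section would lie
    outside the range of v_s.

    The relation <x y, x' y'> = <y, <x, x'> y'> passes to the mean because bounded linear maps
    commute with means and a shift of time does not change them. Means are limits of Riemann sums,
    so no vector-valued integral is involved.

    The tensor product of E and P_s is never formed: operators are defined on finite lists of pairs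
    and extended by density. This requires a tensored with the identity to be bounded, and before
    that the boundedness of adjointable operators, which are defined purely algebraically. *)

Lemma le_of_sqr {R : realType} (a b : R) : 0 <= b -> a ^+ 2 <= b ^+ 2 -> a <= b.
Proof. by move=> b0 h; rewrite leNgt; apply/negP => ba; nra. Qed.

Lemma small_mul {R : realType} (C e : R) : 0 <= C -> 0 < e ->
  exists d, [/\ 0 < d, d <= 1 & C * d < e].
Proof.
move=> C0 e0; have C1 : 0 < C + 1 by lra.
exists (Num.min 1 (e / (C + 1))); split.
- by rewrite lt_min ltr01 divr_gt0.
- by rewrite ge_min lexx.
- set m := Num.min _ _; have m0 : 0 < m by rewrite lt_min ltr01 divr_gt0.
  have : m <= e / (C + 1) by rewrite ge_min lexx orbT.
  rewrite ler_pdivlMr//; nra.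
Qed.

Lemma Re_norm_ge0 {R : realType} (k : complex R) : 0 <= complex.Re `|k|.
Proof. by have := normr_ge0 k; rewrite lecE => /andP[]. Qed.

Section RealNorm.
Context {R : realType}.

Definition rnorm (V : normedModType (complex R)) (v : V) : R := complex.Re `|v|.

Lemma rnormE (V : normedModType (complex R)) (v : V) : `|v| = (rnorm v)%:C.
Proof. by rewrite /rnorm RRe_real// normr_real. Qed.

Section Mod.
Context {V : normedModType (complex R)}.
Implicit Types u v w : V.

Lemma rnorm_ge0 v : 0 <= rnorm v.
Proof. by rewrite -ler0c -rnormE normr_ge0. Qed.

Lemma rnorm_leC v (M : complex R) : `|v| <= M -> rnorm v <= complex.Re M.
Proof. by rewrite rnormE lecE => /andP[_]. Qed.

Lemma rnormD u v : rnorm (u + v) <= rnorm u + rnorm v.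
Proof. by have := ler_normD u v; rewrite !rnormE -rmorphD lecR. Qed.

Lemma rnormN v : rnorm (- v) = rnorm v.
Proof. by rewrite /rnorm normrN. Qed.

Lemma rnormB u v : rnorm (u - v) = rnorm (v - u).
Proof. by rewrite -rnormN opprB. Qed.

Lemma rnormZ (k : complex R) v : rnorm (k *: v) = complex.Re `|k| * rnorm v.
Proof.
apply: complexI; rewrite rmorphM /= -!rnormE normrZ; congr (_ * _).
Qed.

Lemma rnormZr (k : R) v : rnorm (k%:C *: v) = `|k| * rnorm v.
Proof.
rewrite rnormZ; congr (_ * _).
by rewrite normc_def /= expr0n addr0 sqrtr_sqr.
Qed.

Lemma rnorm0 : rnorm (0 : V) = 0.
Proof. by rewrite /rnorm normr0. Qed.

Lemma rnorm0_eq0 v : rnorm v = 0 -> v = 0.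
Proof. by move=> v0; apply/eqP; rewrite -normr_eq0 rnormE v0. Qed.

Lemma rnorm_sum (I : Type) (r : seq I) (P : pred I) (F : I -> V) :
  rnorm (\sum_(i <- r | P i) F i) <= \sum_(i <- r | P i) rnorm (F i).
Proof.
elim/big_ind2: _ => //; first by rewrite rnorm0.
by move=> x1 x2 y1 y2 h1 h2; apply: (le_trans (rnormD _ _)); exact: lerD.
Qed.

Lemma rnorm_tri w u v : rnorm (u - v) <= rnorm (u - w) + rnorm (w - v).
Proof. by rewrite -[u - v](subrKA w) rnormD. Qed.

Lemma rnorm_sub u v : rnorm u <= rnorm v + rnorm (u - v).
Proof. by rewrite -{1}[u](subrK v) addrC rnormD. Qed.

Lemma eq_of_small u v (C : R) :
  (forall e : R, 0 < e -> rnorm (u - v) <= C * e) -> u = v.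
Proof.
move=> h; apply/eqP; rewrite -subr_eq0; apply/eqP/rnorm0_eq0.
apply/eqP; rewrite eq_le rnorm_ge0 andbT; apply/ler_addgt0Pr => e e0.
rewrite add0r; have C1 : 0 < `|C| + 1 by have := normr_ge0 C; lra.
apply: (le_trans (h _ (divr_gt0 e0 C1))).
rewrite mulrA ler_pdivrMr// mulrC ler_wpM2l//; first exact: ltW.
by have := ler_norm C; lra.
Qed.

Lemma cvg_rnormP T (F : set_system T) (FF : Filter F) (f : T -> V) l :
  f @ F --> l <-> forall e : R, 0 < e -> \forall x \near F, rnorm (l - f x) < e.
Proof.
split=> [/cvgrPdist_lt h e e0|h].
  have /h : (0 : complex R) < e%:C by rewrite ltcR.
  by apply: filterS => x; rewrite rnormE ltcR.
apply/cvgrPdist_lt => e; rewrite ltcE => /andP[/eqP/= ie re].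
have := h _ re; apply: filterS => x; rewrite rnormE.
by rewrite ltcE/= ie eqxx.
Qed.

End Mod.
End RealNorm.

Section Limits.
Context {R : realType} {V : normedModType (complex R)}.
Implicit Types (u v : nat -> V) (l m : V).

Definition rlim u l := forall e : R, 0 < e ->
  exists N, forall n, (N <= n)%N -> rnorm (u n - l) < e.

Lemma rlim_cst l : rlim (fun=> l) l.
Proof. by move=> e e0; exists 0%N => n _; rewrite subrr rnorm0. Qed.

Lemma rlim_uniq u l m : rlim u l -> rlim u m -> l = m.
Proof.
move=> ul um; apply: (@eq_of_small _ _ _ _ 2) => e e0.
have [N hN] := ul _ e0; have [M hM] := um _ e0.
have := rnorm_tri (u (maxn N M)) l m.
rewrite (rnormB l (u _)).
have := hN (maxn N M) (leq_maxl _ _); have := hM (maxn N M) (leq_maxr _ _).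
lra.
Qed.

Lemma rlimD u v l m : rlim u l -> rlim v m -> rlim (fun n => u n + v n) (l + m).
Proof.
move=> ul um e e0; have e2 : 0 < e / 2 by lra.
have [N hN] := ul _ e2; have [M hM] := um _ e2.
exists (maxn N M) => n; rewrite geq_max => /andP[/hN ? /hM ?].
rewrite opprD addrACA; apply: le_lt_trans (rnormD _ _) _; lra.
Qed.

Lemma rlim_bound u l (C : R) :
  (forall n, rnorm (u n) <= C) -> rlim u l -> rnorm l <= C.
Proof.
move=> uC ul; apply/ler_addgt0Pr => e e0; have [N /(_ N (leqnn _))] := ul _ e0.
have := rnorm_sub l (u N); rewrite rnormB; have := uC N; lra.
Qed.

Lemma eq_rlim u v l : (forall n, u n = v n) -> rlim u l -> rlim v l.
Proof. by move=> uv ul e /ul[N hN]; exists N => n /hN; rewrite uv. Qed.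

Lemma inv_small (e : R) : 0 < e -> exists N, forall n, (N <= n)%N -> (n.+1%:R)^-1 < e.
Proof.
move=> e0; exists (Num.truncn e^-1) => n Nn.
rewrite invf_plt ?posrE//; apply: (lt_le_trans (truncnS_gt _)).
by rewrite ler_nat.
Qed.

End Limits.

Lemma rlim_lip {R : realType} {V W : normedModType (complex R)} (f : V -> W)
    (C : R) (u : nat -> V) (l : V) :
  (forall x y, rnorm (f x - f y) <= C * rnorm (x - y)) ->
  rlim u l -> rlim (f \o u) (f l).
Proof.
move=> fC ul e e0; have C1 : 0 < `|C| + 1 by have := normr_ge0 C; lra.
have [N hN] := ul _ (divr_gt0 e0 C1); exists N => n /hN /=.
rewrite ltr_pdivlMr// => h; apply: le_lt_trans (fC _ _) _.
apply: le_lt_trans h; rewrite mulrC ler_wpM2l ?rnorm_ge0//.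
by have := ler_norm C; lra.
Qed.

Lemma rcauchy_cvg {R : realType} {V : completeNormedModType (complex R)}
    (u : nat -> V) :
  (forall e : R, 0 < e -> exists N, forall n m, (N <= n)%N -> (N <= m)%N ->
     rnorm (u n - u m) < e) ->
  exists l, rlim u l.
Proof.
move=> h.
have cu : cauchy (u @ \oo).
  apply/cauchy_exP => e; rewrite /= ltcE => /andP[/eqP/= ie re].
  have [N hN] := h _ re.
  exists (u N); exists N => // n /= Nn; rewrite -ball_normE /= rnormE ltcE /= ie eqxx.
  exact: hN.
have /cvg_ex[/= l ul] : cvg (u @ \oo) by exact: cauchy_cvg.
exists l => e e0; have /cvg_rnormP/(_ _ e0)[N _ hN] := ul.
by exists N => n Nn; rewrite rnormB; exact: hN.
Qed.

(** * Square roots in a C*-algebra *)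

Section CStar.
Context {R : realType} {B : unitalCStarAlgType R}.
Implicit Types a b c d x y : B.

Lemma rnormM a b : rnorm (a * b) <= rnorm a * rnorm b.
Proof. by have := cnormM_le a b; rewrite !rnormE -rmorphM lecR. Qed.

Lemma rnorm_starM a : rnorm (star a * a) = rnorm a ^+ 2.
Proof. by have := cnorm_starM a; rewrite !rnormE -rmorphXn => /complexI. Qed.

Lemma rnorm_star a : rnorm (star a) = rnorm a.
Proof.
have h b : rnorm b <= rnorm (star b).
  have := rnormM (star b) b; rewrite rnorm_starM expr2.
  have := @rnorm_ge0 _ _ b; rewrite le_eqVlt => /predU1P[<-|b0].
    by rewrite rnorm_ge0.
  by rewrite ler_pM2r.
by apply/eqP; rewrite eq_le h andbT -{2}[a]starK h.
Qed.

Lemma rnorm_Mstar a : rnorm (a * star a) = rnorm a ^+ 2.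
Proof. by rewrite -{1}[a]starK rnorm_starM rnorm_star. Qed.

Lemma rnorm1_le1 : rnorm (1 : B) <= 1.
Proof.
have := rnorm_starM 1; rewrite star1 mulr1.
have := @rnorm_ge0 _ _ (1 : B); nra.
Qed.

Lemma starB a b : star (a - b) = star a - star b.
Proof. by rewrite starD starN. Qed.

Lemma starZr (r : R) a : star (r%:C *: a) = r%:C *: star a.
Proof. by rewrite starZ conj_Creal//; apply/complex_realP; exists r. Qed.

Definition sc (r : R) : B := r%:C *: (1 : B).

Lemma scl r a : sc r * a = r%:C *: a.
Proof. by rewrite /sc -cscalerAl mul1r. Qed.

Lemma scr r a : a * sc r = r%:C *: a.
Proof. by rewrite /sc -cscalerAr mulr1. Qed.

Lemma sc_comm r a : a * sc r = sc r * a.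
Proof. by rewrite scl scr. Qed.

Lemma star_sc r : star (sc r) = sc r.
Proof. by rewrite /sc starZr star1. Qed.

Lemma sc1 : sc 1 = 1.
Proof. by rewrite /sc scale1r. Qed.

Lemma scD r s : sc (r + s) = sc r + sc s.
Proof. by rewrite /sc rmorphD scalerDl. Qed.

Lemma scN r : sc (- r) = - sc r.
Proof. by rewrite /sc rmorphN scaleNr. Qed.

Lemma scB r s : sc (r - s) = sc r - sc s.
Proof. by rewrite scD scN. Qed.

Lemma sc0 : sc 0 = 0.
Proof. by rewrite /sc scale0r. Qed.

Lemma rnorm_sc r : rnorm (sc r) <= `|r|.
Proof. by rewrite rnormZr -[leRHS]mulr1 ler_wpM2l// rnorm1_le1. Qed.

Lemma rlimM (u v : nat -> B) l m :
  rlim u l -> rlim v m -> rlim (fun n => u n * v n) (l * m).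
Proof.
move=> ul vm e e0.
have := @rnorm_ge0 _ _ l; have := @rnorm_ge0 _ _ m => m0 l0.
have c0 : 0 < 1 + rnorm l + rnorm m by lra.
have e1 : 0 < Num.min 1 (e / (1 + rnorm l + rnorm m)).
  by rewrite lt_min ltr01 divr_gt0.
have [N hN] := ul _ e1; have [M hM] := vm _ e1.
exists (maxn N M) => n; rewrite geq_max => /andP[/hN + /hM].
rewrite !lt_min !ltr_pdivlMr// => /andP[u1 u2] /andP[v1 v2].
have -> : u n * v n - l * m = (u n - l) * (v n - m) + l * (v n - m) + (u n - l) * m.
  by rewrite -mulrDl subrK mulrBr mulrBl addrA subrK.
have h1 := rnormM (u n - l) (v n - m).
have h2 := rnormM l (v n - m); have h3 := rnormM (u n - l) m.
have h4 := rnormD ((u n - l) * (v n - m) + l * (v n - m)) ((u n - l) * m).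
have h5 := rnormD ((u n - l) * (v n - m)) (l * (v n - m)).
have := @rnorm_ge0 _ _ (u n - l); have := @rnorm_ge0 _ _ (v n - m); nra.
Qed.

Lemma rlim_star (u : nat -> B) l : rlim u l -> rlim (star \o u) (star l).
Proof.
by apply: (@rlim_lip _ _ _ star 1) => x y; rewrite -starB rnorm_star mul1r.
Qed.

Lemma rlimZ (k : R) (u : nat -> B) l : rlim u l ->
  rlim (fun n => k%:C *: u n) (k%:C *: l).
Proof.
apply: (@rlim_lip _ _ _ (fun x => k%:C *: x) `|k|) => x y.
by rewrite -scalerBr rnormZr.
Qed.

Definition sa a := star a = a.

Lemma saD a b : sa a -> sa b -> sa (a + b).
Proof. by rewrite /sa => ha hb; rewrite starD ha hb. Qed.

Lemma saN a : sa a -> sa (- a).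
Proof. by rewrite /sa => ha; rewrite starN ha. Qed.

Lemma saB a b : sa a -> sa b -> sa (a - b).
Proof. by move=> ha hb; apply: saD => //; apply: saN. Qed.

Lemma sa_sc r : sa (sc r). Proof. exact: star_sc. Qed.

Lemma saM a b : sa a -> sa b -> a * b = b * a -> sa (a * b).
Proof. by rewrite /sa => ha hb ab; rewrite starM ha hb ab. Qed.

Lemma sa_starM a : sa (star a * a).
Proof. by rewrite /sa starM starK. Qed.

Lemma sa_lim (u : nat -> B) l : (forall n, sa (u n)) -> rlim u l -> sa l.
Proof.
move=> hu ul; apply: (@rlim_uniq _ _ u _ _ _ ul).
by apply: eq_rlim (rlim_star ul) => n /=; exact: hu.
Qed.

Lemma comm_lim (u : nat -> B) l c :
  (forall n, c * u n = u n * c) -> rlim u l -> c * l = l * c.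
Proof.
move=> hu ul; have h1 := rlimM (rlim_cst c) ul; have h2 := rlimM ul (rlim_cst c).
by apply: (rlim_uniq h1); apply: eq_rlim h2 => n; rewrite hu.
Qed.

(* The scalar majorant of the iteration [sqrt_it] below, at x = 1. *)
Fixpoint sqrt_maj n : R := if n is m.+1 then (1 + sqrt_maj m ^+ 2) / 2 else 0.

(** The defect d = 1 - t evolves by d |-> d - d^2/2, which decays like 2/n. The iteration therefore
    converges even for |x| = 1, where no geometric rate is available. *)
Lemma sqrt_maj_bnd n :
  [/\ 0 <= sqrt_maj n, sqrt_maj n <= 1 & 1 - sqrt_maj n <= 2 / n.+2%:R].
Proof.
elim: n => [|n [h0 h1 h2]] /=; first by split => //; lra.
split; [nra|nra|].
set t := sqrt_maj n in h0 h1 h2 *.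
rewrite ler_pdivlMr//; move: h2; rewrite ler_pdivlMr// -[n.+3]addn3 -[n.+2]addn2 !natrD.
have := @ler0n R n; move: (n%:R) => k k0 h2.
have := @mulr_ge0 _ (1-t) (2 - (1 - t) * (k + 2)).
nra.
Qed.

(** A limit y solves 2 y = x + y^2, that is, (1 - y)^2 = 1 - x. The iterates are polynomials in x
    with nonnegative coefficients, so they commute with everything that commutes with x and are
    dominated in norm by their values at 1. *)
Fixpoint sqrt_it x n : B :=
  if n is m.+1 then (2^-1 : R)%:C *: (x + sqrt_it x m * sqrt_it x m) else 0.

Lemma sqrt_it_comm x c n : c * x = x * c -> c * sqrt_it x n = sqrt_it x n * c.
Proof.
move=> cx; elim: n => [|n IH] /=; first by rewrite mulr0 mul0r.
by rewrite -cscalerAr -cscalerAl mulrDr mulrDl cx mulrA IH -mulrA IH mulrA.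
Qed.

Lemma sa_sqrt_it x n : sa x -> sa (sqrt_it x n).
Proof.
move=> hx; elim: n => [|n IH] /=; first exact: star0.
by rewrite /sa starZr starD starM hx IH.
Qed.

Lemma sqrt_it_norm x n : rnorm x <= 1 -> rnorm (sqrt_it x n) <= sqrt_maj n.
Proof.
move=> x1; elim: n => [|n IH] /=; first by rewrite rnorm0.
rewrite rnormZr ger0_norm; last lra.
have := rnormD x (sqrt_it x n * sqrt_it x n).
have := rnormM (sqrt_it x n) (sqrt_it x n).
have := @rnorm_ge0 _ _ (sqrt_it x n); nra.
Qed.

(** The increments of the iteration and of its majorant factor in the same way, as half a difference
    of squares; the estimate passes through this factorization by induction. *)
Lemma sqrt_it_step x n : rnorm x <= 1 ->
  rnorm (sqrt_it x n.+1 - sqrt_it x n) <= sqrt_maj n.+1 - sqrt_maj n.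
Proof.
move=> x1; elim: n => [|n IH].
  rewrite /= mul0r addr0 subr0 rnormZr ger0_norm; last lra.
  by rewrite expr0n addr0 subr0; lra.
have cc : sqrt_it x n.+1 * sqrt_it x n = sqrt_it x n * sqrt_it x n.+1.
  by apply: sqrt_it_comm; apply/esym; apply: sqrt_it_comm.
have -> : sqrt_it x n.+2 - sqrt_it x n.+1 = (2^-1 : R)%:C *:
    ((sqrt_it x n.+1 - sqrt_it x n) * (sqrt_it x n.+1 + sqrt_it x n)).
  rewrite [sqrt_it x n.+2]/= [in X in _ - X]/= -scalerBr; congr (_ *: _).
  rewrite -/(sqrt_it x n.+1) opprD addrACA subrr add0r.
  by rewrite mulrDr !mulrBl cc addrA subrK.
rewrite rnormZr ger0_norm; last lra.
have h := rnormM (sqrt_it x n.+1 - sqrt_it x n) (sqrt_it x n.+1 + sqrt_it x n).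
have h' := rnormD (sqrt_it x n.+1) (sqrt_it x n).
have := sqrt_it_norm n x1; have := sqrt_it_norm n.+1 x1.
have := @rnorm_ge0 _ _ (sqrt_it x n.+1 - sqrt_it x n).
have := @rnorm_ge0 _ _ (sqrt_it x n.+1 + sqrt_it x n).
have -> : sqrt_maj n.+2 - sqrt_maj n.+1 =
  2^-1 * ((sqrt_maj n.+1 - sqrt_maj n) * (sqrt_maj n.+1 + sqrt_maj n)).
  rewrite [sqrt_maj n.+2]/= -/(sqrt_maj n.+1).
  have -> : sqrt_maj n.+1 = (1 + sqrt_maj n ^+ 2) / 2 by [].
  by field.
move=> a0 b0 c1 c2; rewrite ler_wpM2l//; first lra.
apply: (le_trans h); apply: ler_pM => //; lra.
Qed.

Lemma sqrt_it_cauchy x n k : rnorm x <= 1 ->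
  rnorm (sqrt_it x (k + n) - sqrt_it x n) <= sqrt_maj (k + n) - sqrt_maj n.
Proof.
move=> x1; elim: k => [|k IH]; first by rewrite add0n !subrr rnorm0.
have := rnorm_tri (sqrt_it x (k + n)) (sqrt_it x (k.+1 + n)) (sqrt_it x n).
by have := sqrt_it_step (k + n) x1; rewrite addSn; lra.
Qed.

(** The bound on 1 - s later certifies that the root is itself positive, and the commutation clause
    does the work of a functional calculus. *)
Lemma sqrt_one_sub x : sa x -> rnorm x <= 1 ->
  exists s, [/\ sa s, rnorm (1 - s) <= 1, s * s = 1 - x
    & forall c, c * x = x * c -> c * s = s * c].
Proof.
move=> hx x1.
have [y hy] : exists y, rlim (sqrt_it x) y.
  apply: rcauchy_cvg => e e0; have [N hN] := inv_small (divr_gt0 e0 (ltr0n R 2)).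
  have main n m : (N <= n)%N -> (n <= m)%N -> rnorm (sqrt_it x m - sqrt_it x n) < e.
    move=> Nn nm; rewrite -(subnK nm).
    apply: le_lt_trans (sqrt_it_cauchy _ _ x1) _.
    have [_ h1 _] := sqrt_maj_bnd (m - n + n).
    have [_ _ h2] := sqrt_maj_bnd n.
    apply: (@le_lt_trans _ _ (2 / n.+2%:R)); first by apply: le_trans h2; rewrite lerD2r.
    by rewrite -ltr_pdivlMl// mulrC; apply: hN; exact: leqW.
  exists N => n m Nn Nm; case: (leqP n m) => nm; last by apply: main => //; exact: ltnW.
  by rewrite rnormB; apply: main.
have yE : y = (2^-1 : R)%:C *: (x + y * y).
  apply: (@rlim_uniq _ _ (fun n => sqrt_it x n.+1)).
    by move=> e /hy[N hN]; exists N => n Nn; apply: hN; exact: leqW.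
  by apply: rlimZ; apply: rlimD; [exact: rlim_cst|exact: rlimM].
have y2 : y + y = x + y * y.
  by rewrite {1 2}yE -scalerDl -rmorphD (_ : _ + _ = 1) ?scale1r//; field.
exists (1 - y); split.
- apply: saB; first exact: star1.
  by apply: (@sa_lim (sqrt_it x)) => // n; exact: sa_sqrt_it.
- rewrite opprB addrC subrK; apply: rlim_bound hy => n.
  by have [_ h _] := sqrt_maj_bnd n; apply: le_trans (sqrt_it_norm n x1) h.
- have -> : x = y + y - y * y by rewrite y2 addrK.
  rewrite mulrBr mulr1 mulrBl mul1r !opprD !opprK -!addrA; congr (_ + (_ + _)).
- move=> c cx; rewrite mulrBr mulrBl mulr1 mul1r; congr (_ - _).
  by apply: (@comm_lim (sqrt_it x)) => // n; exact: sqrt_it_comm.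
Qed.

End CStar.

(** * Positive elements *)

Section Positive.
Context {R : realType} {B : unitalCStarAlgType R}.
Implicit Types a b c d x y : B.

(** Squares of self-adjoint elements allow sums, limits and roots to be treated before it is known
    that every c^* c is positive; [cstar_posE] identifies the two notions afterwards. *)
Definition spos a := exists2 b, sa b & a = b * b.

Lemma spos_sa a : spos a -> sa a.
Proof. by move=> [b hb ->]; apply: saM. Qed.

(** Rescaling: x = (r - a)/r has norm at most 1 and a = r (1 - x), so the root is sqrt r times that
    of 1 - x. The radius r' is returned so that the root meets the same criterion again. *)
Lemma sqrt_pos a (r : R) : sa a -> 0 <= r -> rnorm (sc r - a) <= r ->
  exists s, [/\ sa s, exists2 r', 0 <= r' & rnorm (sc r' - s) <= r', s * s = a
    & forall c, c * a = a * c -> c * s = s * c].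
Proof.
move=> ha; rewrite le_eqVlt => /predU1P[r0|r0] h; first subst r.
  have a0 : a = 0.
    have := @rnorm_ge0 _ _ (sc 0 - a); rewrite sc0 sub0r in h * => h'.
    by rewrite -[a]opprK (@rnorm0_eq0 _ _ (- a)) ?oppr0//; lra.
  exists 0; split; rewrite ?a0 ?mul0r//; first exact: star0.
    by exists 0; rewrite // sc0 subrr rnorm0.
have r1 : r != 0 by rewrite gt_eqF//.
set x := (r^-1)%:C *: (sc r - a).
have xE : r%:C *: (1 - x) = a.
  rewrite /x scalerBr scalerA -rmorphM mulfV// scale1r -/(sc r).
  by rewrite opprB addrC subrK.
have hx : sa x by rewrite /sa /x starZr (saB (sa_sc _) ha).
have x1 : rnorm x <= 1.
  rewrite rnormZr ger0_norm ?invr_ge0 ?(ltW r0)//.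
  by rewrite ler_pdivrMl// mulr1.
have [s [hs s1 ss sc_]] := sqrt_one_sub hx x1.
exists ((Num.sqrt r)%:C *: s); split.
- by rewrite /sa starZr hs.
- exists (Num.sqrt r); first exact: sqrtr_ge0.
  rewrite /sc -scalerBr rnormZr ger0_norm ?sqrtr_ge0//.
  by rewrite -[leRHS]mulr1 ler_wpM2l ?sqrtr_ge0.
- rewrite -cscalerAl -cscalerAr scalerA -rmorphM -expr2 sqr_sqrtr ?ltW//.
  by rewrite ss xE.
- move=> c ca; rewrite -cscalerAr -cscalerAl sc_// /x -cscalerAr -cscalerAl.
  by rewrite mulrBr mulrBl ca sc_comm.
Qed.

Lemma spos_crit a (r : R) : sa a -> 0 <= r -> rnorm (sc r - a) <= r -> spos a.
Proof. by move=> ha r0 /(sqrt_pos ha r0)[s [hs _ <- _]]; exists s. Qed.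

(** The element u = a + i s satisfies u^* u = r^2, so |u| <= r, and a is the real part of u. *)
Lemma sa_circle a s (r : R) : sa a -> sa s -> s * a = a * s -> 0 <= r ->
  s * s + a * a = sc (r ^+ 2) -> rnorm a <= r.
Proof.
move=> ha hs sas r0 E; pose u := a + 'i *: s.
have su : star u = a - 'i *: s.
  by rewrite /u starD starZ ha hs conjCi scaleNr.
have uu : star u * u = sc (r ^+ 2).
  rewrite su /u mulrDr mulrBl mulrBl -!cscalerAl -!cscalerAr scalerA.
  have -> : 'i * 'i = -1 :> complex R by rewrite -expr2 sqrCi.
  by rewrite -E sas scaleN1r opprK addrA subrK addrC.
have ur : rnorm u <= r.
  rewrite -(@ler_pXn2r _ 2%N)// ?nnegrE ?rnorm_ge0// -rnorm_starM uu.
  by apply: le_trans (rnorm_sc _) _; rewrite ger0_norm// sqr_ge0.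
have -> : a = (2^-1 : R)%:C *: (u + star u).
  rewrite su /u addrACA subrr addr0 scalerDr -scalerDl -rmorphD.
  by rewrite (_ : _ + _ = 1 :> R) ?scale1r//; field.
rewrite rnormZr ger0_norm; last lra.
have := rnormD u (star u); rewrite rnorm_star; lra.
Qed.

(** Converse of the criterion. Since r^2 - a^2 is within r^2 of r^2, it has a root s commuting with
    a, and s lies on the circle of radius r with a, whence |s| <= r. *)
Lemma rnorm_sc_sub_sqr a (r : R) : sa a -> rnorm a <= r ->
  rnorm (sc (r ^+ 2) - a * a) <= r ^+ 2.
Proof.
move=> ha ar; have r0 : 0 <= r by apply: le_trans ar; exact: rnorm_ge0.
have h : rnorm (sc (r ^+ 2) - (sc (r ^+ 2) - a * a)) <= r ^+ 2.
  rewrite opprB addrC subrK expr2; apply: (le_trans (rnormM _ _)).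
  by rewrite ler_pM ?rnorm_ge0.
have [|s [hs _ ss sc_]] := sqrt_pos _ (sqr_ge0 _) h.
  by apply: saB; [exact: sa_sc|exact: saM].
have sas : s * a = a * s.
  by apply/esym/sc_; rewrite mulrBr mulrBl sc_comm mulrA.
have : rnorm s <= r.
  by apply: (@sa_circle s a); rewrite ?sas// ss addrC subrK.
move=> sr; rewrite -ss expr2; apply: (le_trans (rnormM _ _)).
by rewrite ler_pM ?rnorm_ge0.
Qed.

Lemma spos_norm a (r : R) : spos a -> rnorm a <= r -> rnorm (sc r - a) <= r.
Proof.
move=> [b hb ->] ar; have r0 : 0 <= r by apply: le_trans ar; exact: rnorm_ge0.
rewrite -(sqr_sqrtr r0); apply: rnorm_sc_sub_sqr => //.
rewrite -(@ler_pXn2r _ 2%N)// ?nnegrE ?rnorm_ge0 ?sqrtr_ge0//.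
rewrite -rnorm_starM hb; apply: le_trans ar _.
by rewrite -{1}(sqr_sqrtr r0) lexx.
Qed.

Lemma spos_sqrt a : spos a ->
  exists s, [/\ sa s, spos s, s * s = a & forall c, c * a = a * c -> c * s = s * c].
Proof.
move=> pa; have [s [hs [r r0 sr] ss sc_]] :=
  sqrt_pos (spos_sa pa) (rnorm_ge0 a) (spos_norm pa (lexx _)).
by exists s; split => //; apply: spos_crit sr.
Qed.

Lemma spos0 : spos 0.
Proof. by exists 0; rewrite ?mul0r//; exact: star0. Qed.

Lemma sposD a b : spos a -> spos b -> spos (a + b).
Proof.
move=> pa pb; apply: (@spos_crit _ (rnorm a + rnorm b)).
- by apply: saD; apply: spos_sa.
- by rewrite addr_ge0 ?rnorm_ge0.
- rewrite scD opprD addrACA; apply: (le_trans (rnormD _ _)).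
  by rewrite lerD// spos_norm.
Qed.

Lemma sposZ (k : R) a : 0 <= k -> spos a -> spos (k%:C *: a).
Proof.
move=> k0 [b hb ->]; exists ((Num.sqrt k)%:C *: b); first by rewrite /sa starZr hb.
by rewrite -cscalerAl -cscalerAr scalerA -rmorphM -(expr2 (Num.sqrt k)) sqr_sqrtr.
Qed.

(** The criterion |r - a| <= r is a closed condition, and convergence bounds a tail of the sequence,
    so one radius serves all its terms. *)
Lemma spos_lim (u : nat -> B) l : (forall n, spos (u n)) -> rlim u l -> spos l.
Proof.
move=> pu ul; have [N hN] := ul _ ltr01.
have vl : rlim (fun n => u (n + N)%N) l.
  by move=> e /ul[M hM]; exists M => n Mn; apply: hM; rewrite (leq_trans Mn)// leq_addr.
have ub n : rnorm (u (n + N)%N) <= rnorm l + 1.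
  by have := hN (n + N)%N (leq_addl _ _); have := rnorm_sub (u (n + N)%N) l; lra.
apply: (@spos_crit _ (rnorm l + 1)).
- by apply: sa_lim ul => n; apply: spos_sa.
- by have := rnorm_ge0 l; lra.
- apply: (@rlim_bound _ _ (fun n => sc (rnorm l + 1) - u (n + N)%N)).
    by move=> n; apply: spos_norm.
  move=> e /vl[M hM]; exists M => n /hM h.
  by rewrite opprB addrC subrKA rnormB.
Qed.

Lemma spos_sub a (r : R) : sa a -> rnorm a <= r -> spos (sc r - a).
Proof.
move=> ha ar; apply: (@spos_crit _ r).
- by apply: saB => //; exact: sa_sc.
- by apply: le_trans ar; exact: rnorm_ge0.
- by rewrite opprB addrC subrK.
Qed.

Lemma spos_conj a c : spos a -> sa c -> c * a = a * c -> spos (c * a * c).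
Proof.
move=> /spos_sqrt[s [hs _ <- sc_]] hc /sc_ cs; exists (c * s); first exact: saM.
by rewrite -!mulrA -cs.
Qed.

(** The roots b of a and h of r - a commute and satisfy b^2 + h^2 = r, so the circle estimate bounds
    b by sqrt r. *)
Lemma spos_le_norm a (r : R) : 0 <= r -> spos a -> spos (sc r - a) -> rnorm a <= r.
Proof.
move=> r0 /spos_sqrt[b [hb _ <- bc]] /spos_sqrt[h [hh _ hE hc]].
have bh : b * h = h * b by apply: hc; rewrite mulrBr mulrBl mulrA sc_comm.
have : rnorm b <= Num.sqrt r.
  apply: (@sa_circle b h) => //; first exact: sqrtr_ge0.
  by rewrite sqr_sqrtr// hE subrK.
move=> br; rewrite -[leRHS](sqr_sqrtr r0) expr2; apply: (le_trans (rnormM _ _)).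
by rewrite ler_pM ?rnorm_ge0.
Qed.

Lemma spos_le a b : spos a -> spos (b - a) -> rnorm a <= rnorm b.
Proof.
move=> pa pba; have hb : sa b.
  by rewrite -(subrK a b); apply: saD; apply: spos_sa.
apply: spos_le_norm (rnorm_ge0 _) pa _.
rewrite -[sc _](subrK b) -addrA; apply: sposD => //; exact: spos_sub.
Qed.

Lemma sa_sqr0 b : sa b -> b * b = 0 -> b = 0.
Proof.
move=> hb bb; apply/rnorm0_eq0/eqP; rewrite -sqrf_eq0 -rnorm_starM hb bb.
by rewrite rnorm0.
Qed.

(** Bernoulli's inequality in the form q^n (1 + n (1 - q)) <= 1. *)
Lemma geom_small (q e : R) : 0 <= q -> q < 1 -> 0 < e -> exists n, q ^+ n < e.
Proof.
move=> q0 q1 e0; have h n : q ^+ n * (1 + n%:R * (1 - q)) <= 1.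
  elim: n => [|n IH]; first by rewrite expr0 mul0r addr0 mul1r.
  have h : q ^+ n.+1 <= 1 by rewrite exprn_ile1// ltW.
  rewrite -natr1; have -> : q ^+ n.+1 * (1 + (n%:R + 1) * (1 - q)) =
    q * (q ^+ n * (1 + n%:R * (1 - q))) + q ^+ n.+1 * (1 - q) by rewrite exprS; ring.
  move: (q ^+ n.+1) h => z; nra.
have e1 : 0 < e * (1 - q) by rewrite mulr_gt0// subr_gt0.
have [n /(_ n (leqnn _)) hn] := inv_small e1.
exists n.+1; have := h n.+1.
move: hn; rewrite invf_plt ?posrE// => hn.
have qn : 0 <= q ^+ n.+1 by rewrite exprn_ge0.
have k0 : 1 < e * (n.+1%:R * (1 - q)).
  by move: hn; rewrite -[X in X < _]mul1r ltr_pdivrMr// mulrCA.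
move: (n.+1%:R * (1 - q)) k0 (q ^+ n.+1) qn => k k0 z z0 hz.
have kp : 0 < k by rewrite -(pmulr_rgt0 _ e0); lra.
rewrite -(ltr_pM2r kp); nra.
Qed.

Lemma neumann z (r : R) : 0 < r -> rnorm (sc r - z) < r ->
  exists y, y * z = 1 /\ z * y = 1.
Proof.
move=> r0 hr; have r1 : r != 0 by rewrite gt_eqF.
pose x := (r^-1)%:C *: (sc r - z); pose q := rnorm x.
have xE : r%:C *: (1 - x) = z.
  rewrite /x scalerBr scalerA -rmorphM mulfV// scale1r -/(sc r).
  by rewrite opprB addrC subrK.
have q1 : q < 1.
  rewrite /q rnormZr ger0_norm ?invr_ge0 ?(ltW r0)//.
  by rewrite ltr_pdivrMl// mulr1.
have q0 : 0 <= q := rnorm_ge0 _.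
pose fix v n : B := if n is m.+1 then 1 + x * v m else 0.
have vx n : x * v n = v n * x.
  elim: n => [|n IH] /=; first by rewrite mulr0 mul0r.
  by rewrite mulrDr mulrDl mulr1 mul1r -[x * v n * x]mulrA -IH.
have vb n : rnorm (v n) * (1 - q) <= 1.
  elim: n => [|n IH] /=; first by rewrite rnorm0 mul0r.
  have := rnormD (1 : B) (x * v n); have := @rnorm1_le1 _ B.
  have := rnormM x (v n); rewrite -/q => h1 h2 h3.
  apply: (@le_trans _ _ ((1 + q * rnorm (v n)) * (1 - q))); last nra.
  rewrite ler_wpM2r//; lra.
have vd n k : rnorm (v (k + n)%N - v n) * (1 - q) <= q ^+ n.
  elim: n => [|n IH]; first by rewrite addn0 subr0 expr0.
  rewrite addnS /= opprD addrACA subrr add0r -mulrBr exprS.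
  apply: (@le_trans _ _ (q * rnorm (v (k + n)%N - v n) * (1 - q))).
    by rewrite ler_wpM2r ?rnormM//; lra.
  by rewrite -mulrA ler_wpM2l.
have [l hl] : exists l, rlim v l.
  apply: rcauchy_cvg => e e0.
  have [|N hN] := @geom_small q (e * (1 - q)) q0 q1; first by rewrite mulr_gt0// subr_gt0.
  have main n m : (N <= n)%N -> (n <= m)%N -> rnorm (v n - v m) < e.
    move=> Nn nm; rewrite rnormB -(subnK nm) -(@ltr_pM2r _ (1 - q)) ?subr_gt0//.
    apply: le_lt_trans (vd _ _) _; apply: le_lt_trans hN.
    by apply: ler_wiXn2l => //; exact: ltW.
  exists N => n m Nn Nm; case: (leqP n m) => nm; first exact: main.
  by rewrite rnormB; apply: main => //; exact: ltnW.
have lE : l = 1 + x * l.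
  apply: (@rlim_uniq _ _ (fun n => v n.+1)).
    by move=> e /hl[N hN]; exists N => n Nn; apply: hN; exact: leqW.
  by apply: rlimD; [exact: rlim_cst|apply: rlimM => //; exact: rlim_cst].
have xl : x * l = l * x by apply: comm_lim hl => n.
have l1 : (1 - x) * l = 1 by rewrite mulrBl mul1r {1}lE addrK.
exists ((r^-1)%:C *: l); rewrite -xE -!cscalerAl -!cscalerAr !scalerA -rmorphM.
rewrite mulVf// -rmorphM mulfV// !scale1r l1; split => //.
by rewrite mulrBr mulr1 -xl {1}lE addrK.
Qed.

Lemma inv_comm z y c : y * z = 1 -> z * y = 1 -> c * z = z * c -> c * y = y * c.
Proof.
by move=> yz zy cz; rewrite -[RHS]mulr1 -zy mulrA -[y * c * z]mulrA cz mulrA yz mul1r.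
Qed.

Lemma inv_sa z y : y * z = 1 -> z * y = 1 -> sa z -> sa y.
Proof.
move=> yz zy hz; rewrite /sa -[LHS]mulr1 -zy mulrA -{1}hz -starM zy star1 mul1r //.
Qed.

Fact sqr_polar d b : (d + b) * (d + b) - (d - b) * (d - b) =
  (d * b + b * d) + (d * b + b * d).
Proof.
rewrite [(d + b) * _]mulrDl [(d - b) * _]mulrBl opprB [b * (d - b) - _]addrC.
rewrite addrACA -mulrBr -mulrDr opprB [d + b + (b - d)]addrC subrKA.
by rewrite [d + b + _]addrACA subrr addr0 !mulrDr addrACA.
Qed.

(* Jacobson: M - d d^* inherits invertibility from M - d^* d = M + p, and an
   invertible positive element is bounded below, contradicting M = |d d^*|. *)
Lemma star_neg_eq0 d p : spos p -> star d * d = - p -> d = 0.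
Proof.
move=> pp dp; pose q := d * star d.
have hq : sa q by rewrite /sa /q starM starK.
pose M := rnorm q.
have [M0|M0] := eqVneq M 0.
  by apply/rnorm0_eq0/eqP; rewrite -sqrf_eq0 -rnorm_Mstar -/q -/M M0.
have {}M0 : 0 < M by rewrite lt_def M0 rnorm_ge0.
(* With h and k twice the real part and, up to sign, twice the imaginary part of d, h^2 + k^2 = 2 (d
   d^* + d^* d) = 2 (q - p). Hence q is half of a sum of squares plus p. *)
have pq : spos q.
  pose h := d + star d; pose k := 'i *: (d - star d).
  have hh : sa h by rewrite /sa /h starD starK addrC.
  have hk : sa k.
    by rewrite /sa /k starZ conjCi starB starK scaleNr -scalerN opprB.
  have E : h * h + k * k = (q - p) + (q - p).
    rewrite /h /k -cscalerAl -cscalerAr scalerA.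
    have -> : 'i * 'i = -1 :> complex R by rewrite -expr2 sqrCi.
    by rewrite scaleN1r sqr_polar -/q dp.
  have -> : q = (2^-1 : R)%:C *: (h * h + k * k) + p.
    rewrite E scalerDr -scalerDl -rmorphD.
    by rewrite (_ : _ + _ = 1 :> R) ?scale1r ?subrK//; field.
  by apply: sposD => //; apply: sposZ; [lra|apply: sposD; [exists h|exists k]].
have [y [yz zy]] : exists y, y * (sc M + p) = 1 /\ (sc M + p) * y = 1.
  have M1 : 0 < M + rnorm p by have := rnorm_ge0 p; lra.
  apply: (neumann M1); rewrite scD opprD addrACA subrr add0r.
  by apply: le_lt_trans (spos_norm pp (lexx _)) _; lra.
(* Jacobson's formula: an inverse of M - d d^* is built from the inverse y of M - d^* d. *)
pose g := (M^-1)%:C *: (1 + d * y * star d).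
have fg : (sc M - q) * g = 1.
  have E : (sc M - q) * (d * y * star d) = d * ((sc M + p) * y) * star d.
    by rewrite -[p]opprK -dp !mulrA mulrBr mulrBl sc_comm /q !mulrA.
  rewrite /g -cscalerAr mulrDr mulr1 E zy mulr1 -/q subrK.
  by rewrite scalerA -rmorphM mulVf ?gt_eqF// scale1r.
have hg : sa g.
  have hy : sa y by apply: inv_sa yz zy _; apply: saD; [exact: sa_sc|exact: spos_sa].
  by rewrite /sa /g starZr starD star1 !starM starK mulrA hy.
have hMq : sa (sc M - q) by apply: saB => //; exact: sa_sc.
have gf : g * (sc M - q) = 1 by rewrite -star1 -fg starM hg hMq.
have [f [hf _ ff fc]] := spos_sqrt (spos_sub hq (lexx _)).
rewrite -/M in ff fc.
have fgc : f * g = g * f.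
  by apply: inv_comm gf fg _; rewrite -ff mulrA.
(* Since f commutes with g and f^2 inverts g, f (K - g) f = K (M - q) - 1. Its positivity lowers the
   bound on q to M - 1/K; the summand 1/M ensures that K > 0 and 1/K <= M. *)
pose K : R := rnorm g + M^-1.
have K0 : 0 < K by rewrite ltr_wpDl ?rnorm_ge0 ?invr_gt0.
have kf : spos (f * (sc K - g) * f).
  apply: spos_conj => //; last by rewrite mulrBr mulrBl sc_comm fgc.
  by apply: spos_sub => //; rewrite /K lerDl invr_ge0 ltW.
have : rnorm q <= M - K^-1.
  apply: spos_le_norm => //.
    rewrite subr_ge0 invf_ple ?posrE// /K.
    by rewrite lerDr rnorm_ge0.
  have -> : sc (M - K^-1) - q = (K^-1)%:C *: (f * (sc K - g) * f).
    rewrite mulrBr mulrBl sc_comm -mulrA ff -[f * g * f]mulrA -fgc mulrA ff fg.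
    by rewrite scl scalerBr scalerA -rmorphM mulVf ?gt_eqF// scale1r scB addrAC.
  by apply: sposZ => //; rewrite invr_ge0 ltW.
by rewrite -/M lerDl oppr_ge0 leNgt invr_gt0 K0.
Qed.

(** Let m = |a| be the root of a^2 and v = m - a, twice the negative part of a. Then v a = - m v, so
    (c v)^* (c v) = - m v^2 = - (h v)^2 with h the root of m. [star_neg_eq0] gives c v = 0, hence m
    v = 0, v^2 = 0 and a = m. *)
Lemma spos_starM c : spos (star c * c).
Proof.
pose a := star c * c.
have ha : sa a by exact: sa_starM.
have [|m [hm pm mm mc]] := @spos_sqrt (a * a); first by exists a.
have [h [hh _ hE hc]] := spos_sqrt pm.
have ma : m * a = a * m by apply/esym; apply: mc; rewrite mulrA.
pose v := m - a.
have hv : sa v by exact: saB.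
have mv : m * v = v * m by rewrite mulrBr mulrBl ma.
have hvc : h * v = v * h by apply/esym; apply: hc.
have hvhv : h * v * (h * v) = m * v * v.
  by rewrite {1}hvc -mulrA [h * (h * v)]mulrA hE mulrA -mv.
have va : v * a = - (m * v) by rewrite mulrBl mulrBr mm opprB.
have hv0 : h * v = 0.
  apply: sa_sqr0; first exact: saM.
  have d0 : c * v = 0.
    apply: (@star_neg_eq0 _ (h * v * (h * v))); first by exists (h * v) => //; exact: saM.
    rewrite starM hv mulrA -[v * star c * c]mulrA -/a va.
    by rewrite mulNr hvhv.
  have : star (c * v) * (c * v) = 0 by rewrite d0 mulr0.
  rewrite starM hv mulrA -[v * star c * c]mulrA -/a va mulNr => /eqP.
  rewrite oppr_eq0 => /eqP.
  by rewrite hvhv.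
have mv0 : m * v = 0 by rewrite -hE -mulrA hv0 mulr0.
have v0 : v = 0.
  by apply: sa_sqr0 => //; rewrite {2}/v mulrBr -mv va mv0 oppr0 subr0.
by rewrite -/a -[a](subrK m) -opprB -/v v0 oppr0 add0r.
Qed.

End Positive.

(** * Semi-inner products with values in B *)

Section PositiveCone.
Context {R : realType} {B : unitalCStarAlgType R}.
Implicit Types a b c : B.

Lemma cstar_posE a : cstar_pos a <-> spos a.
Proof.
split=> [[c ->]|[b hb ->]]; first exact: spos_starM.
by exists b; rewrite hb.
Qed.

Lemma spos_star_conj a c : spos a -> spos (star c * a * c).
Proof.
move=> [b hb ->]; rewrite !mulrA -[star c * b * b * c]mulrA -{1}hb -starM.
exact: spos_starM.
Qed.

Lemma spos_sub_starM c : spos (sc (rnorm c ^+ 2) - star c * c).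
Proof. by apply: spos_sub; [exact: sa_starM|rewrite rnorm_starM]. Qed.

(** The witness is a^(-1/2), used to normalise vectors that are almost unit vectors. With s the root
    of a, 1 - a = (1 - s)(1 + s) and (1 + s)^2 >= 1 give |1 - s| <= |1 - a|, and b - 1 = b (1 - s)
    gives the estimate. *)
Lemma inv_sqrt a : spos a -> rnorm (1 - a) < 1 ->
  exists b, star b * a * b = 1 /\ rnorm (b - 1) * (1 - rnorm (1 - a)) <= rnorm (1 - a).
Proof.
move=> pa a1; have [|y [ya ay]] := @neumann _ _ a 1 ltr01; first by rewrite sc1.
have [s [hs ps ss sa_]] := spos_sqrt pa.
have hy := inv_sa ya ay (spos_sa pa).
have as_ : a * s = s * a by rewrite -ss mulrA.
have sy : s * y = y * s by apply: (inv_comm ya ay).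
exists (s * y); split.
  rewrite starM hs hy -ss.
  by rewrite -!mulrA [s * (s * _)]mulrA ss [s * (s * _)]mulrA ss [a * (a * _)]mulrA -mulrA ay mulr1 ya.
have s1 : rnorm (1 - s) <= rnorm (1 - a).
  apply: le_of_sqr; first exact: rnorm_ge0.
  have h1 : sa (1 - s) by apply: saB => //; exact: star1.
  have h2 : sa (1 - a) by apply: saB; [exact: star1|exact: spos_sa].
  rewrite -!rnorm_starM h1 h2; apply: spos_le; first by exists (1 - s).
  have -> : (1 - a) * (1 - a) - (1 - s) * (1 - s) = (1 - s) * (s + s + a) * (1 - s).
    have cs : (1 - s) * (1 + s) = (1 + s) * (1 - s).
      rewrite mulrBl mul1r mulrDr mulr1 opprD addrA addrK.
      by rewrite mulrDl mul1r mulrBr mulr1 addrA subrK.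
    have -> : 1 - a = (1 - s) * (1 + s).
      by rewrite mulrBl mul1r mulrDr mulr1 opprD addrA addrK ss.
    rewrite {2}cs mulrA -[(1 - s) * (1 + s) * (1 + s)]mulrA.
    rewrite -[X in _ - X * _]mulr1 -mulrBl -mulrBr; congr (_ * _ * _).
    by rewrite mulrDl mul1r mulrDr mulr1 ss -[1 + s + _]addrA [1 + (_ + _)]addrC addrK addrA.
  apply: spos_conj => //; first by apply: sposD => //; exact: sposD.
  rewrite mulrBl mul1r mulrBr mulr1; congr (_ - _).
  by rewrite !mulrDl !mulrDr as_.
have bE : s * y - 1 = s * y * (1 - s).
  by rewrite mulrBr mulr1 sy -mulrA ss ya.
have := rnormM (s * y) (1 - s); rewrite -bE.
have := rnorm_sub (s * y) 1; have := @rnorm1_le1 _ B.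
have := rnorm_ge0 (1 - s); have := rnorm_ge0 (s * y - 1); have := rnorm_ge0 (s * y).
nra.
Qed.

End PositiveCone.

Section PreHilbert.
Context {R : realType} (B : unitalCStarAlgType R).

(* No module axioms are required of the operations: they are only seen through
   the kernel [ph_ip]. *)
Record preHilbert := PreHilbert {
  ph_car :> Type;
  ph_pt : ph_car;
  ph_add : ph_car -> ph_car -> ph_car;
  ph_scale : complex R -> ph_car -> ph_car;
  ph_ract : ph_car -> B -> ph_car;
  ph_ip : ph_car -> ph_car -> B;
  ph_ipD : forall x y z, ph_ip x (ph_add y z) = ph_ip x y + ph_ip x z;
  ph_ipZ : forall k x y, ph_ip x (ph_scale k y) = k *: ph_ip x y;
  ph_ipr : forall x y b, ph_ip x (ph_ract y b) = ph_ip x y * b;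
  ph_star : forall x y, star (ph_ip x y) = ph_ip y x;
  ph_pos : forall x, spos (ph_ip x x)
}.

Section Theory.
Context {X : preHilbert}.
Implicit Types x y z : X.

Lemma ph_ipDl x y z : ph_ip (ph_add x y) z = ph_ip x z + ph_ip y z.
Proof. by rewrite -ph_star ph_ipD starD !ph_star. Qed.

Lemma ph_ipZl k x y : ph_ip (ph_scale k x) y = k^* *: ph_ip x y.
Proof. by rewrite -ph_star ph_ipZ starZ ph_star. Qed.

Lemma ph_iprl x y b : ph_ip (ph_ract x b) y = star b * ph_ip x y.
Proof. by rewrite -ph_star ph_ipr starM ph_star. Qed.

Definition pn x : R := Num.sqrt (rnorm (ph_ip x x)).

Lemma pn_ge0 x : 0 <= pn x. Proof. exact: sqrtr_ge0. Qed.

Lemma pn2 x : pn x ^+ 2 = rnorm (ph_ip x x).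
Proof. by rewrite sqr_sqrtr// rnorm_ge0. Qed.

(** With b = <x, y> and M >= |<x, x>|, adding the positive elements <x b - M y, x b - M y> and b^*
    (M - <x, x>) b cancels all terms in <x, x>; division by M leaves M <y, y> - b^* b >= 0. The
    perturbation by e covers the case <x, x> = 0. *)
Lemma ph_CS x y : rnorm (ph_ip x y) <= pn x * pn y.
Proof.
apply: le_of_sqr; first by rewrite mulr_ge0 ?pn_ge0.
rewrite exprMn !pn2.
set b := ph_ip x y; set yy := ph_ip y y.
have main (M : R) : 0 < M -> rnorm (ph_ip x x) <= M -> rnorm b ^+ 2 <= M * rnorm yy.
  move=> M0 xM; rewrite -rnorm_starM -[M](ger0_norm (ltW M0)) -rnormZr.
  apply: spos_le; first exact: spos_starM.
  have p1 := ph_pos (ph_add (ph_ract x b) (ph_scale (- M%:C) y)).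
  have p2 := spos_star_conj b (spos_sub (spos_sa (ph_pos x)) xM).
  have := sposZ (_ : 0 <= M^-1) (sposD p1 p2).
  rewrite invr_ge0 (ltW M0) => /(_ isT).
  rewrite ph_ipD !ph_ipDl !ph_ipZ !ph_ipr !ph_iprl !ph_ipZl -/b -/yy.
  rewrite -[ph_ip y x]ph_star -/b.
  have -> : (- M%:C)^* = - M%:C by rewrite rmorphN /= conj_Creal//; apply/complex_realP; exists M.
  have -> : star b * (sc M - ph_ip x x) * b =
      M%:C *: (star b * b) - star b * ph_ip x x * b.
    by rewrite mulrBr mulrBl scr -cscalerAl.
  rewrite -cscalerAl scalerA mulrNN !scaleNr.
  rewrite [_ + (_ - star b * ph_ip x x * b)]addrC addrA subrKA subrr add0r.
  rewrite scalerDr scalerN !scalerA mulrA -!rmorphM mulVf ?gt_eqF//.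
  by rewrite mul1r scale1r addrC.
apply/ler_addgt0Pr => e e0.
have d0 : 0 < e / (rnorm yy + 1) by rewrite divr_gt0// ltr_wpDl ?rnorm_ge0.
have := main (rnorm (ph_ip x x) + e / (rnorm yy + 1)).
rewrite ltr_wpDl ?rnorm_ge0// lerDl ltW// => /(_ isT isT) /le_trans; apply.
rewrite mulrDl lerD2l mulrAC ler_pdivrMr ?ltr_wpDl ?rnorm_ge0//.
by rewrite ler_pM2l// lerDl.
Qed.

Lemma pnD x y : pn (ph_add x y) <= pn x + pn y.
Proof.
apply: le_of_sqr; first by rewrite addr_ge0 ?pn_ge0.
rewrite pn2 ph_ipD !ph_ipDl sqrrD !pn2.
have := rnormD (ph_ip x x + ph_ip y x) (ph_ip x y + ph_ip y y).
have := rnormD (ph_ip x x) (ph_ip y x); have := rnormD (ph_ip x y) (ph_ip y y).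
have := ph_CS x y; have := ph_CS y x; lra.
Qed.

End Theory.
End PreHilbert.

Section HilbertNorm.
Context {R : realType} {B : unitalCStarAlgType R} {E : hilbertModType B}.
Implicit Types x y : E.

Fact hm_pos x : spos (inner x x).
Proof. by apply/cstar_posE; exact: inner_pos. Qed.

Definition hm_ph : preHilbert B := @PreHilbert _ _ E 0 +%R *:%R ract inner
  (@innerDr _ _ E) (@innerZr _ _ E) (@inner_ractr _ _ E) (@star_inner _ _ E) hm_pos.

Lemma rnorm_inner x : rnorm x ^+ 2 = rnorm (inner x x).
Proof. by have := norm_inner x; rewrite !rnormE -rmorphXn => /complexI. Qed.

Lemma CS x y : rnorm (inner x y) <= rnorm x * rnorm y.
Proof.
have pnE z : @pn _ _ hm_ph z = rnorm z.
  by rewrite /pn /= -rnorm_inner sqrtr_sqr ger0_norm ?rnorm_ge0.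
by have := @ph_CS _ _ hm_ph x y; rewrite !pnE.
Qed.

Lemma rnorm_ract x (b : B) : rnorm (ract x b) <= rnorm x * rnorm b.
Proof.
apply: le_of_sqr; first by rewrite mulr_ge0 ?rnorm_ge0.
rewrite rnorm_inner inner_ractl inner_ractr.
have := rnormM (star b) (inner x x * b); have := rnormM (inner x x) b.
rewrite rnorm_star -rnorm_inner exprMn => h1 h2; apply: (le_trans h2).
by rewrite expr2 [_ ^+ 2 * _]mulrC expr2 -mulrA ler_wpM2l ?rnorm_ge0// mulrC.
Qed.

End HilbertNorm.

(** * Completion of a semi-inner product space *)

Section Completion.
Context {R : realType} {B : unitalCStarAlgType R} (X : preHilbert B).

Definition approx (f : X -> B) (e : R) (x : X) :=
  forall y, rnorm (f y - ph_ip y x) <= e * pn y.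

(** A vector f of the completion is stored as the functional y |-> <y, f>. Null vectors of X
    disappear without a quotient, and equality is extensional. Linearity is not imposed, since it
    follows by approximation. *)
Definition comp_pred : {pred X -> B} :=
  fun f => `[< forall e : R, 0 < e -> exists x, approx f e x >].

Lemma comp_predP f : reflect (forall e : R, 0 < e -> exists x, approx f e x)
  (f \in comp_pred).
Proof. exact: asboolP. Qed.

Lemma approxD f g d e x y : approx f d x -> approx g e y ->
  approx (f + g) (d + e) (ph_add x y).
Proof.
move=> fx gy z; rewrite ph_ipD opprD addrACA mulrDl.
by apply: (le_trans (rnormD _ _)); apply: lerD.
Qed.

Lemma approxZ (k : complex R) f d x : approx f d x ->
  approx (k *: f) (complex.Re `|k| * d) (ph_scale k x).
Proof.
move=> fx z; rewrite ph_ipZ -scalerBr rnormZ -mulrA.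
by apply: ler_wpM2l; [exact: Re_norm_ge0|exact: fx].
Qed.

Fact comp_submod_closed : submod_closed comp_pred.
Proof.
split=> [|k f g /comp_predP hf /comp_predP hg]; apply/comp_predP => e e0.
  exists (ph_scale 0 (ph_pt X)) => y.
  by rewrite ph_ipZ scale0r subrr rnorm0 mulr_ge0 ?pn_ge0// ltW.
have k0 := Re_norm_ge0 k.
have c0 : 0 < complex.Re `|k| + 1 by lra.
have d0 := divr_gt0 e0 c0.
have [x hx] := hf _ d0; have [y hy] := hg _ d0.
exists (ph_add (ph_scale k x) y) => z.
apply: (le_trans (approxD (approxZ k hx) hy z)).
by rewrite ler_wpM2r ?pn_ge0// -[X in _ + X]mul1r -mulrDl mulrC divfK ?gt_eqF.
Qed.
HB.instance Definition _ := GRing.isSubmodClosed.Build (complex R) (X -> B) comp_pred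
  comp_submod_closed.

Record completion := Completion { cval : X -> B; cvalP : cval \in comp_pred }.
HB.instance Definition _ := [isSub for cval].
HB.instance Definition _ := [Choice of completion by <:].
HB.instance Definition _ := [SubChoice_isSubLmodule of completion by <:].

Implicit Types f g h : completion.

Lemma approx_ex f (e : R) : 0 < e -> exists x, approx (cval f) e x.
Proof. exact/comp_predP/cvalP. Qed.

Lemma cval_bound f : exists2 C : R, 0 <= C & forall y, rnorm (cval f y) <= C * pn y.
Proof.
have [x fx] := approx_ex f ltr01; exists (1 + pn x).
  by have := pn_ge0 x; lra.
move=> y; have := rnorm_sub (cval f y) (ph_ip y x); have := fx y.
have := ph_CS y x; lra.
Qed.

Definition ph_sub (x y : X) := ph_add x (ph_scale (-1) y).

Lemma ip_sub z x y : ph_ip z (ph_sub x y) = ph_ip z x - ph_ip z y.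
Proof. by rewrite ph_ipD ph_ipZ scaleN1r. Qed.

Lemma ip_subl z x y : ph_ip (ph_sub x y) z = ph_ip x z - ph_ip y z.
Proof. by rewrite -ph_star ip_sub starB !ph_star. Qed.

Lemma cval_sub f x y : cval f (ph_sub x y) = cval f x - cval f y.
Proof.
pose C := pn (ph_sub x y) + pn x + pn y.
apply: (@eq_of_small _ _ _ _ C) => e e0; have [z fz] := approx_ex f e0.
have -> : cval f (ph_sub x y) - (cval f x - cval f y) =
   (cval f (ph_sub x y) - ph_ip (ph_sub x y) z) -
     ((cval f x - ph_ip x z) - (cval f y - ph_ip y z)).
  have -> : (cval f x - ph_ip x z) - (cval f y - ph_ip y z) =
      (cval f x - cval f y) - ph_ip (ph_sub x y) z.
    by rewrite ip_subl !opprD !opprK addrACA.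
  by rewrite !opprB subrKA.
have := rnormD (cval f (ph_sub x y) - ph_ip (ph_sub x y) z)
  (- ((cval f x - ph_ip x z) - (cval f y - ph_ip y z))).
have := rnormD (cval f x - ph_ip x z) (- (cval f y - ph_ip y z)).
rewrite !rnormN; have := fz (ph_sub x y); have := fz x; have := fz y.
rewrite /C; lra.
Qed.

Lemma approx_close f d e x y : 0 <= d -> 0 <= e -> approx (cval f) d x -> approx (cval f) e y ->
  pn (ph_sub x y) <= d + e.
Proof.
move=> d0 e0 fx fy; set w := ph_sub x y.
have h : pn w ^+ 2 <= (d + e) * pn w.
  rewrite pn2 {2}/w ip_sub (_ : _ - _ = (ph_ip w x - cval f w) + (cval f w - ph_ip w y)).
    rewrite mulrDl; apply: (le_trans (rnormD _ _)); apply: lerD => //.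
    by rewrite rnormB.
  by rewrite subrKA.
have := pn_ge0 w; rewrite le_eqVlt => /predU1P[w0|w0]; last first.
  by move: h; rewrite expr2 ler_pM2r.
by rewrite -w0 addr_ge0.
Qed.

(** The value is the limit of g x as x approximates f: two approximants of f are close in [pn], and
    g is controlled by [pn]. The linear rate in d reduces all later identities to limit
    arguments. *)
Fact comp_inner_ex f g : exists l : B, exists2 C : R, 0 <= C &
  forall d x, 0 < d -> approx (cval f) d x -> rnorm (cval g x - l) <= C * d.
Proof.
have [C C0 gC] := cval_bound g.
have /choice[u hu] : forall n : nat, exists x, approx (cval f) (n.+1%:R^-1) x.
  by move=> n; apply: approx_ex; rewrite invr_gt0.
have close d e x y : 0 < d -> 0 < e -> approx (cval f) d x -> approx (cval f) e y ->
    rnorm (cval g x - cval g y) <= C * (d + e).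
  move=> d0 e0 fx fy; rewrite -cval_sub; apply: (le_trans (gC _)).
  by rewrite ler_wpM2l// (approx_close (ltW d0) (ltW e0) fx fy).
have [l hl] : exists l, rlim (cval g \o u) l.
  apply: rcauchy_cvg => e e0.
  have [|c [c0 _ ce]] := @small_mul _ (C * 2) e _ e0; first by rewrite mulr_ge0.
  have [N hN] := inv_small c0; exists N => n m /hN n1 /hN m1 /=.
  apply: le_lt_trans (close _ _ _ _ _ _ (hu n) (hu m)) _; rewrite ?invr_gt0//.
  apply: le_lt_trans ce; rewrite -mulrA ler_wpM2l// mulr_natl mulr2n.
  by rewrite lerD// ltW.
exists l, C => // d x d0 fx; apply/ler_addgt0Pr => e e0.
have e2 : 0 < e / 2 by lra.
have [c [c0 _ ce]] := small_mul C0 e2.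
have [N1 /(_ (maxn N1 _) (leq_maxl _ _)) h1] := inv_small c0.
have [N2 /(_ (maxn N1 N2) (leq_maxr _ _)) h2] := hl _ e2.
have {}h1 := h1 N2; set n := maxn N1 N2 in h1 h2.
have := rnorm_tri (cval g (u n)) (cval g x) l.
have n0 : (0 : R) < n.+1%:R^-1 by rewrite invr_gt0.
have := close _ _ _ _ d0 n0 fx (hu n); rewrite mulrDr => h3 h4.
have : C * n.+1%:R^-1 <= C * c by rewrite ler_wpM2l// ltW.
move: (C * _^-1) h3 => q h3; rewrite /= in h2; lra.
Qed.

Definition comp_inner f g : B := projT1 (cid (comp_inner_ex f g)).

Lemma comp_innerP f g : exists2 C : R, 0 <= C &
  forall d x, 0 < d -> approx (cval f) d x ->
    rnorm (cval g x - comp_inner f g) <= C * d.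
Proof. exact: projT2 (cid (comp_inner_ex f g)). Qed.

Lemma comp_inner_uniq f g l (C : R) :
  (forall d x, 0 < d -> d <= 1 -> approx (cval f) d x -> rnorm (cval g x - l) <= C * d) ->
  comp_inner f g = l.
Proof.
have [D D0 hD] := comp_innerP f g => hC; apply: (@eq_of_small _ _ _ _ (D + `|C|)) => e e0.
have [d [d0 d1 de]] := small_mul ler01 e0; rewrite mul1r in de.
have [x fx] := approx_ex f d0.
have := rnorm_tri (cval g x) (comp_inner f g) l; rewrite (rnormB _ (cval g x)).
have := hD _ _ d0 fx; have := hC _ _ d0 d1 fx.
have : D * d <= D * e by rewrite ler_wpM2l// ltW.
have : C * d <= `|C| * e.
  apply: (@le_trans _ _ (`|C| * d)); first by rewrite ler_wpM2r ?ler_norm ?ltW.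
  by rewrite ler_wpM2l// ltW.
rewrite mulrDl; lra.
Qed.

Lemma comp_innerD f g h : comp_inner f (g + h) = comp_inner f g + comp_inner f h.
Proof.
have [C C0 hC] := comp_innerP f g; have [D D0 hD] := comp_innerP f h.
apply: (@comp_inner_uniq _ _ _ (C + D)) => d x d0 _ fx.
rewrite (_ : cval (g + h) x = cval g x + cval h x)// opprD addrACA mulrDl.
by apply: le_trans (rnormD _ _) _; apply: lerD; [exact: hC|exact: hD].
Qed.

Lemma comp_innerZ k f g : comp_inner f (k *: g) = k *: comp_inner f g.
Proof.
have [C C0 hC] := comp_innerP f g.
apply: (@comp_inner_uniq _ _ _ (complex.Re `|k| * C)) => d x d0 _ fx.
rewrite (_ : cval (k *: g) x = k *: cval g x)// -scalerBr rnormZ -mulrA.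
by apply: ler_wpM2l; [exact: Re_norm_ge0|exact: hC].
Qed.

Fact comp_ract_subproof f (b : B) : (fun x => cval f x * b) \in comp_pred.
Proof.
apply/comp_predP => e e0; have [d [d0 _ de]] := small_mul (rnorm_ge0 b) e0.
have [x fx] := approx_ex f d0; exists (ph_ract x b) => y.
rewrite ph_ipr -mulrBl; apply: le_trans (rnormM _ _) _.
apply: (@le_trans _ _ (d * pn y * rnorm b)); first by rewrite ler_wpM2r ?rnorm_ge0.
by rewrite mulrC mulrA ler_wpM2r ?pn_ge0 ?ltW.
Qed.
Definition comp_ract f b := Completion (comp_ract_subproof f b).

Lemma comp_inner_ract f g b : comp_inner f (comp_ract g b) = comp_inner f g * b.
Proof.
have [C C0 hC] := comp_innerP f g.
apply: (@comp_inner_uniq _ _ _ (C * rnorm b)) => d x d0 _ fx /=.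
rewrite -mulrBl; apply: le_trans (rnormM _ _) _.
by rewrite mulrAC ler_wpM2r ?rnorm_ge0 ?hC.
Qed.

Lemma approx_pn f (C d : R) x : 0 <= C -> 0 <= d ->
  (forall y, rnorm (cval f y) <= C * pn y) -> approx (cval f) d x -> pn x <= C + d.
Proof.
move=> C0 d0 fC fx.
have h : pn x * pn x <= (C + d) * pn x.
  rewrite -expr2 pn2; have := rnorm_sub (ph_ip x x) (cval f x).
  by rewrite rnormB; have := fC x; have := fx x; lra.
have := pn_ge0 x; rewrite le_eqVlt => /predU1P[w0|w0]; last first.
  by move: h; rewrite ler_pM2r.
by rewrite -w0 addr_ge0.
Qed.

Lemma comp_inner_approx f g : exists2 C : R, 0 <= C &
  forall d x y, 0 < d -> d <= 1 -> approx (cval f) d x -> approx (cval g) d y ->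
    rnorm (ph_ip x y - comp_inner f g) <= C * d.
Proof.
have [C C0 hC] := comp_innerP f g; have [D D0 fD] := cval_bound f.
exists (C + D + 1); first lra.
move=> d x y d0 d1 fx gy; have := rnorm_tri (cval g x) (ph_ip x y) (comp_inner f g).
have := hC _ _ d0 fx; have := gy x; have := rnormB (cval g x) (ph_ip x y) => h0.
have := approx_pn D0 (ltW d0) fD fx => h1 h2 h3 h4.
have : d * pn x <= d * (D + 1) by apply: ler_wpM2l; lra.
lra.
Qed.

Lemma comp_star f g : star (comp_inner f g) = comp_inner g f.
Proof.
have [C C0 hC] := comp_inner_approx f g; have [D D0 hD] := comp_inner_approx g f.
apply: (@eq_of_small _ _ _ _ (C + D)) => e e0.
have [d [d0 d1 de]] := small_mul ler01 e0; rewrite mul1r in de.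
have [x fx] := approx_ex f d0; have [y gy] := approx_ex g d0.
have := rnorm_tri (ph_ip y x) (star (comp_inner f g)) (comp_inner g f).
have -> : star (comp_inner f g) - ph_ip y x = star (comp_inner f g - ph_ip x y).
  by rewrite starB ph_star.
rewrite rnorm_star (rnormB _ (ph_ip x y)).
have := hC _ _ _ d0 d1 fx gy; have := hD _ _ _ d0 d1 gy fx.
have : (C + D) * d <= (C + D) * e by apply: ler_wpM2l; lra.
lra.
Qed.

Lemma comp_pos f : spos (comp_inner f f).
Proof.
have [C C0 hC] := comp_inner_approx f f.
have /choice[u hu] : forall n : nat, exists x, approx (cval f) (n.+1%:R^-1) x.
  by move=> n; apply: approx_ex; rewrite invr_gt0.
apply: (@spos_lim _ _ (fun n => ph_ip (u n) (u n))) => [n|e e0].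
  exact: ph_pos.
have [c [c0 _ ce]] := small_mul C0 e0; have [N hN] := inv_small c0.
exists N => n /hN nc; apply: le_lt_trans (hC _ _ _ _ _ (hu n) (hu n)) _.
- by rewrite invr_gt0.
- by rewrite invf_le1// ler1n.
- by apply: le_lt_trans ce; rewrite ler_wpM2l// ltW.
Qed.

Definition comp_ph : preHilbert B := @PreHilbert _ _ completion 0 +%R *:%R comp_ract
  comp_inner comp_innerD comp_innerZ comp_inner_ract comp_star comp_pos.

Fact cmb_subproof (x : X) : (fun y => ph_ip y x) \in comp_pred.
Proof.
by apply/comp_predP => e e0; exists x => y; rewrite subrr rnorm0 mulr_ge0 ?pn_ge0 ?ltW.
Qed.
Definition cemb (x : X) := Completion (cmb_subproof x).

Lemma comp_inner_emb x f : comp_inner (cemb x) f = cval f x.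
Proof.
have [C C0 hC] := comp_innerP (cemb x) f.
apply: (@eq_of_small _ _ _ _ C) => e e0; rewrite rnormB; apply: hC => // y /=.
by rewrite subrr rnorm0 mulr_ge0 ?pn_ge0 ?ltW.
Qed.

Definition comp_norm f : complex R := (@pn _ _ comp_ph f)%:C.

Fact comp_normD f g : comp_norm (f + g) <= comp_norm f + comp_norm g.
Proof. by rewrite /comp_norm -rmorphD lecR; exact: (@pnD _ _ comp_ph). Qed.

Fact comp_normZ k f : comp_norm (k *: f) = `|k| * comp_norm f.
Proof.
have kE : `|k| = (complex.Re `|k|)%:C by rewrite RRe_real// normr_real.
rewrite /comp_norm kE -rmorphM; congr (_%:C).
rewrite /pn (@ph_ipZ _ _ comp_ph) (@ph_ipZl _ _ comp_ph) !rnormZ mulrA.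
rewrite norm_conjC sqrtrM ?mulr_ge0 ?Re_norm_ge0// -expr2 sqrtr_sqr ger0_norm//.
exact: Re_norm_ge0.
Qed.

Lemma cval_le f x : rnorm (cval f x) <= pn x * @pn _ _ comp_ph f.
Proof.
rewrite -comp_inner_emb; apply: le_trans (@ph_CS _ _ comp_ph (cemb x) f) _.
by rewrite /pn /= comp_inner_emb.
Qed.

Fact comp_norm0 f : comp_norm f = 0 -> f = 0.
Proof.
move=> /complexI f0; apply: val_inj; apply/funext => x; apply: rnorm0_eq0.
apply/eqP; rewrite eq_le rnorm_ge0 andbT; apply: le_trans (cval_le f x) _.
by rewrite f0 mulr0.
Qed.
HB.instance Definition _ := Lmodule_isNormed.Build (complex R) completion
  comp_normD comp_normZ comp_norm0.

Lemma comp_rnorm f : rnorm f = @pn _ _ comp_ph f.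
Proof. by rewrite /rnorm. Qed.

(** An approximant x of f has pn x <= C + d, so |f x| <= C (C + d), while f x tends to <f, f>. *)
Lemma comp_norm_le f (C : R) : 0 <= C ->
  (forall x, rnorm (cval f x) <= C * pn x) -> rnorm f <= C.
Proof.
move=> C0 fC; rewrite comp_rnorm.
have [D D0 hD] := comp_innerP f f.
suff : pn (f : comp_ph) ^+ 2 <= C ^+ 2 by exact: le_of_sqr.
rewrite pn2; apply/ler_addgt0Pr => e e0.
have [d [d0 d1 de]] := @small_mul _ (C + D) e (addr_ge0 C0 D0) e0.
have [x fx] := approx_ex f d0.
have := approx_pn C0 (ltW d0) fC fx; have := fC x; have := hD _ _ d0 fx.
have := rnorm_sub (comp_inner f f) (cval f x); rewrite rnormB => h1 h2 h3 h4.
have : C * pn x <= C * (C + d) by apply: ler_wpM2l.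
by rewrite /=; nra.
Qed.

(** The limit is taken pointwise on X. The Cauchy estimate is uniform relative to [pn], which places
    the pointwise limit in [comp_pred] and makes the convergence one in norm. *)
Fact comp_complete (F : set_system completion) : ProperFilter F -> cauchy F -> cvg F.
Proof.
move=> FF /cauchyP Fc.
have {}Fc (e : R) : 0 < e -> exists g, \forall h \near F, rnorm (g - h) < e.
  move=> e0; have /Fc[g gF] : (0 : complex R) < e%:C by rewrite ltcR.
  by exists g; apply: filterS gF => h; rewrite -ball_normE /= rnormE ltcR.
have cvalB g h x : rnorm (cval g x - cval h x) <= pn x * rnorm (g - h).
  by apply: le_trans (cval_le (g - h) x) _; rewrite comp_rnorm.
have limx x : exists l, forall e : R, 0 < e -> \forall h \near F, rnorm (l - cval h x) < e.
  have cx : cauchy ((fun h => cval h x) @ F).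
    apply/cauchy_exP => e; rewrite /= ltcE => /andP[/eqP/= ie re].
    have [d [d0 _ de]] := small_mul (pn_ge0 x) re; have [g hg] := Fc _ d0.
    exists (cval g x); rewrite /nbhs/=; apply: filterS hg => h gh.
    rewrite /= -ball_normE /= rnormE ltcE /= ie eqxx /=.
    apply: le_lt_trans (cvalB _ _ _) _; apply: le_lt_trans de.
    by rewrite ler_wpM2l ?pn_ge0// ltW.
  have /cvg_ex[/= l lF] : cvg ((fun h => cval h x) @ F) by exact: cauchy_cvg.
  by exists l => e e0; move/cvg_rnormP : lF; apply.
have [l hl] := choice limx.
have ml g (e : R) : (\forall h \near F, rnorm (g - h) < e) ->
    forall x, rnorm (l x - cval g x) <= e * pn x.
  move=> gF x; apply/ler_addgt0Pr => d d0.
  have /filter_ex[h [h1 h2]] : F ((fun h => rnorm (g - h) < e) `&`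
      (fun h => rnorm (l x - cval h x) < d)) by apply: filterI; [exact: gF|exact: hl].
  have := rnorm_tri (cval h x) (l x) (cval g x); have := cvalB g h x.
  have := rnormB (cval g x) (cval h x).
  have : pn x * rnorm (g - h) <= pn x * e by rewrite ler_wpM2l ?pn_ge0// ltW.
  lra.
have lP : l \in comp_pred.
  apply/comp_predP => e e0; have e2 : 0 < e / 2 by lra.
  have [g /ml gF] := Fc _ e2; have [x gx] := approx_ex g e2.
  exists x => y; have := gF y; have := gx y.
  have := rnorm_tri (cval g y) (l y) (ph_ip y x); lra.
apply/cvg_ex; exists (Completion lP); apply/cvg_rnormP => e e0.
have e2 : 0 < e / 2 by lra.
have [g gF] := Fc _ e2; have lg : rnorm (Completion lP - g) <= e / 2.
  by apply: comp_norm_le; [exact: ltW|exact: ml].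
apply: filterS gF => h gh; apply: le_lt_trans (rnorm_tri g _ _) _.
by rewrite (splitr e); exact: ler_ltD lg gh.
Qed.

HB.instance Definition _ := Uniform_isComplete.Build completion comp_complete.

Fact comp_ractDl f g b : comp_ract (f + g) b = comp_ract f b + comp_ract g b.
Proof. by apply: val_inj; apply/funext => x; exact: mulrDl. Qed.
Fact comp_ractDr f a b : comp_ract f (a + b) = comp_ract f a + comp_ract f b.
Proof. by apply: val_inj; apply/funext => x; exact: mulrDr. Qed.
Fact comp_ractA f a b : comp_ract f (a * b) = comp_ract (comp_ract f a) b.
Proof. by apply: val_inj; apply/funext => x; exact: mulrA. Qed.
Fact comp_ract1 f : comp_ract f 1 = f.
Proof. by apply: val_inj; apply/funext => x; exact: mulr1. Qed.
Fact comp_ractZl k f b : comp_ract (k *: f) b = k *: comp_ract f b.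
Proof. by apply: val_inj; apply/funext => x; apply/esym; exact: cscalerAl. Qed.
Fact comp_ractZr k f b : comp_ract f (k *: b) = k *: comp_ract f b.
Proof. by apply: val_inj; apply/funext => x; apply/esym; exact: cscalerAr. Qed.
Fact comp_inner_pos f : cstar_pos (comp_inner f f).
Proof. by apply/cstar_posE; exact: comp_pos. Qed.
Fact comp_norm_inner f : `|f| ^+ 2 = `|comp_inner f f|.
Proof. by rewrite !rnormE -rmorphXn comp_rnorm pn2. Qed.
HB.instance Definition _ := isHilbertModule.Build R B completion
  comp_ractDl comp_ractDr comp_ractA comp_ract1 comp_ractZl comp_ractZr
  comp_innerD comp_innerZ comp_inner_ract comp_star comp_inner_pos
  comp_norm_inner.

Lemma inner_cemb x y : inner (cemb x) (cemb y) = ph_ip x y.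
Proof. exact: comp_inner_emb. Qed.

Lemma cemb_dense f (e : R) : 0 < e -> exists x, rnorm (f - cemb x) < e.
Proof.
move=> e0; have e2 : 0 < e / 2 by lra.
have [x fx] := approx_ex f e2; exists x.
by apply: (@le_lt_trans _ _ (e / 2)); [apply: comp_norm_le (ltW e2) _|lra].
Qed.

End Completion.

(** * Hilbert modules and correspondences *)

Section Extension.
Context {R : realType} {V : normedModType (complex R)}
  {W : completeNormedModType (complex R)}.

(** Indexing the dense family by an arbitrary type lets formal sums serve as indices. The Lipschitz
    bound on g contains well-definedness, as e need not be injective. *)
Lemma lip_ext (S : Type) (e : S -> V) (g : S -> W) (C : R) : 0 <= C ->
  (forall u (d : R), 0 < d -> exists x, rnorm (u - e x) < d) ->
  (forall x y, rnorm (g x - g y) <= C * rnorm (e x - e y)) ->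
  exists h : V -> W, (forall x, h (e x) = g x) /\
    (forall u v, rnorm (h u - h v) <= C * rnorm (u - v)).
Proof.
move=> C0 de gC.
(* The value at u is characterised by its distances to all g x at once; both conclusions follow from
   this estimate. *)
have /choice[h hP] u : exists w, forall x, rnorm (w - g x) <= C * rnorm (u - e x).
  have /choice[x hx] : forall n : nat, exists x, rnorm (u - e x) < n.+1%:R^-1.
    by move=> n; apply: de; rewrite invr_gt0.
  have [w hw] : exists w, rlim (g \o x) w.
    apply: rcauchy_cvg => d d0.
    have [|c [c0 _ cd]] := @small_mul _ (C * 2) d _ d0; first by rewrite mulr_ge0.
    have [N hN] := inv_small c0; exists N => n m /hN n1 /hN m1 /=.
    apply: le_lt_trans (gC _ _) _; apply: le_lt_trans cd.
    rewrite -mulrA ler_wpM2l//; have := rnorm_tri u (e (x n)) (e (x m)).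
    have := lt_trans (hx n) n1; have := lt_trans (hx m) m1.
    have := rnormB (e (x n)) u; lra.
  exists w => y; apply/ler_addgt0Pr => d d0; have d2 : 0 < d / 2 by lra.
  have [c [c0 _ cd]] := small_mul C0 d2.
  have [N1 /(_ (maxn N1 _) (leq_maxl _ _)) h1] := inv_small c0.
  have [N2 /(_ (maxn N1 N2) (leq_maxr _ _)) h2] := hw _ d2.
  have {}h1 := h1 N2; set n := maxn N1 N2 in h1 h2; rewrite /= in h2.
  have := rnorm_tri (g (x n)) w (g y); have := rnormB w (g (x n)).
  have := gC (x n) y; have := rnorm_tri u (e (x n)) (e y).
  have := rnormB (e (x n)) u; have hxn := lt_trans (hx n) h1.
  move=> a1 a2 a3 a4 a5.
  have : C * rnorm (e (x n) - e y) <= C * (c + rnorm (u - e y)).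
    by rewrite ler_wpM2l//; lra.
  rewrite mulrDr; lra.
exists h; split.
  move=> x; apply: (@eq_of_small _ _ _ _ 0) => d d0.
  by apply: le_trans (hP _ _) _; rewrite subrr rnorm0 mulr0 mul0r.
move=> u v; apply/ler_addgt0Pr => d d0.
have [|c [c0 _ cd]] := @small_mul _ (C * 2) d _ d0; first by rewrite mulr_ge0.
have [x hx] := de u _ c0.
have := rnorm_tri (g x) (h u) (h v); have := rnormB (h v) (g x).
have := hP u x; have := hP v x; have := rnorm_tri u v (e x); have := rnormB v u.
move=> a1 a2 a3 a4 a5 a6.
have : C * rnorm (v - e x) <= C * (rnorm (u - v) + c) by rewrite ler_wpM2l//; lra.
have : C * rnorm (u - e x) <= C * c by rewrite ler_wpM2l// ltW.
rewrite mulrDr; lra.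
Qed.

Lemma span_denseP (A : set V) : spans_densely A ->
  forall u (d : R), 0 < d -> exists2 v, lin_span A v & rnorm (u - v) < d.
Proof.
move=> dA u d d0.
have : closure (lin_span A) u by rewrite dA.
move=> /(_ (ball u (d%:C : complex R))) [|v [Av uv]].
  by apply: nbhsx_ballx; rewrite ltcR.
by exists v => //; move: uv; rewrite -ball_normE /= rnormE ltcR.
Qed.

End Extension.

Section HilbertModules.
Context {R : realType} {B : unitalCStarAlgType R}.

Section One.
Context {E : hilbertModType B}.
Implicit Types x y z : E.

Lemma innerBr x y z : inner x (y - z) = inner x y - inner x z.
Proof. by rewrite innerDr innerNr. Qed.

Lemma innerBl x y z : inner (x - y) z = inner x z - inner y z.
Proof. by rewrite innerDl innerNl. Qed.

Lemma inner0r x : inner x 0 = 0.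
Proof. by rewrite -(subrr x) innerBr subrr. Qed.

Lemma inner_sumr I (s : seq I) x (F : I -> E) :
  inner x (\sum_(i <- s) F i) = \sum_(i <- s) inner x (F i).
Proof.
elim: s => [|j s IH]; first by rewrite !big_nil inner0r.
by rewrite !big_cons innerDr IH.
Qed.

Lemma inner_suml I (s : seq I) x (F : I -> E) :
  inner (\sum_(i <- s) F i) x = \sum_(i <- s) inner (F i) x.
Proof.
elim: s => [|j s IH]; first by rewrite !big_nil -(star_inner x) inner0r star0.
by rewrite !big_cons innerDl IH.
Qed.

Lemma dense_inner_inj (A : set E) x y :
  (forall u (d : R), 0 < d -> exists2 v, A v & rnorm (u - v) < d) ->
  (forall z, A z -> inner z x = inner z y) -> x = y.
Proof.
move=> dA h; pose w := x - y.
apply: (@eq_of_small _ _ _ _ 1) => e e0.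
have [z Az wz] := dA w _ e0; rewrite -/w.
have zw : inner z w = 0 by rewrite innerBr h// subrr.
have h1 : rnorm w ^+ 2 <= e * rnorm w.
  rewrite rnorm_inner -[X in inner X w](subrK z) innerDl zw addr0.
  by apply: le_trans (CS _ _) _; rewrite ler_wpM2r ?rnorm_ge0// ltW.
rewrite mul1r; have := rnorm_ge0 w; rewrite le_eqVlt => /predU1P[<-|p].
  exact: ltW.
by move: h1; rewrite expr2 ler_pM2r.
Qed.

End One.

Section Isometric.
Context {E F : hilbertModType B} {f : E -> F} (fi : isometric_embedding f).

Lemma isoD x y : f (x + y) = f x + f y. Proof. by case: fi. Qed.
Lemma iso_ract x (b : B) : f (ract x b) = ract (f x) b. Proof. by case: fi. Qed.
Lemma iso_inner x y : inner (f x) (f y) = inner x y. Proof. by case: fi. Qed.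

Lemma isoZ (k : complex R) x : f (k *: x) = k *: f x.
Proof. by rewrite -[x]ract1 -ractZr iso_ract ractZr !ract1. Qed.

Lemma isoB x y : f (x - y) = f x - f y.
Proof. by rewrite isoD -scaleN1r isoZ scaleN1r. Qed.

Lemma iso0 : f 0 = 0.
Proof. by rewrite -(subrr 0) isoB subrr. Qed.

Lemma iso_norm x : rnorm (f x) = rnorm x.
Proof.
apply/eqP; rewrite -(@eqrXn2 _ 2%N) ?rnorm_ge0//.
by rewrite !rnorm_inner iso_inner.
Qed.

Lemma iso_sum I (s : seq I) (G : I -> E) :
  f (\sum_(j <- s) G j) = \sum_(j <- s) f (G j).
Proof.
elim: s => [|j s IH]; first by rewrite !big_nil iso0.
by rewrite !big_cons isoD IH.
Qed.

End Isometric.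

Section Corr.
Context {E : correspondence B}.
Implicit Types (x y : E) (b : B).

Lemma lactDl a b x : op (lact E (a + b)) x = op (lact E a) x + op (lact E b) x.
Proof. by have := lact_linear E 1 a b; rewrite !scale1r => ->. Qed.

Lemma lactZl (k : complex R) b x : op (lact E (k *: b)) x = k *: op (lact E b) x.
Proof.
have h0 : op (lact E 0) x = 0 by apply: (addrI (op (lact E 0) x)); rewrite -lactDl !addr0.
by have /(congr1 (fun a => op a x)) := lact_linear E k b 0; rewrite addr0 /= h0 addr0.
Qed.

Lemma lactBl a b x : op (lact E (a - b)) x = op (lact E a) x - op (lact E b) x.
Proof. by rewrite lactDl -scaleN1r lactZl scaleN1r. Qed.

Lemma lactMl a b x : op (lact E (a * b)) x = op (lact E a) (op (lact E b) x).
Proof. by rewrite lactM. Qed.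

Lemma lact_inner b x y : inner (op (lact E b) x) y = inner x (op (lact E (star b)) y).
Proof. by rewrite op_inner lact_star. Qed.

(** The action of 1 is contractive, because it is a self-adjoint idempotent, and it fixes every b x;
    nondegeneracy provides a dense span of such elements. *)
Lemma lact1 x : op (lact E 1) x = x.
Proof.
have c1 z : rnorm (op (lact E 1) z) <= rnorm z.
  have h : rnorm (op (lact E 1) z) ^+ 2 <= rnorm z * rnorm (op (lact E 1) z).
    by rewrite rnorm_inner lact_inner -lactMl star1 mulr1; exact: CS.
  have := rnorm_ge0 (op (lact E 1) z); rewrite le_eqVlt => /predU1P[<-|p].
    exact: rnorm_ge0.
  by move: h; rewrite expr2 ler_pM2r.
apply: (@eq_of_small _ _ _ _ 2) => e e0.
have [v [n [k [w [wA vE]]]] xv] := span_denseP (@lact_nondegenerate _ _ E) x e0.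
have v1 : op (lact E 1) v = v.
  rewrite vE; apply: (big_ind (fun v => op (lact E 1) v = v)).
  - by rewrite -(scale0r (0 : E)) opZ scale0r scale0r.
  - by move=> a b ha hb; rewrite opD ha hb.
  - by move=> j _; have [b [y ->]] := wA j; rewrite opZ -lactMl mul1r.
have -> : op (lact E 1) x - x = op (lact E 1) (x - v) - (x - v).
  by rewrite opD opN v1 opprB addrA subrK.
have := rnormD (op (lact E 1) (x - v)) (- (x - v)); rewrite rnormN.
have := c1 (x - v); lra.
Qed.

Lemma lact_sc (r : R) x : op (lact E (sc r)) x = r%:C *: x.
Proof. by rewrite lactZl lact1. Qed.

Lemma lact_spos b x : spos b -> spos (inner x (op (lact E b) x)).
Proof.
move=> [c hc ->]; rewrite lactMl -{1}hc -lact_inner.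
exact: hm_pos.
Qed.

(** The action preserves the positivity of |b|^2 - b^* b. *)
Lemma rnorm_lact b x : rnorm (op (lact E b) x) <= rnorm b * rnorm x.
Proof.
apply: le_of_sqr; first by rewrite mulr_ge0 ?rnorm_ge0.
rewrite exprMn !rnorm_inner lact_inner -lactMl.
rewrite -[rnorm b ^+ 2]ger0_norm ?sqr_ge0// -rnormZr.
apply: spos_le; first by apply: lact_spos; exact: spos_starM.
rewrite -innerZr -innerBr -lact_sc -lactBl.
by apply: lact_spos; exact: spos_sub_starM.
Qed.

End Corr.
End HilbertModules.

(** * Product systems and continuous sections *)

Lemma nbhs_initialP (S : choiceType) (T : topologicalType) (f : S -> T)
    (s : initial_topology f) (A : set S) :
  nbhs s A <-> exists2 C, nbhs (f s) C & f @^-1` C `<=` A.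
Proof.
split=> [[_ [[C Cop <-] Cs CA]]|[C fC CA]].
  by exists C => //; apply: open_nbhs_nbhs.
by apply: filterS CA _; exact: initial_continuous.
Qed.

Section RplusTopology.
Context {R : realType}.
Implicit Types s t : Rplus R.

Lemma nbhs_rpP t (A : set (Rplus R)) : nbhs t A <->
  exists2 d : R, 0 < d & forall s, `|rpval s - rpval t| < d -> A s.
Proof.
split=> [/(@nbhs_initialP _ _ (@rpval R))[C /nbhs_ballP[d d0 dC] CA]|[d d0 dA]].
  by exists d => // s st; apply/CA/dC; rewrite -ball_normE /= distrC.
apply/(@nbhs_initialP _ _ (@rpval R)); exists (ball (rpval t) d).
  exact: nbhsx_ballx.
by move=> s; rewrite /= -ball_normE /= distrC => /dA.
Qed.

Section Cont.
Context {V : normedModType (complex R)}.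

Lemma cont_rpP (f : Rplus R -> V) : continuous f <->
  forall t (e : R), 0 < e -> exists2 d : R, 0 < d &
    forall s, `|rpval s - rpval t| < d -> rnorm (f s - f t) < e.
Proof.
split=> [cf t e e0|h t].
  move: (cf t) => /cvg_rnormP/(_ e e0)/nbhs_rpP[d d0 dA].
  by exists d => // s /dA; rewrite rnormB.
apply/(@cvg_rnormP _ _ _ _ (nbhs_filter t)) => e e0; have [d d0 hd] := h t e e0.
by apply/nbhs_rpP; exists d => // s /hd; rewrite rnormB.
Qed.

Lemma cont_rp2P (f : Rplus R * Rplus R -> V) : continuous f ->
  forall s t (e : R), 0 < e -> exists2 d : R, 0 < d &
    forall s' t', `|rpval s' - rpval s| < d -> `|rpval t' - rpval t| < d ->
      rnorm (f (s', t') - f (s, t)) < e.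
Proof.
move=> cf s t e e0.
move: (cf (s, t)) => /cvg_rnormP/(_ e e0)[[U V'] [/= /nbhs_rpP[d d0 dU]
  /nbhs_rpP[d' d'0 dV] UV]].
exists (Num.min d d'); first by rewrite lt_min d0.
move=> s' t'; rewrite !lt_min => /andP[h1 _] /andP[_ h2].
by rewrite rnormB; apply: (UV (s', t')); split; [exact: dU|exact: dV].
Qed.

End Cont.
End RplusTopology.

Section ProductSystem.
Context {R : realType} {B : unitalCStarAlgType R} {P : ps_data B}
  (hP : is_product_system P).
Implicit Types (r s t : Rplus R) (b : B).

Lemma pm_inner s t (x x' : P s) (y y' : P t) :
  inner (ps_mul x y) (ps_mul x' y') = inner y (op (lact (P t) (inner x x')) y').
Proof.
have [T [tens [u [[h _ _] [ui _ _] uE]]]] := ps_mul_unitary hP s t.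
by rewrite !uE (iso_inner ui) h.
Qed.

Lemma pm_dense0 s t (z : P (s + t)) (e : R) : 0 < e ->
  exists n (k : 'I_n -> complex R) (x : 'I_n -> P s) (y : 'I_n -> P t),
    rnorm (z - \sum_(j < n) k j *: ps_mul (x j) (y j)) < e.
Proof.
have [T [tens [u [[_ _ h] [ui us _] uE]]]] := ps_mul_unitary hP s t.
move=> e0; have [w wE] := us z.
have [v [n [k [a [aA vE]]]] wv] := span_denseP h w e0.
have /choice[x /choice[y xy]] : forall j, exists x y, a j = tens x y.
  by move=> j; have [x [y]] := aA j; exists x, y.
exists n, k, x, y; rewrite -wE.
have -> : \sum_(j < n) k j *: ps_mul (x j) (y j) = u v.
  by rewrite vE (iso_sum ui); apply: eq_bigr => j _; rewrite (isoZ ui) uE xy.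
by rewrite -(isoB ui) (iso_norm ui).
Qed.

(** Bilinearity is not part of the data of the product. It follows, in the lemmas below, by testing
    against products, whose inner products are known and whose span is dense. *)
Lemma pm_inj s t (u v : P (s + t)) :
  (forall x y, inner (ps_mul x y) u = inner (ps_mul x y) v) -> u = v.
Proof.
move=> h; apply: (@dense_inner_inj _ _ _ [set w | exists n (k : 'I_n -> complex R)
    (x : 'I_n -> P s) (y : 'I_n -> P t), w = \sum_(j < n) k j *: ps_mul (x j) (y j)]).
  move=> w d /(pm_dense0 w)[n [k [x [y hw]]]].
  by exists (\sum_(j < n) k j *: ps_mul (x j) (y j)) => //; exists n, k, x, y.
move=> w [n [k [x [y ->]]]]; rewrite !inner_suml; apply: eq_bigr => j _.
by rewrite !innerZl h.
Qed.

Lemma pmDl s t (x x' : P s) (y : P t) :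
  ps_mul (x + x') y = ps_mul x y + ps_mul x' y.
Proof. by apply: pm_inj => a b; rewrite innerDr !pm_inner innerDr lactDl innerDr. Qed.

Lemma pmDr s t (x : P s) (y y' : P t) :
  ps_mul x (y + y') = ps_mul x y + ps_mul x y'.
Proof. by apply: pm_inj => a b; rewrite innerDr !pm_inner opD innerDr. Qed.

Lemma pmZl s t k (x : P s) (y : P t) : ps_mul (k *: x) y = k *: ps_mul x y.
Proof. by apply: pm_inj => a b; rewrite innerZr !pm_inner innerZr lactZl innerZr. Qed.

Lemma pmZr s t k (x : P s) (y : P t) : ps_mul x (k *: y) = k *: ps_mul x y.
Proof. by apply: pm_inj => a b; rewrite innerZr !pm_inner opZ innerZr. Qed.

Lemma pm_ractr s t (x : P s) (y : P t) b : ps_mul x (ract y b) = ract (ps_mul x y) b.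
Proof. by apply: pm_inj => u v; rewrite inner_ractr !pm_inner op_ract inner_ractr. Qed.

Lemma pmBl s t (x x' : P s) (y : P t) :
  ps_mul (x - x') y = ps_mul x y - ps_mul x' y.
Proof. by rewrite pmDl -scaleN1r pmZl scaleN1r. Qed.

Lemma pmBr s t (x : P s) (y y' : P t) :
  ps_mul x (y - y') = ps_mul x y - ps_mul x y'.
Proof. by rewrite pmDr -scaleN1r pmZr scaleN1r. Qed.

Lemma pm0l s t (y : P t) : ps_mul (0 : P s) y = 0.
Proof. by rewrite -(subrr 0) pmBl subrr. Qed.

Lemma pm0r s t (x : P s) : ps_mul x (0 : P t) = 0.
Proof. by rewrite -(subrr 0) pmBr subrr. Qed.

Lemma pm_norm s t (x : P s) (y : P t) : rnorm (ps_mul x y) <= rnorm x * rnorm y.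
Proof.
apply: le_of_sqr; first by rewrite mulr_ge0 ?rnorm_ge0.
rewrite exprMn rnorm_inner pm_inner; apply: le_trans (CS _ _) _.
have := rnorm_lact (inner x x) y; rewrite -rnorm_inner => h.
apply: le_trans (_ : rnorm y * (rnorm x ^+ 2 * rnorm y) <= _).
  by rewrite ler_wpM2l ?rnorm_ge0.
by rewrite mulrCA -expr2.
Qed.

Lemma pm_dense s t (z : P (s + t)) (e : R) : 0 < e ->
  exists l : seq (P s * P t), rnorm (z - \sum_(p <- l) ps_mul p.1 p.2) < e.
Proof.
move=> /(pm_dense0 z)[n [k [x [y h]]]].
exists [seq (k j *: x j, y j) | j <- enum 'I_n].
rewrite big_map big_enum /=.
by under eq_bigr do rewrite pmZl.
Qed.

Lemma cast_id t (e : t = t) (x : P t) : ps_cast e x = x.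
Proof. by rewrite (Prop_irrelevance e erefl). Qed.

Lemma castK s t (e : s = t) (x : P s) : ps_cast (esym e) (ps_cast e x) = x.
Proof. by case: _ / e. Qed.

Lemma castB s t (e : s = t) (x y : P s) : ps_cast e (x - y) = ps_cast e x - ps_cast e y.
Proof. by case: _ / e. Qed.

Lemma cast_norm s t (e : s = t) (x : P s) : rnorm (ps_cast e x) = rnorm x.
Proof. by case: _ / e. Qed.

Lemma cast_emb (F : Type) (i : forall t, P t -> F) s t (e : s = t) (x : P s) :
  i t (ps_cast e x) = i s x.
Proof. by case: _ / e. Qed.

Section Continuous.
Context {Ehat : hilbertModType B} {i : forall t, P t -> Ehat}
  (hi : forall t, isometric_embedding (i t)) (hc : is_continuous_ps i).

(** Continuity at a single time, because stable sections are continuous only beyond some time. *)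
Definition scont (x : forall t, P t) (t : Rplus R) :=
  forall e : R, 0 < e -> exists2 d : R, 0 < d &
    forall s, `|rpval s - rpval t| < d -> rnorm (i (x s) - i (x t)) < e.

Lemma cont_sectionsP x : cont_sections i x <-> forall t, scont x t.
Proof. by split=> [/cont_rpP//|h]; apply/cont_rpP. Qed.

Lemma scont_ex t (y : P t) : exists2 x, (forall s, scont x s) & x t = y.
Proof. by case: hc => /(_ t y)[x /cont_sectionsP hx xy] _; exists x. Qed.

Lemma eq_scont x y t : (forall s, x s = y s) -> scont x t -> scont y t.
Proof. by move=> xy h e /h[d d0 hd]; exists d => // s; rewrite -!xy; exact: hd. Qed.

Lemma scontD x y t : scont x t -> scont y t -> scont (fun s => x s + y s) t.
Proof.
move=> hx hy e e0; have e2 : 0 < e / 2 by lra.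
have [d d0 hd] := hx _ e2; have [d' d'0 hd'] := hy _ e2.
exists (Num.min d d'); first by rewrite lt_min d0.
move=> s; rewrite lt_min => /andP[/hd h1 /hd' h2].
rewrite !(isoD (hi _)) opprD addrACA; apply: le_lt_trans (rnormD _ _) _; lra.
Qed.

Lemma scontZ (f : R -> R) x t : 
  (forall e : R, 0 < e -> exists2 d : R, 0 < d &
    forall s : R, `|s - rpval t| < d -> `|f s - f (rpval t)| < e) ->
  scont x t -> scont (fun s => (f (rpval s))%:C *: x s) t.
Proof.
move=> hf hx e e0.
set a := f (rpval t); have e2 : 0 < e / 2 by lra.
have [c [c0 c1 ce]] := small_mul (normr_ge0 a) e2.
have [|c' [c'0 c'1 c'e]] := @small_mul _ (rnorm (x t) + 1) (e / 2) _ e2.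
  by rewrite addr_ge0 ?rnorm_ge0.
have [d d0 hd] := hf _ c'0; have [d' d'0 hd'] := hx _ c0.
exists (Num.min d d'); first by rewrite lt_min d0.
move=> s; rewrite lt_min => /andP[/hd h1 /hd' h2]; rewrite !(isoZ (hi _)).
have -> : (f (rpval s))%:C *: i (x s) - (f (rpval t))%:C *: i (x t) =
  (f (rpval s) - a)%:C *: i (x s) + a%:C *: (i (x s) - i (x t)).
  by rewrite rmorphB scalerBl scalerBr addrA subrK.
apply: le_lt_trans (rnormD _ _) _; rewrite !rnormZr.
have h3 : `|a| * rnorm (i (x s) - i (x t)) <= `|a| * c by rewrite ler_wpM2l// ltW.
have h4 : rnorm (i (x s)) <= rnorm (x t) + 1.
  have := rnorm_sub (i (x s)) (i (x t)); rewrite (iso_norm (hi t)); lra.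
have h5 : `|f (rpval s) - a| * rnorm (i (x s)) <= c' * (rnorm (x t) + 1).
  by apply: ler_pM => //; [exact: rnorm_ge0|exact: ltW].
rewrite mulrC in c'e; lra.
Qed.

Lemma scontZc (k : complex R) x t : scont x t -> scont (fun s => k *: x s) t.
Proof.
move=> hx e e0; have [c [c0 _ ce]] := small_mul (Re_norm_ge0 k) e0.
have [d d0 hd] := hx _ c0; exists d => // s /hd h.
rewrite !(isoZ (hi _)) -scalerBr rnormZ; apply: le_lt_trans ce.
by rewrite ler_wpM2l ?Re_norm_ge0 ?ltW.
Qed.

Lemma scont_ract b x t : scont x t -> scont (fun s => ract (x s) b) t.
Proof.
move=> hx e e0; have [c [c0 _ ce]] := small_mul (rnorm_ge0 b) e0.
have [d d0 hd] := hx _ c0; exists d => // s /hd h.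
rewrite !(iso_ract (hi _)).
have -> : ract (i (x s)) b - ract (i (x t)) b = ract (i (x s) - i (x t)) b.
  by rewrite ractDl; congr (_ + _); rewrite -scaleN1r -ractZl scaleN1r.
apply: le_lt_trans (rnorm_ract _ _) _; apply: le_lt_trans ce.
by rewrite mulrC ler_wpM2l ?rnorm_ge0 ?ltW.
Qed.

Lemma scontB x y t : scont x t -> scont y t -> scont (fun s => x s - y s) t.
Proof.
move=> hx hy; apply: eq_scont (scontD hx (scontZc (-1) hy)) => s.
by rewrite scaleN1r.
Qed.

Lemma scont_norm x t : scont x t -> forall e : R, 0 < e -> exists2 d : R, 0 < d &
    forall s, `|rpval s - rpval t| < d -> rnorm (x s) < rnorm (x t) + e.
Proof.
move=> hx e /hx[d d0 hd]; exists d => // s /hd.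
rewrite -(iso_norm (hi s)) -(iso_norm (hi t)).
have := rnorm_sub (i (x s)) (i (x t)); lra.
Qed.

Lemma scont_inner x y t : scont x t -> scont y t ->
  forall e : R, 0 < e -> exists2 d : R, 0 < d &
    forall s, `|rpval s - rpval t| < d ->
      rnorm (inner (x s) (y s) - inner (x t) (y t)) < e.
Proof.
move=> hx hy e e0; pose C := rnorm (x t) + rnorm (y t) + 1.
have C0 : 0 <= C by have := rnorm_ge0 (x t); have := rnorm_ge0 (y t); rewrite /C; lra.
have [c [c0 c1 ce]] := small_mul C0 e0.
have [d d0 hd] := hx _ c0; have [d' d'0 hd'] := hy _ c0.
exists (Num.min d d'); first by rewrite lt_min d0.
move=> s; rewrite lt_min => /andP[/hd h1 /hd' h2].
rewrite -(iso_inner (hi s)) -(iso_inner (hi t)).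
set X := i (x s) in h1 *; set X0 := i (x t) in h1 *.
set Y := i (y s) in h2 *; set Y0 := i (y t) in h2 *.
have -> : inner X Y - inner X0 Y0 = inner (X - X0) Y + inner X0 (Y - Y0).
  by rewrite innerBl innerBr addrA subrK.
apply: le_lt_trans (rnormD _ _) _.
have := CS (X - X0) Y; have := CS X0 (Y - Y0).
have := rnorm_sub Y Y0.
have := iso_norm (hi t) (x t); have := iso_norm (hi t) (y t); rewrite -/X0 -/Y0.
have := rnorm_ge0 (X - X0); have := rnorm_ge0 (Y - Y0).
have := rnorm_ge0 X0; have := rnorm_ge0 Y0; have := rnorm_ge0 Y.
rewrite /C in ce; nra.
Qed.

(** Condition (2) of a continuous product system concerns sections continuous everywhere, whereas x
    and y are continuous at one time only. They are replaced by global sections x' and y' through x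
    s and y t; the errors x - x' and y - y' are small near s and t. *)
Lemma scont_mul x y s t : scont x s -> scont y t ->
  forall e : R, 0 < e -> exists2 d : R, 0 < d &
    forall s' t', `|rpval s' - rpval s| < d -> `|rpval t' - rpval t| < d ->
      rnorm (i (ps_mul (x s') (y t')) - i (ps_mul (x s) (y t))) < e.
Proof.
move=> hx hy e e0.
have [x' cx xx] := scont_ex (x s); have [y' cy yy] := scont_ex (y t).
pose C := rnorm (x s) + rnorm (y t) + 2.
have C0 : 0 <= C by have := rnorm_ge0 (x s); have := rnorm_ge0 (y t); rewrite /C; lra.
have e2 : 0 < e / 2 by lra.
have [c [c0 c1 ce]] := small_mul C0 e2.
have [d1 d10 hd1] := scont_norm (scontB hx (cx s)) c0.
have [d2 d20 hd2] := scont_norm (scontB hy (cy t)) c0.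
have [d3 d30 hd3] := scont_norm (cx s) ltr01.
have [d4 d40 hd4] := scont_norm hy ltr01.
have [d5 d50 hd5] := cont_rp2P (hc.2 _ _ (proj2 (cont_sectionsP _) cx)
  (proj2 (cont_sectionsP _) cy)) s t e2.
exists (Num.min d1 (Num.min d2 (Num.min d3 (Num.min d4 d5)))).
  by rewrite !lt_min d10 d20 d30 d40.
move=> s' t'; rewrite !lt_min => /and5P[s1 s2 s3 s4 s5] /and5P[t1 t2 t3 t4 t5].
have := hd1 _ s1; have := hd2 _ t2; have := hd3 _ s3; have := hd4 _ t4.
have := hd5 _ _ s5 t5; rewrite /= xx yy !subrr !rnorm0 !add0r => k5 k4 k3 k2 k1.
have -> : i (ps_mul (x s') (y t')) - i (ps_mul (x s) (y t)) =
  i (ps_mul (x s' - x' s') (y t')) + i (ps_mul (x' s') (y t' - y' t')) +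
  (i (ps_mul (x' s') (y' t')) - i (ps_mul (x s) (y t))).
  by rewrite -(isoD (hi _)) pmBl pmBr subrKA (isoB (hi _)) subrKA.
apply: le_lt_trans (rnormD _ _) _.
have := rnormD (i (ps_mul (x s' - x' s') (y t'))) (i (ps_mul (x' s') (y t' - y' t'))).
rewrite !(iso_norm (hi _)).
have := pm_norm (x s' - x' s') (y t'); have := pm_norm (x' s') (y t' - y' t').
have := rnorm_ge0 (x s' - x' s'); have := rnorm_ge0 (y t' - y' t').
have := rnorm_ge0 (y t'); have := rnorm_ge0 (x' s').
rewrite /C in ce; nra.
Qed.

End Continuous.
End ProductSystem.

(** * Means of eventually periodic functions *)

Section Segment.
Context {R : realType}.

(** A Lebesgue number argument: compactness turns local radii into one radius, provided P passes to
    smaller radii. *)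
Lemma segment_unif (P : R -> R -> Prop) (u v : R) :
  (forall d d' t, 0 < d' -> d' <= d -> P d t -> P d' t) ->
  (forall t0, u <= t0 <= v -> exists2 r, 0 < r & forall t, `|t - t0| < r ->
      u <= t <= v -> P r t) ->
  exists2 d, 0 < d & forall t, u <= t <= v -> P d t.
Proof.
move=> Pmono Ploc.
have /compact_near_coveringP cov := @segment_compact R u v.
have := cov R (0 : R)^'+ (fun d t => u <= t <= v -> P d t) _.
case=> [x /=|d /= d0 dP].
  rewrite in_itv /= => /Ploc[r r0 hr].
  exists (ball x r, [set d | 0 < d < r]) => /=.
    split; first exact: nbhsx_ballx.
    by near=> d; apply/andP; split; near: d; [exact: nbhs_right_gt|exact: nbhs_right_lt].
  move=> [t d] /= [xt /andP[d0 dr]] uv; apply: (Pmono r) => //; first exact: ltW.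
  by apply: hr => //; move: xt; rewrite -ball_normE /= distrC.
have d1 : 0 < d / 2 by rewrite divr_gt0.
exists (d / 2) => // t tuv; apply: (dP (d / 2)) => //=.
  by rewrite sub0r normrN ger0_norm ?ltW//; move: d0 d1; rewrite /=; lra.
Unshelve. all: by end_near.
Qed.

End Segment.

Section Rp.
Context {R : realType}.
Implicit Types (r : R) (s t : Rplus R).

(** The absolute value makes this embedding total; for r >= 0 it is the point r itself. *)
Definition rp r : Rplus R := MkRplus (normr_ge0 r).

Lemma rpE r : 0 <= r -> rpval (rp r) = r.
Proof. exact: ger0_norm. Qed.

Lemma rpD s t : rpval (s + t) = rpval s + rpval t. Proof. by []. Qed.

Lemma rp_eq s t : rpval s = rpval t -> s = t. Proof. exact: val_inj. Qed.

Lemma rp_subK s t : rpval s <= rpval t -> rp (rpval t - rpval s) + s = t.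
Proof. by move=> st; apply: rp_eq; rewrite rpD rpE ?subr_ge0// subrK. Qed.

Lemma rpMn s n : rpval (s *+ n) = rpval s * n%:R.
Proof.
elim: n => [|n IH]; first by rewrite mulr0n mulr0.
by rewrite mulrS rpD IH -natr1 mulrDr mulr1 addrC.
Qed.

Lemma rp_decomp (a t : Rplus R) n : 0 <= rpval t - rpval a * n%:R ->
  t = a *+ n + rp (rpval t - rpval a * n%:R).
Proof.
by rewrite -rpMn => h; rewrite addrC rp_subK// -subr_ge0.
Qed.

End Rp.

Lemma window_step {R : realType} (h T t : R) : 0 < h -> T <= t ->
  exists n : nat, T <= t - h * n%:R < T + h.
Proof.
move=> h0 Tt; exists (Num.truncn ((t - T) / h)).
have : 0 <= (t - T) / h by rewrite divr_ge0 ?subr_ge0// ltW.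
move=> /truncn_itv/andP[]; rewrite ler_pdivlMr// ltr_pdivrMr// -natr1 => h1 h2.
by apply/andP; split; lra.
Qed.

Section Avg.
Context {R : realType} {V : normedModType (complex R)}.
Implicit Types F G : nat -> V.

Definition avg n F : V := (n.+1%:R^-1 : R)%:C *: \sum_(k < n.+1) F k.

Lemma avgD n F G : avg n (fun k => F k + G k) = avg n F + avg n G.
Proof. by rewrite /avg big_split scalerDr. Qed.

Lemma avg_cst n (c : V) : avg n (fun=> c) = c.
Proof.
rewrite /avg sumr_const card_ord -[c *+ _]scaler_nat scalerA.
rewrite -(rmorph_nat (real_complex R)) -rmorphM.
by rewrite mulVf ?scale1r// pnatr_eq0.
Qed.

Lemma avg_norm n F (C : R) : (forall k, rnorm (F k) <= C) -> rnorm (avg n F) <= C.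
Proof.
move=> FC; rewrite /avg rnormZr ger0_norm ?invr_ge0//.
rewrite ler_pdivrMl//; apply: le_trans (rnorm_sum _ _ _) _.
apply: le_trans (ler_sum _ (fun (k : 'I_n.+1) _ => FC k)) _.
by rewrite sumr_const card_ord mulr_natl.
Qed.

Lemma avg_close n F c (e : R) : (forall k, rnorm (F k - c) <= e) ->
  rnorm (avg n F - c) <= e.
Proof.
move=> h; have -> : avg n F - c = avg n (fun k => F k - c).
  by rewrite avgD (avg_cst n (- c)).
exact: avg_norm.
Qed.

Lemma avg_dist n F G (e : R) : (forall k, rnorm (F k - G k) <= e) ->
  rnorm (avg n F - avg n G) <= e.
Proof.
move=> h; have -> : avg n F - avg n G = avg n (fun k => F k - G k).
  by rewrite /avg -scalerBr sumrB.
exact: avg_norm.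
Qed.

Lemma avg_exchange n m (F : nat -> nat -> V) :
  avg n (fun k => avg m (F k)) = avg m (fun j => avg n (fun k => F k j)).
Proof.
rewrite /avg -!scaler_sumr exchange_big /= !scalerA; congr (_ *: _).
by rewrite mulrC.
Qed.

Lemma eq_avg n F G : (forall k, F k = G k) -> avg n F = avg n G.
Proof. by move=> FG; rewrite /avg; congr (_ *: _); apply: eq_bigr => k _. Qed.

End Avg.

Section Mean.
Context {R : realType} {V : completeNormedModType (complex R)}.
Context (a : Rplus R) (a0 : 0 < rpval a).
Implicit Types (f g : Rplus R -> V) (T : Rplus R).

Definition eventually_periodic (A : Type) (f : Rplus R -> A) (al : R) :=
  forall t : Rplus R, al < rpval t -> f (a + t) = f t.

Lemma periodicMn (A : Type) (f : Rplus R -> A) al n t :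
  eventually_periodic f al -> al < rpval t -> f (a *+ n + t) = f t.
Proof.
move=> fp alt; elim: n => [|n IH]; first by rewrite mulr0n add0r.
rewrite mulrS -addrA fp ?IH// rpD rpMn.
by apply: (lt_le_trans alt); rewrite lerDr mulr_ge0// ltW.
Qed.

Lemma window (T t : R) : T <= t -> exists n : nat,
  T <= t - rpval a * n%:R < T + rpval a.
Proof. exact: window_step. Qed.

Definition eventually_continuous f (al : R) := forall t : Rplus R, al < rpval t ->
  forall e : R, 0 < e -> exists2 d : R, 0 < d &
    forall s, `|rpval s - rpval t| < d -> rnorm (f s - f t) < e.

(** Compactness gives a uniform radius over one period, and s and t are moved back by the same
    multiple of a. The margin al + 1 < T together with d <= 1 keeps s, too, in the range where f is
    periodic. *)
Lemma periodic_unif f al (T : R) : eventually_periodic f al -> eventually_continuous f al ->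
  al + 1 < T -> 1 <= T -> forall e : R, 0 < e -> exists d : R, [/\ 0 < d, d <= 1 &
   forall s t : Rplus R, T <= rpval t -> `|rpval s - rpval t| <= d -> rnorm (f s - f t) <= e].
Proof.
move=> fp fc alT T1 e e0.
pose P (d t : R) := forall s s' : Rplus R, rpval s' = t ->
  `|rpval s - t| <= d -> rnorm (f s - f s') <= e.
have [d d0 dP] : exists2 d, 0 < d & forall t, T <= t <= T + rpval a -> P d t.
  apply: segment_unif => [d d' t d'0 dd' hP s s' st ss|t0 /andP[Tt0 h2]].
    by apply: hP => //; apply: le_trans dd'.
  have [|d d0 hd] := fc (rp t0) _ (e / 2) (divr_gt0 e0 (ltr0n _ 2)).
    by rewrite rpE//; lra.
  rewrite rpE in hd; last by lra.
  exists (d / 2); first lra.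
  move=> t tt0 _ s s' s't st.
  have k1 : `|rpval s - t0| < d.
    by have := ler_distD t (rpval s) t0; lra.
  have k2 : `|rpval s' - t0| < d by rewrite s't; apply: lt_trans tt0 _; lra.
  have := hd _ k1; have := hd _ k2; have := rnorm_tri (f (rp t0)) (f s) (f s').
  have := rnormB (f s') (f (rp t0)); lra.
exists (Num.min d 1); split; [by rewrite lt_min d0 ltr01|by rewrite ge_min lexx orbT|].
move=> s t Tt; rewrite le_min => /andP[st1 st2].
have [n /andP[n1 n2]] := window Tt.
set u := rpval t - _ in n1 n2.
have u0 : 0 <= u by lra.
have tE : t = a *+ n + rp u by apply: rp_decomp.
pose w := rpval s - rpval a * n%:R.
have wu : w - u = rpval s - rpval t by rewrite /w /u; lra.
have w0 : T - 1 <= w by move: st2; rewrite -wu ler_norml => /andP[]; lra.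
have w00 : 0 <= w by lra.
have sE : s = a *+ n + rp w by apply: rp_decomp.
have alu : al < rpval (rp u) by rewrite rpE//; lra.
have alw : al < rpval (rp w) by rewrite rpE//; lra.
rewrite tE sE (periodicMn _ fp alu) (periodicMn _ fp alw).
apply: (dP u); [by apply/andP; split; lra|exact: rpE|].
by rewrite rpE// wu.
Qed.

Definition riemann f n (T : Rplus R) : V :=
  avg n (fun k => f (T + rp (k%:R * (rpval a / n.+1%:R)))).

(** The mesh tends to 0 and, independently, the base point to infinity. The mean thus depends only
    on large times and is insensitive to shifts, without reference to the periodicity of f. *)
Definition is_mean f m := forall e : R, 0 < e -> exists (N : nat) (T0 : R),
  forall n T, (N <= n)%N -> T0 <= rpval T -> rnorm (riemann f n T - m) <= e.

Lemma is_mean_uniq f m m' : is_mean f m -> is_mean f m' -> m = m'.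
Proof.
move=> h h'; apply: (@eq_of_small _ _ _ _ 2) => e e0.
have [N [T hN]] := h _ e0; have [N' [T' hN']] := h' _ e0.
have TE : rpval (rp (Num.max 0 (Num.max T T'))) = Num.max 0 (Num.max T T').
  by rewrite rpE// le_max lexx.
have := hN (maxn N N') (rp (Num.max 0 (Num.max T T'))) (leq_maxl _ _).
have := hN' (maxn N N') (rp (Num.max 0 (Num.max T T'))) (leq_maxr _ _).
rewrite TE !le_max !lexx !orbT => /(_ isT) h1 /(_ isT) h2.
move: h1 h2; set q := riemann _ _ _ => h1 h2.
have := rnorm_tri q m m'; have := rnormB m q; lra.
Qed.

Lemma is_meanD f g m l : is_mean f m -> is_mean g l ->
  is_mean (fun t => f t + g t) (m + l).
Proof.
move=> hf hg e e0; have e2 : 0 < e / 2 by lra.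
have [N [T hN]] := hf _ e2; have [N' [T' hN']] := hg _ e2.
exists (maxn N N'), (Num.max T T') => n u; rewrite geq_max ge_max.
move=> /andP[n1 n2] /andP[u1 u2]; rewrite /riemann avgD opprD addrACA.
have := hN _ _ n1 u1; have := hN' _ _ n2 u2 => h1 h2.
apply: le_trans (rnormD _ _) _; rewrite /riemann in h1 h2; lra.
Qed.

Lemma is_mean_cst (m : V) : is_mean (fun=> m) m.
Proof.
move=> e e0; exists 0%N, 0 => n T _ _.
by rewrite /riemann avg_cst subrr rnorm0 ltW.
Qed.

Lemma eq_is_mean f g m (T : R) : (forall t, T <= rpval t -> f t = g t) ->
  is_mean f m -> is_mean g m.
Proof.
move=> fg hf e /hf[N [T' hN]]; exists N, (Num.max T T') => n u Nn.
rewrite ge_max => /andP[u1 u2]; have := hN _ _ Nn u2.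
rewrite /riemann (@eq_avg _ _ _ _ (fun k => g (u + rp (k%:R * (rpval a / n.+1%:R)))))//.
by move=> k; apply: fg; rewrite rpD; apply: (le_trans u1); rewrite lerDl rpval_ge0.
Qed.

Lemma is_mean_shift f g s m (T : R) : (forall t, T <= rpval t -> g (t + s) = f t) ->
  is_mean f m -> is_mean g m.
Proof.
move=> fg hf e /hf[N [T' hN]]; exists N, (Num.max 0 (Num.max T T') + rpval s) => n u Nn us.
have su : rpval s <= rpval u.
  by apply: le_trans us; rewrite lerDr le_max lexx.
rewrite -(rp_subK su); set u' := rp _.
have u'E : rpval u' = rpval u - rpval s by rewrite rpE// subr_ge0.
have : Num.max 0 (Num.max T T') <= rpval u' by rewrite u'E lerBrDr.
rewrite !ge_max => /and3P[_ u1 u2]; have := hN _ _ Nn u2.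
rewrite /riemann (@eq_avg _ _ _ _ (fun k => g (u' + s + rp (k%:R * (rpval a / n.+1%:R)))))//.
move=> k; rewrite addrAC fg// rpD; apply: (le_trans u1).
by rewrite lerDl rpval_ge0.
Qed.

Lemma is_mean_bound f m (C T : R) : (forall t, T <= rpval t -> rnorm (f t) <= C) ->
  is_mean f m -> rnorm m <= C.
Proof.
move=> fC hf; apply/ler_addgt0Pr => e /hf[N [T' hN]].
pose u := rp (Num.max 0 (Num.max T T')).
have uE : rpval u = Num.max 0 (Num.max T T') by rewrite rpE// le_max lexx.
have := hN N u (leqnn _); rewrite uE !le_max lexx !orbT => /(_ isT) h.
have : rnorm (riemann f N u) <= C.
  apply: avg_norm => k; apply: fC; rewrite rpD uE.
  apply: (@le_trans _ _ (Num.max 0 (Num.max T T'))).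
    by rewrite !le_max lexx orbT.
  by rewrite lerDl rpval_ge0.
have := rnorm_sub m (riemann f N u); have := rnormB m (riemann f N u); lra.
Qed.

(** A shift by one mesh width permutes the sample points cyclically: the last one moves to the first
    one plus a. *)
Lemma riemann_step f al n T : eventually_periodic f al -> al < rpval T ->
  riemann f n (T + rp (rpval a / n.+1%:R)) = riemann f n T.
Proof.
move=> fp alT; rewrite /riemann /avg; congr (_ *: _).
set h := rpval a / n.+1%:R; have h0 : 0 <= h by rewrite divr_ge0 ?rpval_ge0.
have kh k : 0 <= k%:R * h by exact: mulr_ge0.
pose F k := f (T + rp (k%:R * h)).
transitivity (\sum_(k < n.+1) F k.+1).
  apply: eq_bigr => k _; rewrite /F; congr f; apply: rp_eq.
  rewrite !rpD (rpE (kh _)) (rpE (kh _)) (rpE h0) -natr1 mulrDl mul1r -addrA.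
  by congr (_ + _); exact: addrC.
rewrite -[RHS]/(\sum_(k < n.+1) F k) big_ord_recr big_ord_recl /= addrC.
congr (_ + _); rewrite /F (_ : T + rp (n.+1%:R * h) = a + (T + rp (0%:R * h))).
  by apply: fp; rewrite rpD rpE ?mul0r// addr0.
apply: rp_eq; rewrite !rpD (rpE (kh _)) (rpE (kh _)) mul0r addr0 addrC /h.
by rewrite mulrCA mulfV ?mulr1// pnatr_eq0.
Qed.

(** Write u = j h + v with h the mesh and 0 <= v < h. The multiples of h leave the sum unchanged,
    and v moves each sample by less than the mesh. *)
Lemma riemann_shift f al n (T u : Rplus R) (e : R) : eventually_periodic f al ->
  al < rpval T ->
  (forall s t : Rplus R, rpval T <= rpval t ->
     `|rpval s - rpval t| <= rpval a / n.+1%:R -> rnorm (f s - f t) <= e) ->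
  rnorm (riemann f n (T + u) - riemann f n T) <= e.
Proof.
move=> fp alT hf; set h := rpval a / n.+1%:R.
have h0 : 0 < h by rewrite divr_gt0.
have [j /andP[]] := window_step h0 (rpval_ge0 u).
rewrite add0r; set v := rpval u - _ => v0 vh.
have step k (w : Rplus R) : al < rpval w ->
    riemann f n (w + rp h *+ k) = riemann f n w.
  move=> alw; elim: k => [|k IH]; first by rewrite mulr0n addr0.
  rewrite mulrSr addrA (riemann_step _ fp) ?IH// rpD.
  by apply: (lt_le_trans alw); rewrite lerDl rpval_ge0.
have -> : T + u = T + rp v + rp h *+ j.
  by apply: rp_eq; rewrite !rpD rpMn (rpE v0) (rpE (ltW h0)) /v -addrA subrK.
rewrite step; last by apply: (lt_le_trans alT); rewrite rpD lerDl rpval_ge0.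
apply: avg_dist => k; apply: hf; first by rewrite rpD lerDl rpval_ge0.
rewrite !rpD (_ : _ - _ = rpval (rp v)); last by lra.
by rewrite (rpE v0) ger0_norm// ltW.
Qed.

Lemma is_mean_ex f al : eventually_periodic f al -> eventually_continuous f al ->
  exists m, is_mean f m.
Proof.
move=> fp fc; pose T1 := Num.max 1 (al + 2).
have T11 : 1 <= T1 by rewrite le_max lexx.
have T1al : al + 2 <= T1 by rewrite le_max lexx orbT.
have main (e : R) : 0 < e -> exists N, forall n (T u : Rplus R), (N <= n)%N ->
    T1 <= rpval T -> rnorm (riemann f n (T + u) - riemann f n T) <= e.
  move=> e0; have [|d [d0 _ hd]] := periodic_unif fp fc _ T11 e0; first by lra.
  have [N hN] := inv_small (divr_gt0 d0 a0); exists N => n T u /hN nd TT.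
  apply: (riemann_shift u fp); first lra.
  move=> s t Tt st; apply: hd; first exact: le_trans Tt.
  apply: (le_trans st); rewrite mulrC -ler_pdivlMr//; exact: ltW.
have main2 (e : R) : 0 < e -> exists N, forall n m (T : Rplus R), (N <= n)%N ->
    (N <= m)%N -> T1 <= rpval T -> rnorm (riemann f n T - riemann f m T) <= e.
  move=> e0; have e2 : 0 < e / 2 by lra.
  have [N hN] := main _ e2; exists N => n m T Nn Nm TT.
  (* The common refinement of both sums: A averages shifts of the n-sum and, after exchanging the
     averages, shifts of the m-sum. It is therefore close to both. *)
  pose A := avg m (fun j => riemann f n (T + rp (j%:R * (rpval a / m.+1%:R)))).
  have h1 : rnorm (A - riemann f n T) <= e / 2 by apply: avg_close => k; exact: hN.
  have h2 : rnorm (A - riemann f m T) <= e / 2.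
    rewrite /A /riemann avg_exchange; apply: avg_close => k.
    set q := rp (k%:R * _).
    have := hN m T q Nm TT; rewrite /riemann.
    rewrite (@eq_avg _ _ _ (fun k => f (T + q + _)) (fun k0 => f (T + rp (k0%:R * (rpval a / m.+1%:R)) + q)))//.
    by move=> k0; rewrite addrAC.
  have := rnorm_tri A (riemann f n T) (riemann f m T).
  have := rnormB A (riemann f n T); lra.
pose T := rp T1; have TT : T1 <= rpval T by rewrite rpE//; lra.
have [m hm] : exists m, rlim (fun n => riemann f n T) m.
  apply: rcauchy_cvg => e e0; have e2 : 0 < e / 2 by lra.
  have [N hN] := main2 _ e2; exists N => n m Nn Nm.
  by have := hN _ _ _ Nn Nm TT; lra.
exists m => e e0; have e2 : 0 < e / 2 by lra.
have [N hN] := main _ e2; have [M hM] := hm _ e2.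
exists (maxn N M), T1 => n u; rewrite geq_max => /andP[Nn Mn] T1u.
have := rnorm_tri (riemann f n T) (riemann f n u) m; have := hM _ Mn.
have := hN n T (rp (rpval u - rpval T)) Nn TT.
have Tu : rpval T <= rpval u by rewrite rpE//; lra.
rewrite [T + rp _]addrC rp_subK//; lra.
Qed.

End Mean.

Lemma is_mean_morph {R : realType} {V W : completeNormedModType (complex R)}
    (a : Rplus R) (L : V -> W) (C : R) (f : Rplus R -> V) m :
  {morph L : x y / x + y} -> (forall (k : R) x, L (k%:C *: x) = k%:C *: L x) ->
  (forall x, rnorm (L x) <= C * rnorm x) -> 0 <= C ->
  is_mean a f m -> is_mean a (L \o f) (L m).
Proof.
move=> LD LZ LC C0 hf e e0; have [c [c0 _ ce]] := small_mul C0 e0.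
have [N [T hN]] := hf _ c0; exists N, T => n u Nn Tu.
have L0 : L 0 = 0 by rewrite -(scale0r (0 : V)) -[0 in LHS](rmorph0 (real_complex R)) LZ rmorph0 scale0r.
have -> : riemann a (L \o f) n u = L (riemann a f n u).
  rewrite /riemann /avg LZ; congr (_ *: _).
  by elim/big_ind2: _ => //= x x' y y' -> ->; rewrite LD.
have -> : L (riemann a f n u) - L m = L (riemann a f n u - m).
  by rewrite LD; congr (_ + _); apply: (addrI (L m)); rewrite -LD !subrr L0.
apply: le_trans (LC _) _; apply: le_trans (ltW ce).
by rewrite ler_wpM2l// hN.
Qed.

Lemma is_mean_spos {R : realType} {B : unitalCStarAlgType R} (a : Rplus R)
    (f : Rplus R -> B) m (T : R) :
  (forall t, T <= rpval t -> spos (f t)) -> is_mean a f m -> spos m.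
Proof.
move=> fp hf.
have pos n u : T <= rpval u -> spos (riemann a f n u).
  move=> Tu; apply: sposZ; first by rewrite invr_ge0.
  apply: (big_ind (@spos _ B)) => [||k _]; [exact: spos0|exact: sposD|].
  by apply: fp; rewrite rpD; apply: (le_trans Tu); rewrite lerDl rpval_ge0.
have /choice[x hx] : forall n : nat, exists x, spos x /\ rnorm (x - m) <= n.+1%:R^-1.
  move=> n; have [|N [T' hN]] := hf (n.+1%:R^-1); first by rewrite invr_gt0.
  pose u := rp (Num.max 0 (Num.max T T')).
  have uE : rpval u = Num.max 0 (Num.max T T') by rewrite rpE// le_max lexx.
  exists (riemann a f N u); split.
    by apply: pos; rewrite uE !le_max lexx orbT.
  by apply: hN => //; rewrite uE !le_max lexx !orbT.
apply: (@spos_lim _ _ x) => [n|e /inv_small[N hN]]; first exact: (hx n).1.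
by exists N => n /hN h; apply: le_lt_trans (hx n).2 h.
Qed.

(** * Shifts of sections *)

Section Sections.
Context {R : realType} {B : unitalCStarAlgType R} {P : ps_data B}
  (hP : is_product_system P).
Context {Ehat : hilbertModType B} {i : forall t, P t -> Ehat}
  (hi : forall t, isometric_embedding (i t)) (hc : is_continuous_ps i).
Context (a : Rplus R) (a0 : 0 < rpval a) (z : P a) (z1 : inner z z = 1).
Local Notation section := (forall t : Rplus R, P t).
Local Notation cont_at := (@scont R B P Ehat i).
Implicit Types (r s t : Rplus R) (x y g : section).

Lemma section_cast x s t (e : s = t) : x t = ps_cast e (x s).
Proof. by case: _ / e. Qed.

Lemma rp_subKl s t : rpval s <= rpval t -> s + rp (rpval t - rpval s) = t.
Proof. by move=> st; rewrite addrC rp_subK. Qed.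

Definition rsh s x (q : P s) : section := fun r =>
  match pselect (rpval s <= rpval r) with
  | left h => ps_cast (rp_subK h) (ps_mul (x (rp (rpval r - rpval s))) q)
  | right _ => 0
  end.

(** The value 0 before time a is essential for periodization: the n-fold shift vanishes before n a,
    so the sum of all shifts is finite at each time. *)
Definition lsh x : section := fun r =>
  match pselect (rpval a <= rpval r) with
  | left h => ps_cast (rp_subKl h) (ps_mul z (x (rp (rpval r - rpval a))))
  | right _ => 0
  end.

Lemma rshE s x (q : P s) t : rsh x q (t + s) = ps_mul (x t) q.
Proof.
rewrite /rsh; case: pselect => [h|[]]; last by rewrite rpD lerDr rpval_ge0.
move: (rp_subK h); have -> : rp (rpval (t + s) - rpval s) = t.
  by apply: rp_eq; rewrite rpD addrK rpE ?rpval_ge0.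
by move=> e; rewrite cast_id.
Qed.

Lemma rsh0 s x (q : P s) r : rpval r < rpval s -> rsh x q r = 0.
Proof. by rewrite /rsh ltNge => /negP h; case: pselect. Qed.

Lemma lshE x t : lsh x (a + t) = ps_mul z (x t).
Proof.
rewrite /lsh; case: pselect => [h|[]]; last by rewrite rpD lerDl rpval_ge0.
move: (rp_subKl h); have -> : rp (rpval (a + t) - rpval a) = t.
  by apply: rp_eq; rewrite rpD addrC addKr rpE ?rpval_ge0.
by move=> e; rewrite cast_id.
Qed.

Lemma lsh0 x r : rpval r < rpval a -> lsh x r = 0.
Proof. by rewrite /lsh ltNge => /negP h; case: pselect. Qed.

Lemma shiftP s r : rpval r < rpval s \/ exists t, r = t + s.
Proof.
case: (ltP (rpval r) (rpval s)) => h; [by left|right].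
by exists (rp (rpval r - rpval s)); rewrite rp_subK.
Qed.

Lemma shiftPl s r : rpval r < rpval s \/ exists t, r = s + t.
Proof. by have [?|[t ->]] := shiftP s r; [left|right; exists t; rewrite addrC]. Qed.

Lemma zmul_inner t (u v : P t) : inner (ps_mul z u) (ps_mul z v) = inner u v.
Proof. by rewrite (pm_inner hP) z1 lact1. Qed.

Lemma zmul_norm t (u : P t) : rnorm (ps_mul z u) = rnorm u.
Proof.
apply/eqP; rewrite -(@eqrXn2 _ 2%N) ?rnorm_ge0//.
by rewrite !rnorm_inner zmul_inner.
Qed.

Lemma lshB x y t : lsh (fun s => x s - y s) t = lsh x t - lsh y t.
Proof.
have [h|[t' ->]] := shiftPl a t; first by rewrite !lsh0// subrr.
by rewrite !lshE (pmBr hP).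
Qed.

Lemma rshB s x y (q : P s) t : rsh (fun s => x s - y s) q t = rsh x q t - rsh y q t.
Proof.
have [h|[t' ->]] := shiftP s t; first by rewrite !rsh0// subrr.
by rewrite !rshE (pmBl hP).
Qed.

(** Associativity of the product; the remaining cases are the times at which one of the two
    truncations is active, where both sides vanish. *)
Lemma lsh_rsh s x (q : P s) t : lsh (rsh x q) t = rsh (lsh x) q t.
Proof.
have [h|[t' ->]] := shiftP s t.
  rewrite rsh0//; have [?|[t'' tE]] := shiftPl a t; first by rewrite lsh0.
  rewrite tE lshE rsh0 ?(pm0r hP)//; apply: le_lt_trans h.
  by rewrite tE rpD lerDr rpval_ge0.
rewrite rshE; have [h|[t'' ->]] := shiftPl a t'; last first.
  by rewrite (section_cast _ (addrA a t'' s)) !lshE rshE (ps_mulA hP).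
rewrite (lsh0 x h) (pm0l hP).
have [h'|[t'' tE]] := shiftPl a (t' + s); first by rewrite lsh0.
rewrite tE lshE rsh0 ?(pm0r hP)//.
by move: h; have := congr1 (@rpval R) tE; rewrite !rpD; lra.
Qed.

Lemma eq_lsh x y : (forall t, x t = y t) -> forall t, lsh x t = lsh y t.
Proof.
move=> xy t; have [h|[t' ->]] := shiftPl a t; first by rewrite !lsh0.
by rewrite !lshE xy.
Qed.

Lemma eq_rsh s x y (q : P s) : (forall t, x t = y t) -> forall t, rsh x q t = rsh y q t.
Proof.
move=> xy t; have [h|[t' ->]] := shiftP s t; first by rewrite !rsh0.
by rewrite !rshE xy.
Qed.

Lemma scont_rsh s x (q : P s) t : 0 < rpval t -> cont_at x t -> cont_at (rsh x q) (t + s).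
Proof.
move=> t0 hx e e0; have [y yc yq] := scont_ex hc q.
have [d d0 hd] := scont_mul hP hi hc hx (yc s) e0.
exists (Num.min d (rpval t)); first by rewrite lt_min d0.
move=> r; rewrite lt_min => /andP[h1 h2].
have [h|[r' rE]] := shiftP s r.
  by move: h2; rewrite rpD ltr_norml => /andP[]; lra.
rewrite rE !rshE -yq; apply: hd; last by rewrite subrr normr0.
by move: h1; rewrite rE !rpD (_ : _ - _ = rpval r' - rpval t)//; lra.
Qed.

(** If g vanishes up to time b, its shift vanishes up to a + b, and the truncation at time a causes
    no jump. *)
Lemma scont_lsh g : (forall t, cont_at g t) ->
  (exists2 b : R, 0 < b & forall t, rpval t < b -> g t = 0) ->
  forall t, cont_at (lsh g) t.
Proof.
move=> gc [b b0 gb] t e e0; have [t1|t1] := leP (rpval t) (rpval a).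
  have small r : rpval r < rpval a + b -> lsh g r = 0.
    move=> rb; have [h|[r' rE]] := shiftPl a r; first exact: lsh0.
    rewrite rE lshE gb ?(pm0r hP)//.
    by move: rb; rewrite rE rpD; lra.
  exists b => // r; rewrite ltr_norml => /andP[_ h].
  by rewrite !small ?(iso0 (hi _)) ?subrr ?rnorm0//; lra.
have [y yc yz] := scont_ex hc z.
have [h|[t' tE]] := shiftPl a t; first lra.
have t'0 : 0 < rpval t' by move: t1; rewrite tE rpD; lra.
have [d d0 hd] := scont_mul hP hi hc (yc a) (gc t') e0.
exists (Num.min d (rpval t')); first by rewrite lt_min d0.
move=> r; rewrite lt_min => /andP[h1 h2].
have [h|[r' rE]] := shiftPl a r.
  by move: h2; rewrite tE rpD ltr_norml => /andP[]; lra.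
rewrite tE rE !lshE -yz; apply: hd; first by rewrite subrr normr0.
by move: h1; rewrite rE tE !rpD (_ : _ - _ = rpval r' - rpval t')//; lra.
Qed.

Definition lshn n g : section := iter n lsh g.

Lemma lshn_eq0 n g t : rpval t < rpval a * n%:R -> lshn n g t = 0.
Proof.
elim: n t => [|n IH] t h; first by move: h; rewrite mulr0 ltNge rpval_ge0.
rewrite /lshn iterS -/(lshn n g); have [?|[t' tE]] := shiftPl a t.
  exact: lsh0.
rewrite tE lshE IH ?(pm0r hP)//; move: h.
by rewrite tE rpD -natr1; lra.
Qed.

Lemma lshnB n x y t : lshn n (fun s => x s - y s) t = lshn n x t - lshn n y t.
Proof.
elim: n t => // n IH t; rewrite /lshn !iterS.
by rewrite (eq_lsh IH) lshB.
Qed.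

Lemma eq_lshn n x y : (forall t, x t = y t) -> forall t, lshn n x t = lshn n y t.
Proof. by move=> xy; elim: n => // n IH t; rewrite /lshn !iterS; exact: eq_lsh. Qed.

Lemma lshn_add n x y t : lshn n (fun s => x s + y s) t = lshn n x t + lshn n y t.
Proof.
elim: n t => // n IH t; rewrite /lshn !iterS (eq_lsh IH).
have [h|[t' ->]] := shiftPl a t; first by rewrite !lsh0// addr0.
by rewrite !lshE (pmDr hP).
Qed.

Lemma lshn_sum n (I : Type) (l : seq I) (F : I -> section) t :
  lshn n (fun s => \sum_(p <- l) F p s) t = \sum_(p <- l) lshn n (F p) t.
Proof.
elim: l => [|p l IH].
  rewrite big_nil (@eq_lshn _ _ (fun s => 0 : P s)); last by move=> s; rewrite big_nil.
  elim: n t => // n IH t; rewrite /lshn iterS (eq_lsh IH).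
  have [h|[t' ->]] := shiftPl a t; first by rewrite lsh0.
  by rewrite lshE (pm0r hP).
rewrite big_cons -IH -lshn_add; apply: eq_lshn => s.
by rewrite big_cons.
Qed.

Lemma lshn_rsh n s x (q : P s) t : lshn n (rsh x q) t = rsh (lshn n x) q t.
Proof.
elim: n t => // n IH t; rewrite /lshn !iterS.
by rewrite (eq_lsh IH) lsh_rsh.
Qed.

Lemma lshn_norm n x (psi : R -> R) : (forall u, 0 <= psi u) ->
  (forall t, rnorm (x t) <= psi (rpval t)) ->
  forall t, rnorm (lshn n x t) <= psi (rpval t - rpval a * n%:R).
Proof.
move=> psi0 xpsi; elim: n => [|n IH] t; first by rewrite mulr0 subr0.
rewrite /lshn iterS -/(lshn n x); have [?|[t' ->]] := shiftPl a t.
  by rewrite lsh0// rnorm0.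
rewrite lshE zmul_norm; apply: le_trans (IH t') _.
by rewrite rpD -natr1 (_ : _ - _ = rpval a + rpval t' - rpval a * (n%:R + 1))//; lra.
Qed.

Definition stable x (al : R) := forall t, al < rpval t -> x (a + t) = ps_mul z (x t).

(** For a stable section, shifting a localised piece amounts to translating the cut-off function.
    The cut-off must vanish up to al, where x need not be stable. *)
Lemma lshn_stable n x al (phi : R -> R) : 0 <= al -> stable x al ->
  (forall u, u <= al -> phi u = 0) ->
  forall t, lshn n (fun s => (phi (rpval s))%:C *: x s) t =
    (phi (rpval t - rpval a * n%:R))%:C *: x t.
Proof.
move=> al0 xs phi0; elim: n => [|n IH] t; first by rewrite mulr0 subr0.
rewrite /lshn iterS -/(lshn n _); have [h|[t' ->]] := shiftPl a t.
  rewrite lsh0// phi0 ?scale0r// -natr1.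
  have : 0 <= rpval a * n%:R by rewrite mulr_ge0// ltW.
  lra.
rewrite lshE IH (pmZr hP).
have -> : rpval (a + t') - rpval a * n.+1%:R = rpval t' - rpval a * n%:R.
  by rewrite rpD -natr1; lra.
have [h|h] := leP (rpval t') al; last by rewrite xs.
rewrite phi0 ?scale0r//.
have : 0 <= rpval a * n%:R by rewrite mulr_ge0// ltW.
lra.
Qed.

Lemma lshn_cont n g : (forall t, cont_at g t) ->
  (exists2 b : R, 0 < b & forall t, rpval t < b -> g t = 0) ->
  (forall t, cont_at (lshn n g) t) /\
  (exists2 b : R, 0 < b & forall t, rpval t < b -> lshn n g t = 0).
Proof.
move=> gc gb; elim: n => [|n [IH1 IH2]] //; split; first exact: scont_lsh.
exists (rpval a) => // t h; exact: lsh0.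
Qed.

Definition ext_idx (t : R) : nat := (Num.truncn (t / rpval a)).+1.

(** The periodization sum of z^n g over all n, cut at an index beyond which the terms vanish at time
    t; by [extE] any larger cut gives the same value. *)
Definition ext g : section := fun t => \sum_(n < ext_idx (rpval t)) lshn n g t.

Lemma ext_idxP (t : R) : t < rpval a * (ext_idx t)%:R.
Proof. by rewrite mulrC -ltr_pdivrMr// truncnS_gt. Qed.

Lemma extE g t n : rpval t < rpval a * n%:R -> ext g t = \sum_(k < n) lshn k g t.
Proof.
move=> tn; rewrite /ext.
have main p q : (p <= q)%N -> rpval t < rpval a * p%:R ->
    \sum_(k < q) lshn k g t = \sum_(k < p) lshn k g t.
  move=> pq tp; rewrite -(subnKC pq) big_split_ord /= [X in _ + X]big1 ?addr0// => k _.
  apply: lshn_eq0; apply: (lt_le_trans tp); rewrite ler_wpM2l ?ler_nat ?leq_addr//.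
  exact: ltW.
have [h|h] := leqP n (ext_idx (rpval t)); first exact: main.
by apply/esym; apply: main; [exact: ltnW|exact: ext_idxP].
Qed.

(** At time a + t the term n = 0 vanishes, since g has ended, and the term n + 1 is z times the term
    n at time t. *)
Lemma ext_stable g (c : R) : (forall t, c <= rpval t -> g t = 0) ->
  stable (ext g) (c - rpval a).
Proof.
move=> gc t ct; have h := ext_idxP (rpval t); set M := ext_idx _ in h.
rewrite (extE _ h) (@extE _ (a + t) M.+1); last first.
  by rewrite rpD -natr1; lra.
rewrite big_ord_recl (_ : lshn ord0 g (a + t) = 0) ?add0r; last first.
  by apply: gc; rewrite rpD; lra.
rewrite (big_morph (ps_mul z) (pmDr hP z) (pm0r hP _ z)).
by apply: eq_bigr => k _; rewrite /lshn /= lshE.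
Qed.

Lemma scont_sum n (F : 'I_n -> section) t : (forall k, cont_at (F k) t) ->
  cont_at (fun s => \sum_(k < n) F k s) t.
Proof.
elim: n F => [|n IH] F Fc.
  move=> e e0; exists 1 => // s _; rewrite !big_ord0 !(iso0 (hi _)) subrr.
  by rewrite rnorm0.
apply: (@eq_scont _ _ _ _ _ (fun s => F ord0 s + \sum_(k < n) F (lift ord0 k) s)).
  by move=> s; rewrite big_ord_recl.
by apply: scontD => //; apply: IH.
Qed.

Lemma scont_ext g : (forall t, cont_at g t) ->
  (exists2 b : R, 0 < b & forall t, rpval t < b -> g t = 0) ->
  forall t, cont_at (ext g) t.
Proof.
move=> gc gb t; pose M := ext_idx (rpval t + 1).
have hM : rpval t + 1 < rpval a * M%:R by exact: ext_idxP.
have hs : cont_at (fun s => \sum_(k < M) lshn k g s) t.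
  by apply: scont_sum => k; have [h _] := lshn_cont k gc gb.
move=> e e0; have [d d0 hd] := hs e e0.
exists (Num.min d 1); first by rewrite lt_min d0 ltr01.
move=> s; rewrite lt_min => /andP[s1 s2].
rewrite (@extE _ s M) ?(@extE _ t M); first exact: hd.
  lra.
by move: s2; rewrite ltr_norml => /andP[]; lra.
Qed.

End Sections.

(** * Stable sections *)

Section StableSections.
Context {R : realType} {B : unitalCStarAlgType R} {P : ps_data B}
  (hP : is_product_system P).
Context {Ehat : hilbertModType B} {i : forall t, P t -> Ehat}
  (hi : forall t, isometric_embedding (i t)) (hc : is_continuous_ps i).
Context (a : Rplus R) (a0 : 0 < rpval a) (z : P a) (z1 : inner z z = 1).
Local Notation section := (forall t : Rplus R, P t).
Local Notation cont_at := (@scont R B P Ehat i).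
Implicit Types (r s t : Rplus R).

Definition stable_cont (x : section) (al : R) :=
  (forall t, al < rpval t -> cont_at x t) /\ stable z x al.

Record stsec := StSec {
  stval :> section;
  stP : exists2 al : R, 0 <= al & stable_cont stval al }.
Implicit Types x y : stsec.

Lemma stable_contW (f : section) al be : al <= be -> stable_cont f al -> stable_cont f be.
Proof.
by move=> ab [h1 h2]; split=> t bt; [apply: h1|apply: h2]; apply: le_lt_trans bt.
Qed.

Lemma stP2 x y : exists al : R, [/\ 0 <= al, stable_cont x al & stable_cont y al].
Proof.
have [al al0 h] := stP x; have [be be0 h'] := stP y.
exists (Num.max al be); split; first by rewrite le_max al0.
  by apply: stable_contW h; rewrite le_max lexx.
by apply: stable_contW h'; rewrite le_max lexx orbT.
Qed.

Fact st_zero_subproof : exists2 al : R, 0 <= al & stable_cont (fun t => 0 : P t) al.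
Proof.
exists 0 => //; split=> [t _ e e0|t _]; last by rewrite (pm0r hP).
by exists 1 => // s _; rewrite !(iso0 (hi _)) subrr rnorm0.
Qed.
Definition st_zero := StSec st_zero_subproof.

Fact st_add_subproof x y : exists2 al : R, 0 <= al & stable_cont (fun t => x t + y t) al.
Proof.
have [al [al0 [x1 x2] [y1 y2]]] := stP2 x y; exists al => //; split=> t alt.
  by apply: scontD => //; [exact: x1|exact: y1].
by rewrite x2// y2// (pmDr hP).
Qed.
Definition st_add x y := StSec (st_add_subproof x y).

Fact st_scale_subproof k x : exists2 al : R, 0 <= al & stable_cont (fun t => k *: x t) al.
Proof.
have [al al0 [x1 x2]] := stP x; exists al => //; split=> t alt.
  by apply: scontZc => //; exact: x1.
by rewrite x2// (pmZr hP).
Qed.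
Definition st_scale k x := StSec (st_scale_subproof k x).

Fact st_ract_subproof x b : exists2 al : R, 0 <= al & stable_cont (fun t => ract (x t) b) al.
Proof.
have [al al0 [x1 x2]] := stP x; exists al => //; split=> t alt.
  by apply: scont_ract => //; exact: x1.
by rewrite x2// (pm_ractr hP).
Qed.
Definition st_ract x b := StSec (st_ract_subproof x b).

Lemma stable_cont_rsh s (x : section) (q : P s) al : 0 <= al -> stable_cont x al ->
  stable_cont (rsh x q) (al + rpval s).
Proof.
move=> al0 [x1 x2]; split=> t alt.
  have [h|[t' tE]] := shiftP s t; first by have := rpval_ge0 s; lra.
  have t'al : al < rpval t' by move: alt; rewrite tE rpD; lra.
  by rewrite tE; apply: (scont_rsh hP hi hc) => //; [lra|exact: x1].
have [h|[t' tE]] := shiftP s t; first by exfalso; have := rpval_ge0 s; lra.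
have t'al : al < rpval t' by move: alt; rewrite tE rpD; lra.
rewrite tE rshE (section_cast _ (esym (addrA a t' s))) rshE x2//.
by rewrite -(ps_mulA hP) castK.
Qed.

Fact st_rsh_subproof s x (q : P s) : exists2 al : R, 0 <= al & stable_cont (rsh x q) al.
Proof.
have [al al0 xs] := stP x; exists (al + rpval s); first by rewrite addr_ge0 ?rpval_ge0.
exact: stable_cont_rsh.
Qed.
Definition st_rsh s x (q : P s) := StSec (st_rsh_subproof x q).

Lemma st_periodic x al : stable_cont x al ->
  forall y, stable_cont y al -> eventually_periodic a (fun t => inner (x t) (y t)) al.
Proof.
move=> [_ xs] y [_ ys] t alt; rewrite xs// ys//; exact: (zmul_inner hP z1).
Qed.

Definition st_ip x y : B := xget 0 (is_mean a (fun t => inner (x t) (y t))).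

Lemma st_ipP x y : is_mean a (fun t => inner (x t) (y t)) (st_ip x y).
Proof.
have [al [al0 hx hy]] := stP2 x y.
have [|m hm] := is_mean_ex a0 (st_periodic hx hy) (al := al).
  by move=> t alt; apply: (scont_inner hi); [exact: hx.1|exact: hy.1].
exact: xgetPex (ex_intro _ m hm).
Qed.

Lemma st_ipE x y m : is_mean a (fun t => inner (x t) (y t)) m -> st_ip x y = m.
Proof. by move=> h; apply: is_mean_uniq (st_ipP x y) h. Qed.

Lemma eq_st_ip x y x' y' (T : R) : (forall t, T <= rpval t -> x t = x' t) ->
  (forall t, T <= rpval t -> y t = y' t) -> st_ip x y = st_ip x' y'.
Proof.
move=> xx yy; apply: st_ipE; apply: (eq_is_mean (T := T)) (st_ipP x' y') => t Tt.
by rewrite xx// yy.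
Qed.

Fact st_ipD x y w : st_ip x (st_add y w) = st_ip x y + st_ip x w.
Proof.
apply: st_ipE; apply: (eq_is_mean (T := 0)) (is_meanD (st_ipP x y) (st_ipP x w)).
by move=> t _; rewrite innerDr.
Qed.

Fact st_ipZ k x y : st_ip x (st_scale k y) = k *: st_ip x y.
Proof.
apply: st_ipE; apply: (eq_is_mean (T := 0)); last first.
  apply: (@is_mean_morph _ _ _ _ (fun b => k *: b) (complex.Re `|k|) _ _ _ _ _ _ (st_ipP x y)).
  - by move=> b c; exact: scalerDr.
  - by move=> l b; rewrite !scalerA mulrC.
  - by move=> b; rewrite rnormZ.
  - exact: Re_norm_ge0.
by move=> t _ /=; rewrite innerZr.
Qed.

Fact st_ipr x y b : st_ip x (st_ract y b) = st_ip x y * b.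
Proof.
apply: st_ipE; apply: (eq_is_mean (T := 0)); last first.
  apply: (@is_mean_morph _ _ _ _ (fun c : B => c * b) (rnorm b) _ _ _ _ _ _ (st_ipP x y)).
  - by move=> c d; exact: mulrDl.
  - by move=> l c; rewrite cscalerAl.
  - by move=> c; rewrite mulrC; exact: rnormM.
  - exact: rnorm_ge0.
by move=> t _ /=; rewrite inner_ractr.
Qed.

Fact st_ip_star x y : star (st_ip x y) = st_ip y x.
Proof.
apply/esym/st_ipE; apply: (eq_is_mean (T := 0)); last first.
  apply: (@is_mean_morph _ _ _ _ (@star _ B) 1 _ _ _ _ _ _ (st_ipP x y)).
  - exact: starD.
  - exact: starZr.
  - by move=> c; rewrite rnorm_star mul1r.
  - exact: ler01.
by move=> t _ /=; rewrite star_inner.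
Qed.

Fact st_ip_pos x : spos (st_ip x x).
Proof. by apply: (is_mean_spos (T := 0)) (st_ipP x x) => t _; exact: hm_pos. Qed.

Definition st_ph : preHilbert B :=
  PreHilbert st_zero st_ipD st_ipZ st_ipr st_ip_star st_ip_pos.

Local Notation E := (completion st_ph).
Local Notation emb := (@cemb _ _ st_ph).

Lemma emb_eq x y (T : R) : (forall t, T <= rpval t -> x t = y t) -> emb x = emb y.
Proof.
move=> xy; apply: val_inj; apply/funext => w /=.
exact: (eq_st_ip (T := T)).
Qed.

Lemma emb_add x y : emb (st_add x y) = emb x + emb y.
Proof. by apply: val_inj; apply/funext => w; exact: st_ipD. Qed.

Lemma emb_scale k x : emb (st_scale k x) = k *: emb x.
Proof. by apply: val_inj; apply/funext => w; exact: st_ipZ. Qed.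

Lemma emb_ract x b : emb (st_ract x b) = ract (emb x) b.
Proof. by apply: val_inj; apply/funext => w; exact: st_ipr. Qed.

Definition st_sub x y := st_add x (st_scale (-1) y).

Lemma st_subE x y t : st_sub x y t = x t - y t.
Proof. by rewrite /= scaleN1r. Qed.

Lemma emb_sub x y : emb (st_sub x y) = emb x - emb y.
Proof. by rewrite emb_add emb_scale scaleN1r. Qed.

Lemma emb_norm2 x : rnorm (emb x) ^+ 2 = rnorm (st_ip x x).
Proof. by rewrite rnorm_inner inner_cemb. Qed.

Lemma emb_dist x y (C T : R) : 0 <= C ->
  (forall t, T <= rpval t -> rnorm (x t - y t) <= C) -> rnorm (emb x - emb y) <= C.
Proof.
move=> C0 h; rewrite -emb_sub; apply: le_of_sqr => //.
rewrite emb_norm2; apply: (is_mean_bound (T := T)) (st_ipP _ _) => t Tt.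
rewrite -rnorm_inner !expr2 st_subE; have hh := h _ Tt.
by apply: ler_pM; rewrite ?rnorm_ge0.
Qed.

(** The time shift by s does not affect the mean, and b |-> <p, b q> is linear and bounded, so it
    can be taken out of the mean of <x_t, y_t>. *)
Lemma st_rsh_ip s x y (p q : P s) :
  st_ip (st_rsh x p) (st_rsh y q) = inner p (op (lact (P s) (st_ip x y)) q).
Proof.
apply: st_ipE.
apply: (@is_mean_shift _ _ _ (fun t => inner p (op (lact (P s) (inner (x t) (y t))) q))
  _ s _ 0).
  by move=> t _ /=; rewrite !rshE (pm_inner hP).
apply: (@is_mean_morph _ _ _ _ (fun b => inner p (op (lact (P s) b) q))
  (rnorm p * rnorm q) _ _ _ _ _ _ (st_ipP x y)).
- by move=> b c; rewrite lactDl innerDr.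
- by move=> k b; rewrite lactZl innerZr.
- move=> b; apply: le_trans (CS _ _) _; rewrite -mulrA ler_wpM2l ?rnorm_ge0//.
  by rewrite mulrC; exact: rnorm_lact.
- by rewrite mulr_ge0 ?rnorm_ge0.
Qed.

Lemma emb_rsh_dist s x y (q : P s) :
  rnorm (emb (st_rsh x q) - emb (st_rsh y q)) <= rnorm q * rnorm (emb x - emb y).
Proof.
have -> : emb (st_rsh x q) - emb (st_rsh y q) = emb (st_rsh (st_sub x y) q).
  rewrite -emb_sub; apply: (emb_eq (T := 0)) => t _; rewrite st_subE.
  rewrite [RHS](eq_rsh (y := fun t => x t - y t)); first by rewrite (rshB hP).
  by move=> r; exact: st_subE.
rewrite -emb_sub; apply: le_of_sqr; first by rewrite mulr_ge0 ?rnorm_ge0.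
rewrite exprMn !emb_norm2 st_rsh_ip; apply: le_trans (CS _ _) _.
rewrite expr2 -mulrA ler_wpM2l ?rnorm_ge0//.
by rewrite mulrC; exact: rnorm_lact.
Qed.

Lemma dil_ex : exists v : forall s, E -> P s -> E,
  (forall s x q, v s (emb x) q = emb (@st_rsh s x q)) /\
  (forall s u w q, rnorm (v s u q - v s w q) <= rnorm q * rnorm (u - w)).
Proof.
have ex1 (p : {s : Rplus R & P s}) : exists h : E -> E,
    (forall x, h (emb x) = emb (@st_rsh (projT1 p) x (projT2 p))) /\
    (forall u w, rnorm (h u - h w) <= rnorm (projT2 p) * rnorm (u - w)).
  apply: (lip_ext (rnorm_ge0 _)); first exact: cemb_dense.
  by move=> x y; exact: emb_rsh_dist.
have [h hP'] := choice ex1.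
exists (fun s u q => h (existT _ s q) u); split.
  by move=> s x q; have [-> _] := hP' (existT _ s q).
by move=> s u w q; have [_ H] := hP' (existT _ s q); exact: H.
Qed.

End StableSections.

(** * Density of elementary products *)

Section Tent.
Context {R : realType}.
Implicit Types u v : R.

Definition clamp v : R := Num.max 0 (Num.min 1 v).

(** The hat function of height 1 supported on [-1, 1], written as a difference so that sums of
    integer translates telescope. *)
Definition tent v : R := clamp (v + 1) - clamp v.

Lemma clampP v : [\/ v <= 0 /\ clamp v = 0, 0 <= v <= 1 /\ clamp v = v |
  1 <= v /\ clamp v = 1].
Proof.
rewrite /clamp /Num.max /Num.min; case: (ltP v 0) => h0.
  constructor 1; split; first exact: ltW.
  by case: (ltP 1 v) => h1; case: ltP => //; lra.
case: (ltP v 1) => h1; [constructor 2|constructor 3]; split; rewrite ?h0 ?ltW//.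
  by case: (ltP 1 v) => h2; case: ltP => //; lra.
by case: (ltP 1 v) => h2; case: ltP => //; lra.
Qed.

Lemma tent_ge0 v : 0 <= tent v.
Proof.
by rewrite /tent; case: (clampP v) => -[h ->]; case: (clampP (v + 1)) => -[h' ->]; lra.
Qed.

Lemma tent_le1 v : tent v <= 1.
Proof.
by rewrite /tent; case: (clampP v) => -[h ->]; case: (clampP (v + 1)) => -[h' ->]; lra.
Qed.

Lemma tent_eq0 v : 1 <= `|v| -> tent v = 0.
Proof.
rewrite ler_normr /tent => /orP[] h1; case: (clampP v) => -[h ->];
  case: (clampP (v + 1)) => -[h' ->]; lra.
Qed.

Lemma tent_lip u v : `|tent u - tent v| <= 2 * `|u - v|.
Proof.
have c x y : `|clamp x - clamp y| <= `|x - y|.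
  rewrite ler_norml; have := ler_norm (x - y); have := ler_norm (- (x - y)).
  rewrite normrN.
  by case: (clampP x) => -[h ->]; case: (clampP y) => -[h' ->]; move=> *; apply/andP; split; lra.
rewrite (_ : tent u - tent v = (clamp (u + 1) - clamp (v + 1)) + (clamp v - clamp u)).
  apply: le_trans (ler_normD _ _) _; have := c (u + 1) (v + 1); have := c v u.
  by rewrite (_ : u + 1 - (v + 1) = u - v) ?(distrC v); lra.
by rewrite /tent; lra.
Qed.

Lemma tent_sum v n : \sum_(j < n) tent (v - j%:R) = clamp (v + 1) - clamp (v - n%:R + 1).
Proof.
elim: n => [|n IH]; first by rewrite big_ord0 subr0 subrr.
rewrite big_ord_recr /= IH /tent -natr1.
by rewrite (_ : v - (n%:R + 1) + 1 = v - n%:R); lra.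
Qed.

(** The nodes are numbered k n + j, with j running through one period and k counting periods, as
    they arise from periodization. The upper bound on v keeps it off the decreasing flank of the
    last tent. *)
Lemma tent_sum2 v (m n : nat) : 0 <= v -> v <= m%:R * n%:R - 1 ->
  \sum_(k < m) \sum_(j < n) tent (v - k%:R * n%:R - j%:R) = 1.
Proof.
move=> v0 vn; under eq_bigr do rewrite tent_sum.
have -> : \sum_(k < m) (clamp (v - k%:R * n%:R + 1) - clamp (v - k%:R * n%:R - n%:R + 1)) =
    clamp (v + 1) - clamp (v - m%:R * n%:R + 1).
  elim: m {vn} => [|m IH]; first by rewrite big_ord0 mul0r subr0 subrr.
  rewrite big_ord_recr /= IH -natr1 mulrDl mul1r.
  by rewrite (_ : v - (m%:R * n%:R + n%:R) + 1 = v - m%:R * n%:R - n%:R + 1); lra.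
by case: (clampP (v + 1)) => -[h ->]; case: (clampP (v - m%:R * n%:R + 1)) => -[h' ->]; lra.
Qed.

End Tent.

Section Density.
Context {R : realType} {B : unitalCStarAlgType R} {P : ps_data B}
  (hP : is_product_system P).
Context {Ehat : hilbertModType B} {i : forall t, P t -> Ehat}
  (hi : forall t, isometric_embedding (i t)) (hc : is_continuous_ps i).
Context (a : Rplus R) (a0 : 0 < rpval a) (z : P a) (z1 : inner z z = 1).
Local Notation section := (forall t : Rplus R, P t).
Local Notation cont_at := (@scont R B P Ehat i).
Local Notation stsec := (@stsec R B P Ehat i a z).
Local Notation E := (completion (st_ph hP hi a0 z1)).
Local Notation emb := (@cemb _ _ (st_ph hP hi a0 z1)).
Local Notation st_rsh := (st_rsh hP hi hc).
Implicit Types (r s t : Rplus R).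

Definition csec := {x : section | forall t, cont_at x t}.

Definition rsh_sum s (L : seq (csec * P s)) : section :=
  fun t => \sum_(p <- L) rsh (sval p.1) p.2 t.

Lemma scont_rsh_sum s (L : seq (csec * P s)) t : rpval s < rpval t ->
  cont_at (rsh_sum L) t.
Proof.
move=> st; elim: L => [|p L IH].
  apply: (@eq_scont _ _ _ _ _ (fun t => 0 : P t)); first by move=> r; rewrite /rsh_sum big_nil.
  by move=> e e0; exists 1 => // r _; rewrite !(iso0 (hi _)) subrr rnorm0.
apply: (@eq_scont _ _ _ _ _ (fun t => rsh (sval p.1) p.2 t + rsh_sum L t)).
  by move=> r; rewrite /rsh_sum big_cons.
apply: scontD => //; have [h|[t' tE]] := shiftP s t; first lra.
rewrite tE; apply: (scont_rsh hP hi hc); last exact: (svalP p.1).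
by move: st; rewrite tE rpD; lra.
Qed.

(** At a single time t0, x is close to a finite sum of products of elements of P_(t0 - s) and P_s.
    Continuous sections through the left factors keep this approximation valid near t0, and
    compactness yields a uniform mesh over one period. *)
Lemma local_approx (x : section) (T : R) s (e : R) : 0 < e -> rpval s < T ->
  (forall t, T <= rpval t -> cont_at x t) ->
  exists N : nat, forall j : 'I_N.+1, exists L : seq (csec * P s),
    forall t, `|rpval t - (T + j%:R * (rpval a / N.+1%:R))| <= rpval a / N.+1%:R ->
    rnorm (x t - rsh_sum L t) <= e.
Proof.
move=> e0 sT xc.
have T0 : 0 < T by have := rpval_ge0 s; lra.
pose Q (d t0 : R) := exists L : seq (csec * P s),
  forall t, `|rpval t - t0| <= d -> rnorm (x t - rsh_sum L t) <= e.
have [d d0 hd] : exists2 d : R, 0 < d & forall t : R, T <= t <= T + rpval a -> Q d t.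
  apply: segment_unif => [d d' t _ dd' [L hL]|t0 /andP[Tt0 _]].
    by exists L => r h; apply: hL; exact: le_trans dd'.
  pose r0 := rp t0; have r0E : rpval r0 = t0 by rewrite rpE//; lra.
  have [h|[t' tE]] := shiftP s r0; first lra.
  have e2 : 0 < e / 2 by lra.
  have [l hl] := pm_dense hP (ps_cast tE (x r0)) e2.
  have /choice[Y hY] (y : P t') : exists Y : csec, sval Y t' = y.
    by have [Y Yc Yy] := scont_ex hc y; exists (exist _ Y Yc).
  pose L := [seq (Y p.1, p.2) | p <- l].
  have Lt : rnorm (x r0 - rsh_sum L r0) < e / 2.
    rewrite -(cast_norm tE) castB.
    rewrite -(section_cast (rsh_sum L) tE) /rsh_sum /L big_map.
    by under eq_bigr do rewrite rshE hY.
  have hcont : cont_at (fun t => x t - rsh_sum L t) r0.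
    apply: scontB => //; first by apply: xc; rewrite r0E.
    by apply: scont_rsh_sum; rewrite r0E; lra.
  have [d d0 hd] := scont_norm hi hcont e2.
  exists (d / 2); first lra.
  move=> t tt0 _; exists L => r rt; apply: ltW; apply: lt_le_trans (hd r _) _; last lra.
  by rewrite r0E; have := ler_distD t (rpval r) t0; lra.
have [N /(_ N (leqnn _)) hN] := inv_small (divr_gt0 d0 a0).
have hNd : rpval a / N.+1%:R <= d.
  by rewrite mulrC -ler_pdivlMr//; exact: ltW.
exists N => j; have [|L hL] := hd (T + j%:R * (rpval a / N.+1%:R)).
  have q0 : 0 <= rpval a / N.+1%:R by rewrite divr_ge0 ?rpval_ge0.
  apply/andP; split; first by rewrite lerDl mulr_ge0.
  rewrite lerD2l mulrCA -[leRHS]mulr1 ler_wpM2l ?rpval_ge0// ler_pdivrMr// mul1r.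
  by rewrite ler_nat ltnW.
by exists L => t h; apply: hL; exact: le_trans hNd.
Qed.

Lemma st_ext_ex (g : section) (c : R) : (forall t, cont_at g t) ->
  (exists2 b : R, 0 < b & forall t, rpval t < b -> g t = 0) ->
  (forall t, c <= rpval t -> g t = 0) ->
  exists G : stsec, forall t, G t = ext z g t.
Proof.
move=> gc gb gc0.
have hG : exists2 al : R, 0 <= al &
      @stable_cont R B P Ehat i a z (ext z g) al.
  exists (`|c - rpval a|) => //; split=> t h; first exact: (scont_ext hP hi hc).
  have := ext_stable hP a0 z gc0; apply; apply: le_lt_trans h; exact: ler_norm.
by exists (StSec hG).
Qed.

Lemma st_sum_ex (l : seq stsec) : exists x : stsec,
  (forall t, x t = \sum_(y <- l) y t) /\ emb x = \sum_(y <- l) emb y.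
Proof.
elim: l => [|y l [x [x1 x2]]].
  pose o := st_zero hP hi z; exists o; split=> [t|]; first by rewrite big_nil.
  rewrite big_nil -(subrr (emb o)) -emb_sub; apply: (emb_eq hP hi a0 z1 (T := 0)) => t _.
  by rewrite st_subE subrr.
exists (st_add hP hi y x); split=> [t|]; first by rewrite big_cons /= x1.
by rewrite big_cons emb_add x2.
Qed.

(** Periodizing tents times x reproduces x at large times. Replacing x under each tent by its local
    approximant gives a periodization that factors as stable sections times elements of [P s]. *)
Lemma st_dense (x : stsec) s (e : R) : 0 < e -> exists l : seq (stsec * P s),
  rnorm (emb x - \sum_(p <- l) emb (st_rsh p.1 p.2)) <= e.
Proof.
move=> e0; have [al al0 [xc xs]] := stP x.
(* Since d <= a, all tents live beyond T - d >= al + s + 1. There x is stable, and after removing s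
   the cut-off sections still vanish on an initial interval of length 1. The summand a also supplies
   the room of one mesh width required by [tent_sum2]. *)
have [T TE] : exists T : R, T = al + rpval s + rpval a + 1 by exists (al + rpval s + rpval a + 1).
have s0 := rpval_ge0 s; have a0' : 0 < rpval a by exact: a0.
have [||N] := @local_approx x T s e e0.
- lra.
- by move=> t h; apply: xc; lra.
move=> /choice[L hL]; set d := rpval a / N.+1%:R in hL.
have d0 : 0 < d by rewrite divr_gt0.
have da : d <= rpval a by rewrite ler_pdivrMr// ler_peMr ?rpval_ge0// ler1n.
pose phi (j : nat) (u : R) := tent ((u - T) / d - j%:R).
have phi_far j u : d <= `|u - (T + j%:R * d)| -> phi j u = 0.
  move=> h; apply: tent_eq0; rewrite -(@ler_pM2r _ d)// mul1r -[X in _ * X](gtr0_norm d0).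
  rewrite -normrM; apply: le_trans h _; rewrite mulrBl divfK ?gt_eqF//.
  by rewrite opprD addrA.
have phi_low j u : u <= T - d -> phi j u = 0.
  move=> h; apply: phi_far; have : 0 <= j%:R * d by rewrite mulr_ge0// ltW.
  by have := ler_norm (- (u - (T + j%:R * d))); rewrite normrN; lra.
(* The tent is evaluated at t + s because the section is going to be multiplied from the right by an
   element of [P s], which delays it by s. *)
pose g (jp : 'I_N.+1 * (csec * P s)) : section :=
  fun t => (phi jp.1 (rpval t + rpval s))%:C *: sval jp.2.1 t.
have /choice[G hG] : forall jp, exists G : stsec, forall t, G t = ext z (g jp) t.
  move=> jp; apply: (@st_ext_ex _ (T + N.+2%:R * d)).
  - move=> t; apply: (@scontZ _ _ _ _ _ hi (fun u => phi jp.1 (u + rpval s)));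
      last exact: (svalP jp.2.1).
    move=> c c0; exists (d * c / 2); first by rewrite divr_gt0// mulr_gt0.
    move=> u us; apply: le_lt_trans (tent_lip _ _) _.
    rewrite (_ : _ - _ = (u - rpval t) / d).
      rewrite normrM (gtr0_norm (_ : 0 < d^-1)) ?invr_gt0//.
      by rewrite mulrA ltr_pdivrMr// mulrC -ltr_pdivlMr//; move: us; lra.
    by rewrite opprB addrA subrK -mulrBl; congr (_ / d); lra.
  - exists 1 => // t t1; rewrite /g phi_low ?scale0r//.
    lra.
  - move=> t ht; rewrite /g phi_far ?scale0r//.
    have hj : (jp.1 : nat)%:R * d <= N%:R * d.
      by rewrite ler_wpM2r ?(ltW d0)// ler_nat -ltnS.
    apply: le_trans (ler_norm _); move: ht; rewrite -natr1 -natr1.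
    lra.
pose l := [seq (G (j, p), p.2) | j <- enum 'I_N.+1, p <- L j].
have [y [yE ye]] := st_sum_ex [seq st_rsh p.1 p.2 | p <- l].
exists l; have -> : \sum_(p <- l) emb (st_rsh p.1 p.2) = emb y by rewrite ye big_map.
apply: (@emb_dist _ _ _ hP _ _ hi _ a0 _ z1 _ _ _ T) => [|t Tt]; first exact: ltW.
pose M := ext_idx a (rpval t); have tM : rpval t < rpval a * M%:R by exact: ext_idxP.
have ML : (rpval t - T) / d <= M%:R * N.+1%:R - 1.
  rewrite ler_pdivrMr// mulrBl mul1r -mulrA (_ : N.+1%:R * d = rpval a).
    by rewrite mulrC; lra.
  by rewrite /d mulrC divfK// pnatr_eq0.
have tT0 : 0 <= (rpval t - T) / d by rewrite divr_ge0 ?subr_ge0// ltW.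
have phiE (n j : nat) : phi j (rpval t - rpval a * n%:R) =
    tent ((rpval t - T) / d - n%:R * N.+1%:R - j%:R).
  congr (tent (_ - _)); rewrite addrAC mulrBl; congr (_ - _).
  rewrite /d invf_div mulrA -[_ * n%:R * _]mulrA mulrAC mulfV ?mul1r//.
  by rewrite gt_eqF.
have phi1 : \sum_(n < M) \sum_(j < N.+1) phi j (rpval t - rpval a * n%:R) = 1.
  under eq_bigr do under eq_bigr do rewrite phiE.
  exact: tent_sum2.
pose px (j : nat) : section := fun r => (phi j (rpval r))%:C *: x r.
pose pL (j : 'I_N.+1) : section := fun r => (phi j (rpval r))%:C *: rsh_sum (L j) r.
(* By stability, z^n applied to a tent times x is the tent translated by n a, times x; the tents add
   up to 1. *)
have key1 : x t = \sum_(n < M) \sum_(j < N.+1) lshn z n (px j) t.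
  rewrite -[LHS]scale1r -[1](rmorph1 (real_complex R)) -phi1 rmorph_sum scaler_suml.
  apply: eq_bigr => n _; rewrite rmorph_sum scaler_suml; apply: eq_bigr => j _.
  rewrite (lshn_stable hP a0 n al0 xs)// => u ual; apply: phi_low; lra.
(* Right multiplication by [p.2] commutes with all shifts z^n, so y is the same double sum with x
   replaced by its local approximants. *)
have key2 : y t = \sum_(n < M) \sum_(j < N.+1) lshn z n (pL j) t.
  rewrite yE big_map /l big_allpairs_dep big_enum /= [RHS]exchange_big.
  apply: eq_bigr => j _.
  transitivity (\sum_(n < M) \sum_(p <- L j)
      lshn z n (fun r => (phi j (rpval r))%:C *: rsh (sval p.1) p.2 r) t); last first.
    apply: eq_bigr => n _; rewrite -(lshn_sum hP); apply: eq_lshn => r.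
    by rewrite /pL /rsh_sum scaler_sumr.
  rewrite exchange_big; apply: eq_bigr => p _.
  have [t'' tE] : exists t'', t = t'' + s.
    by have [h|//] := shiftP s t; exfalso; lra.
  rewrite tE rshE hG (@extE _ _ _ hP _ a0 z _ _ M); last first.
    by move: tM; rewrite tE rpD; lra.
  rewrite (big_morph (fun u => ps_mul u p.2) (fun u v => pmDl hP u v p.2) (pm0l hP _ p.2)).
  apply: eq_bigr => n _; rewrite -(rshE (lshn z n _)) -(lshn_rsh hP); apply: eq_lshn => r.
  have [h|[r' ->]] := shiftP s r; first by rewrite !rsh0// scaler0.
  by rewrite !rshE (pmZl hP) rpD.
rewrite key1 key2 -sumrB; apply: le_trans (rnorm_sum _ _ _) _.
(* The error under each tent is at most e times the tent, z being isometric, and the weights sum to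
   1. *)
have -> : e = \sum_(n < M) \sum_(j < N.+1) e * phi j (rpval t - rpval a * n%:R).
  by under eq_bigr do rewrite -mulr_sumr; rewrite -mulr_sumr phi1 mulr1.
apply: ler_sum => n _; rewrite -sumrB; apply: le_trans (rnorm_sum _ _ _) _.
apply: ler_sum => j _; rewrite -(lshnB hP).
have /= hn := @lshn_norm _ _ _ hP _ _ z1 n (fun r => px j r - pL j r) (fun u => e * phi j u).
apply: hn => [u|r].
  by rewrite mulr_ge0 ?tent_ge0// ltW.
rewrite /px /pL -scalerBr rnormZr (ger0_norm (tent_ge0 _)) -/(phi j (rpval r)).
have [h|h] := leP `|rpval r - (T + j%:R * d)| d.
  by rewrite mulrC ler_wpM2r ?tent_ge0// hL.
by rewrite (phi_far j _ (ltW h)) mul0r mulr0.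
Qed.

End Density.

(** * Continuity of the shifts in time, and a unit vector *)

Section Dilation.
Context {R : realType} {B : unitalCStarAlgType R} {P : ps_data B}
  (hP : is_product_system P).
Context {Ehat : hilbertModType B} {i : forall t, P t -> Ehat}
  (hi : forall t, isometric_embedding (i t)) (hc : is_continuous_ps i).
Local Notation section := (forall t : Rplus R, P t).
Local Notation cont_at := (@scont R B P Ehat i).
Implicit Types (r s t : Rplus R).

Lemma i_rsh s (x : section) (q : P s) t r : r = t + s ->
  i (rsh x q r) = i (ps_mul (x t) q).
Proof. by move=> ->; rewrite rshE. Qed.

Section Fixed.
Context (a : Rplus R) (a0 : 0 < rpval a) (z : P a) (z1 : inner z z = 1).
Local Notation stsec := (@stsec R B P Ehat i a z).
Local Notation E := (completion (st_ph hP hi a0 z1)).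
Local Notation emb := (@cemb _ _ (st_ph hP hi a0 z1)).
Local Notation st_rsh := (st_rsh hP hi hc).

(** The factors Y t lie in different fibres, so the shifted sections are compared at each time r
    through the joint continuity of products, uniformly over one period by compactness. *)
Lemma st_cont (X : stsec) (Y : section) t0 (e : R) : (forall t, cont_at Y t) ->
  0 < e -> exists2 d : R, 0 < d & forall t, `|rpval t - rpval t0| < d ->
    rnorm (emb (st_rsh X (Y t)) - emb (st_rsh X (Y t0))) <= e.
Proof.
move=> Yc e0; have [al al0 Xs] := stP X.
have a0' : 0 < rpval a by exact: a0.
(* The section shifted by Y t is stable only beyond al + t. The threshold has to serve all t within
   distance 1 of t0. *)
have [T TE] : exists T : R, T = al + rpval t0 + 2 by exists (al + rpval t0 + 2).
have t00 := rpval_ge0 t0.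
pose D t : section := fun r => rsh X (Y t) r - rsh X (Y t0) r.
pose Q (d u : R) := forall t r, `|rpval t - rpval t0| < d -> rpval r = u ->
  rnorm (D t r) <= e.
have [d d0 hd] : exists2 d : R, 0 < d & forall u : R, T <= u <= T + rpval a -> Q d u.
  apply: segment_unif => [d d' u _ dd' hQ t r td|u0 /andP[Tu0 _]].
    by apply: hQ; exact: lt_le_trans dd'.
  have e2 : 0 < e / 2 by lra.
  pose w0 := rp (u0 - rpval t0).
  have w0E : rpval w0 = u0 - rpval t0 by rewrite rpE//; lra.
  have Xw : cont_at X w0 by apply: Xs.1; lra.
  have [d d0 hd] := scont_mul hP hi hc Xw (Yc t0) e2.
  exists (Num.min (d / 2) (1 / 2)); first by rewrite lt_min !divr_gt0.
  move=> u; rewrite lt_min => /andP[ud u1] _ t r; rewrite lt_min => /andP[td t1] rE.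
  have [h|[r1 r1E]] := shiftP t r.
    by exfalso; move: u1 t1; rewrite !ltr_norml => /andP[? ?] /andP[? ?]; lra.
  have [h|[r2 r2E]] := shiftP t0 r.
    by exfalso; move: u1; rewrite !ltr_norml => /andP[? ?]; lra.
  have r1E' : rpval r1 = u - rpval t by rewrite -rE r1E rpD; lra.
  have r2E' : rpval r2 = u - rpval t0 by rewrite -rE r2E rpD; lra.
  rewrite -(iso_norm (hi r)) /D (isoB (hi r)) (i_rsh _ _ r1E) (i_rsh _ _ r2E).
  have k1 : `|rpval r1 - rpval w0| < d.
    rewrite r1E' w0E (_ : u - _ - (u0 - _) = (u - u0) - (rpval t - rpval t0)); last lra.
    by apply: le_lt_trans (ler_normB _ _) _; lra.
  have k2 : `|rpval r2 - rpval w0| < d.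
    by rewrite r2E' w0E (_ : u - _ - (u0 - _) = u - u0); lra.
  have k3 : `|rpval t - rpval t0| < d by lra.
  have k4 : `|rpval t0 - rpval t0| < d by rewrite subrr normr0.
  have := hd _ _ k1 k3; have := hd _ _ k2 k4.
  set p0 := i (ps_mul (X w0) (Y t0)); set p1 := i _; set p2 := i _.
  have := rnorm_tri p0 p2 p1; have := rnormB p1 p0; lra.
exists (Num.min d 1); first by rewrite lt_min d0 ltr01.
move=> t; rewrite lt_min => /andP[td t1].
have tt0 : rpval t < rpval t0 + 1 by move: t1; rewrite ltr_norml => /andP[_]; lra.
apply: (@emb_dist _ _ _ hP _ _ hi _ a0 _ z1 _ _ _ T) => [|r Tr]; first exact: ltW.
(* The norm of the difference is periodic although the difference is not, because left
   multiplication by z is isometric. The bound over one period thus extends to all later times. *)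
have per : eventually_periodic a (fun r => rnorm (D t r)) (al + rpval t0 + 1).
  move=> r' hr'; rewrite /D.
  have [_ h1] := stable_cont_rsh hP hi hc (Y t) al0 Xs.
  have [_ h2] := stable_cont_rsh hP hi hc (Y t0) al0 Xs.
  rewrite h1; last lra.
  by rewrite h2 -?(pmBr hP) ?(zmul_norm hP z1)//; lra.
have [n /andP[n1 n2]] := window a0 Tr.
set u := rpval r - _ in n1 n2.
have u0 : 0 <= u by lra.
have rE : r = a *+ n + rp u by apply: rp_decomp.
have alu : al + rpval t0 + 1 < rpval (rp u) by rewrite rpE//; lra.
have := periodicMn a0 n per alu; rewrite -rE => -> .
by apply: (hd u) => //; [apply/andP; split; lra|rewrite rpE].
Qed.

(** The tent is centred at 2 a with half-width a. On one period only two neighbouring translates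
    contribute, and the periodization is z applied to a convex combination of w_(a+t) and z w_t,
    which differ by at most 1/8. So its inner square is within 8/64 + 9/64 + 10/64 < 1/2 of 1, and
    so is the mean up to 1/2, which suffices for normalisation. *)
Lemma unit_ex (w : section) : (forall t, cont_at w t) ->
  (forall t, rpval t <= 4 * rpval a -> rnorm (inner (w t) (w t) - 1) <= 1 / 8) ->
  (forall t, rpval t <= 4 * rpval a -> rnorm (ps_mul z (w t) - w (a + t)) <= 1 / 8) ->
  exists xi : E, inner xi xi = 1.
Proof.
move=> wc w1 w2; have a0' : 0 < rpval a by exact: a0.
pose phi (u : R) := tent (u / rpval a - 2).
have phi_far u : u <= rpval a \/ 3 * rpval a <= u -> phi u = 0.
  have uE : u = u / rpval a * rpval a by rewrite divfK// gt_eqF.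
  rewrite {1 2}uE => h; apply: tent_eq0; rewrite ler_normr.
  move: (u / rpval a) h => v [h|h].
    by apply/orP; right; rewrite -(ler_pM2r a0); lra.
  by apply/orP; left; rewrite -(ler_pM2r a0); lra.
have phi_sum u : rpval a <= u -> u <= 2 * rpval a -> phi (rpval a + u) + phi u = 1.
  move=> h1 h2; rewrite /phi mulrDl divff ?gt_eqF//.
  have h3 : 1 <= u / rpval a by rewrite ler_pdivlMr// mul1r.
  have h4 : u / rpval a <= 2 by rewrite ler_pdivrMr.
  move: (u / rpval a) h3 h4 => v h3 h4; rewrite /tent.
  have -> : 1 + v - 2 = v - 2 + 1 by lra.
  rewrite subrKA.
  by case: (clampP (v - 2 + 1 + 1)) => -[k ->]; case: (clampP (v - 2)) => -[k' ->]; lra.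
pose g : section := fun t => (phi (rpval t))%:C *: w t.
have gl t : rpval t <= rpval a -> g t = 0.
  by move=> h; rewrite /g phi_far ?scale0r//; left.
have gh t : 3 * rpval a <= rpval t -> g t = 0.
  by move=> h; rewrite /g phi_far ?scale0r//; right.
have [||G hG] := @st_ext_ex _ _ _ hP _ _ hi hc a a0 z g (3 * rpval a) _ _ gh.
- move=> t; apply: (@scontZ _ _ _ _ _ hi phi); last exact: wc.
  move=> c c0; exists (rpval a * c / 2); first by rewrite divr_gt0// mulr_gt0.
  move=> u us; apply: le_lt_trans (tent_lip _ _) _.
  rewrite (_ : _ - _ = (u - rpval t) / rpval a).
    rewrite normrM (gtr0_norm (_ : 0 < (rpval a)^-1)) ?invr_gt0//.
    by rewrite mulrA ltr_pdivrMr// mulrC -ltr_pdivlMr//; move: us; lra.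
  by rewrite opprB addrA subrK -mulrBl.
- by exists (rpval a) => // t h; apply: gl; exact: ltW.
have main t : 3 * rpval a <= rpval t < 4 * rpval a ->
    rnorm (inner (G t) (G t) - 1) <= 1 / 2.
  move=> /andP[t3 t4].
  have [h|[t1 t1E]] := shiftPl a t; first by exfalso; lra.
  subst t; rewrite rpD in t3 t4.
  have [h|[t2 t2E]] := shiftPl a t1; first by exfalso; lra.
  subst t1; rewrite rpD in t3 t4.
  have [h|[t3' t3E]] := shiftPl a t2; first by exfalso; lra.
  have t3E' : rpval t2 = rpval a + rpval t3' by rewrite t3E rpD.
  have GE : G (a + (a + t2)) = ps_mul z (g (a + t2) + ps_mul z (g t2)).
    (* On [3 a, 4 a[ only the shifts n = 1 and n = 2 survive: at n = 0 the support of g has ended,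
       at n = 3 it has not begun. *)
    rewrite hG (@extE _ _ _ hP _ a0 z g _ 4%N); last by rewrite !rpD; lra.
    rewrite !big_ord_recl big_ord0 addr0 /lshn /= gh ?rpD// ?rpD// add0r !lshE.
    rewrite (_ : lsh z g t2 = 0) ?(pm0r hP) ?addr0 ?(pmDr hP)//.
    rewrite t3E lshE gl ?(pm0r hP)//; lra.
  rewrite GE (zmul_inner hP z1).
  have gE : g (a + t2) + ps_mul z (g t2) = w (a + t2) + (phi (rpval t2))%:C *:
      (ps_mul z (w t2) - w (a + t2)).
    rewrite /g (pmZr hP) scalerBr rpD.
    have -> : phi (rpval a + rpval t2) = 1 - phi (rpval t2).
      by rewrite -(phi_sum (rpval t2)) ?addrK; lra.
    by rewrite rmorphB scalerBl scale1r addrAC addrA.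
  rewrite gE.
  set W := w (a + t2); set V := (phi _)%:C *: _.
  have hW : rnorm (inner W W - 1) <= 1 / 8 by apply: w1; rewrite rpD; lra.
  have hV : rnorm V <= 1 / 8.
    rewrite rnormZr (ger0_norm (tent_ge0 _)).
    have t2a : rpval t2 <= 4 * rpval a by lra.
    have := w2 t2 t2a; have := tent_le1 (rpval t2 / rpval a - 2); have := tent_ge0 (rpval t2 / rpval a - 2).
    rewrite -/(phi _); have := rnorm_ge0 (ps_mul z (w t2) - w (a + t2)).
    rewrite -/W; nra.
  have W2 : rnorm W <= 9 / 8.
    apply: le_of_sqr; first lra.
    have := rnorm_sub (inner W W) 1; rewrite -rnorm_inner; have := @rnorm1_le1 _ B; lra.
  have -> : inner (W + V) (W + V) - 1 = (inner W W - 1) + (inner W V + inner V (W + V)).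
    by rewrite innerDl [inner W (W + V)]innerDr -[inner W W + _ + _]addrA addrAC.
  have := rnormD (inner W W - 1) (inner W V + inner V (W + V)).
  have := rnormD (inner W V) (inner V (W + V)).
  have := CS W V; have := CS V (W + V); have := rnormD W V.
  have := rnorm_ge0 W; have := rnorm_ge0 V; have := rnorm_ge0 (W + V).
  nra.
have Gs : stable z G (3 * rpval a - rpval a).
  by move=> t h; rewrite !hG; exact: (ext_stable hP a0 z gh).
have per : eventually_periodic a (fun r => inner (G r) (G r)) (3 * rpval a - rpval a).
  by move=> t h; rewrite Gs// (zmul_inner hP z1).
have allt r : 3 * rpval a <= rpval r -> rnorm (inner (G r) (G r) - 1) <= 1 / 2.
  move=> hr; have [n /andP[n1 n2]] := window a0 hr.
  set u := rpval r - _ in n1 n2; have u0 : 0 <= u by lra.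
  have rE : r = a *+ n + rp u by apply: rp_decomp.
  have alu : 3 * rpval a - rpval a < rpval (rp u) by rewrite rpE//; lra.
  have := periodicMn a0 n per alu; rewrite -rE => ->; apply: main.
  by rewrite rpE//; apply/andP; split; lra.
have m1 : rnorm (1 - st_ip G G) <= 1 / 2.
  rewrite rnormB; apply: (is_mean_bound (T := 3 * rpval a)) allt _.
  exact: is_meanD (st_ipP hP hi a0 z1 G G) (is_mean_cst _ _).
have [|b [bE _]] := inv_sqrt (st_ip_pos hP hi a0 z1 G); first lra.
by exists (ract (emb G) b); rewrite inner_ractl inner_ractr inner_cemb mulrA.
Qed.

End Fixed.
End Dilation.

(** * Existence of a left dilation *)

Section LeftDilation.
Context {R : realType} {B : unitalCStarAlgType R} {P : ps_data B}.

(* [v t : E x P t -> E] induces a unitary from the internal tensor product of E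
   and [P t] onto E, compatibly with the product of the system. *)
Record left_dilation {Ehat E : hilbertModType B} (i : forall t, P t -> Ehat)
    (v : forall t : Rplus R, E -> P t -> E) : Prop := LeftDilation {
  ld_inner : forall t x x' (y y' : P t),
    inner (v t x y) (v t x' y') = inner y (op (lact (P t) (inner x x')) y');
  ld_dense : forall t u (e : R), 0 < e -> exists l : seq (E * P t),
    rnorm (u - \sum_(p <- l) v t p.1 p.2) < e;
  ld_mul : forall s t x (y : P s) (w : P t), v (s + t) x (ps_mul y w) = v t (v s x y) w;
  ld_id : forall x b, v 0 x (ps_id P b) = ract x b;
  ld_cont : forall x (Y : forall t, P t) t0 (e : R),
    (forall t, @scont R B P Ehat i Y t) -> 0 < e -> exists2 d : R, 0 < d &
    forall t, `|rpval t - rpval t0| < d -> rnorm (v t x (Y t) - v t0 x (Y t0)) < e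
}.

Context (hP : is_product_system P).
Context {Ehat : hilbertModType B} {i : forall t, P t -> Ehat}
  (hi : forall t, isometric_embedding (i t)) (hc : is_continuous_ps i).
Local Notation section := (forall t : Rplus R, P t).
Local Notation cont_at := (@scont R B P Ehat i).
Implicit Types (r s t : Rplus R).

Lemma ractN (E : hilbertModType B) (x : E) (b : B) : ract x (- b) = - ract x b.
Proof. by rewrite -scaleN1r ractZr scaleN1r. Qed.

(** A continuous section w through the unit at time 0 satisfies <w_t, w_t> = 1 and w_s w_t = w_(s+t)
    approximately for small times, and z is w_a normalised. *)
Lemma unit_setup : exists a : Rplus R, 0 < rpval a /\ exists z : P a, inner z z = 1 /\
  exists w : section, [/\ forall t, cont_at w t,
    forall t, rpval t <= 4 * rpval a -> rnorm (inner (w t) (w t) - 1) <= 1 / 8 &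
    forall t, rpval t <= 4 * rpval a -> rnorm (ps_mul z (w t) - w (a + t)) <= 1 / 8].
Proof.
have [idi _ _] := ps_id_unitary hP.
have id1 : inner (ps_id P 1) (ps_id P 1) = 1.
  by rewrite (iso_inner idi) /inner /= /self_inner star1 mulr1.
have [w wc w0] := scont_ex hc (ps_id P 1).
have e0 : 0 < 1 / 64 :> R by lra.
have [d1 d10 h1] := scont_inner hi (wc 0) (wc 0) e0.
have [d2 d20 h2] := scont_mul hP hi hc (wc 0) (wc 0) e0.
have [d3 d30 h3] := wc 0 _ e0.
have [d [d0 dd1 dd2 dd3]] : exists d : R, [/\ 0 < d, d <= d1, d <= d2 & d <= d3].
  exists (Num.min d1 (Num.min d2 d3)); split; first by rewrite !lt_min d10 d20.
  - by rewrite ge_min lexx.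
  - by rewrite !ge_min lexx orbT.
  - by rewrite !ge_min lexx !orbT.
(* Times up to 5 a are needed, as t <= 4 a and a + t both occur; they stay below d. *)
pose a := rp (d / 8); have aE : rpval a = d / 8 by rewrite rpE//; lra.
have near t (c : R) : d <= c -> rpval t <= 5 * rpval a -> `|rpval t - rpval (0 : Rplus R)| < c.
  by move=> dc ta; rewrite subr0 ger0_norm ?rpval_ge0//; lra.
have ww t : rpval t <= 5 * rpval a -> rnorm (inner (w t) (w t) - 1) < 1 / 64.
  by move=> ta; rewrite -id1 -w0; apply: h1; exact: near.
have wn t : rpval t <= 5 * rpval a -> rnorm (w t) <= 9 / 8.
  move=> /ww h; apply: le_of_sqr; first lra.
  have := rnorm_sub (inner (w t) (w t)) 1; rewrite -rnorm_inner; have := @rnorm1_le1 _ B; lra.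
have a0 : 0 < rpval a by lra.
have aa : rpval a <= 5 * rpval a by lra.
have ga : rnorm (1 - inner (w a) (w a)) < 1 / 64 by rewrite rnormB; exact: ww.
have [|b [bE b1]] := inv_sqrt (hm_pos (w a)); first lra.
exists a; split=> //; exists (ract (w a) b); split.
  by rewrite inner_ractl inner_ractr mulrA.
exists w; split=> // t ta; first by apply/ltW/(lt_trans (ww _ _)); lra.
(* The estimate of [inv_sqrt] with |1 - a| < 1/64 gives (1/64)/(1 - 1/64) = 1/63. *)
have za : rnorm (ract (w a) b - w a) <= 9 / 8 * (1 / 63).
  have -> : ract (w a) b - w a = ract (w a) (b - 1) by rewrite ractDr ractN ract1.
  apply: le_trans (rnorm_ract _ _) _; apply: ler_pM; rewrite ?rnorm_ge0 ?wn//.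
  by have := rnorm_ge0 (b - 1); nra.
have i0 : i (ps_mul (w 0) (w 0)) = i (w 0).
  rewrite -(cast_emb i (add0r 0)) {1}w0 (ps_mul0l hP) lact1 //.
have ta5 : rpval t <= 5 * rpval a by lra.
have at5 : rpval (a + t) <= 5 * rpval a by rewrite rpD; lra.
have k1 : rnorm (ps_mul (w a) (w t) - w (a + t)) <= 1 / 32.
  rewrite -(iso_norm (hi _)) (isoB (hi _)).
  have := h2 a t (near _ _ dd2 aa) (near _ _ dd2 ta5); rewrite i0.
  have := h3 _ (near _ _ dd3 at5).
  have := rnorm_tri (i (w 0)) (i (ps_mul (w a) (w t))) (i (w (a + t))).
  have := rnormB (i (w 0)) (i (w (a + t))); lra.
have -> : ps_mul (ract (w a) b) (w t) - w (a + t) =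
    ps_mul (ract (w a) b - w a) (w t) + (ps_mul (w a) (w t) - w (a + t)).
  by rewrite (pmBl hP) subrKA.
apply: le_trans (rnormD _ _) _.
have := pm_norm hP (ract (w a) b - w a) (w t); have := wn _ ta5.
have := rnorm_ge0 (w t); have := rnorm_ge0 (ract (w a) b - w a); nra.
Qed.

Lemma lip_eq {V W : normedModType (complex R)} (S : Type) (e : S -> V) (f g : V -> W)
    (C D : R) : 0 <= C -> 0 <= D ->
  (forall u (d : R), 0 < d -> exists x, rnorm (u - e x) < d) ->
  (forall u w, rnorm (f u - f w) <= C * rnorm (u - w)) ->
  (forall u w, rnorm (g u - g w) <= D * rnorm (u - w)) ->
  (forall x, f (e x) = g (e x)) -> forall u, f u = g u.
Proof.
move=> C0 D0 de fC gD fg u; apply: (@eq_of_small _ _ _ _ (C + D)) => d d0.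
have [x ux] := de u _ d0; have := rnorm_tri (f (e x)) (f u) (g u).
have h2 : rnorm (f (e x) - g u) <= D * rnorm (u - e x) by rewrite fg rnormB; exact: gD.
have h1 := fC u (e x).
have : C * rnorm (u - e x) <= C * d by rewrite ler_wpM2l// ltW.
have : D * rnorm (u - e x) <= D * d by rewrite ler_wpM2l// ltW.
rewrite mulrDl; lra.
Qed.

(** Each identity holds pointwise at large times for stable sections, and extends to the completion
    because both sides are Lipschitz in the vector of [E]. *)
Lemma dilation_exists : exists (E : hilbertModType B)
  (v : forall t : Rplus R, E -> P t -> E) (xi : E), unit_vector xi /\ left_dilation i v.
Proof.
have [a [a0 [z [z1 [w [wc w1 w2]]]]]] := unit_setup.
pose E : hilbertModType B := completion (st_ph hP hi a0 z1).
pose emb := @cemb _ _ (st_ph hP hi a0 z1).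
have [v [vE vlip]] := dil_ex hP hi hc a0 z1.
have [xi xi1] := unit_ex hP hi hc a0 z1 wc w1 w2.
exists E, v, xi; split=> //.
have de (u : E) (d : R) : 0 < d -> exists x, rnorm (u - emb x) < d by exact: cemb_dense.
have vinner : forall t (x x' : E) (y y' : P t),
    inner (v t x y) (v t x' y') = inner y (op (lact (P t) (inner x x')) y').
  move=> t x x' y y'.
  have lipr (u p q : E) : rnorm (inner (v t u y) (v t p y') - inner (v t u y) (v t q y')) <=
      (rnorm (v t u y) * rnorm y') * rnorm (p - q).
    rewrite -innerBr; apply: le_trans (CS _ _) _; rewrite -mulrA.
    by apply: ler_wpM2l; [exact: rnorm_ge0|exact: vlip].
  have lipr' (u p q : E) : rnorm (inner y (op (lact (P t) (inner u p)) y') -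
      inner y (op (lact (P t) (inner u q)) y')) <=
      (rnorm y * rnorm u * rnorm y') * rnorm (p - q).
    rewrite -innerBr -lactBl -innerBr; apply: le_trans (CS _ _) _.
    rewrite -!mulrA ler_wpM2l ?rnorm_ge0//; apply: le_trans (rnorm_lact _ _) _.
    by rewrite [rnorm y' * _]mulrC mulrA ler_wpM2r ?rnorm_ge0 ?CS.
  have lipl (u p q : E) : rnorm (inner (v t p y) (v t u y') - inner (v t q y) (v t u y')) <=
      (rnorm y * rnorm (v t u y')) * rnorm (p - q).
    rewrite -innerBl; apply: le_trans (CS _ _) _; rewrite mulrAC.
    by apply: ler_wpM2r; [exact: rnorm_ge0|exact: vlip].
  have lipl' (u p q : E) : rnorm (inner y (op (lact (P t) (inner p u)) y') -
      inner y (op (lact (P t) (inner q u)) y')) <=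
      (rnorm y * rnorm u * rnorm y') * rnorm (p - q).
    rewrite -innerBr -lactBl -innerBl; apply: le_trans (CS _ _) _.
    rewrite -!mulrA ler_wpM2l ?rnorm_ge0//; apply: le_trans (rnorm_lact _ _) _.
    by rewrite [rnorm y' * _]mulrC mulrA ler_wpM2r ?rnorm_ge0// mulrC CS.
  move: x; apply: (lip_eq _ _ de (fun p q => lipl x' p q) (fun p q => lipl' x' p q));
    rewrite ?mulr_ge0 ?rnorm_ge0// => X.
  move: x'; apply: (lip_eq _ _ de (fun p q => lipr (emb X) p q) (fun p q => lipr' (emb X) p q));
    rewrite ?mulr_ge0 ?rnorm_ge0// => X'.
  by rewrite !vE !inner_cemb; exact: st_rsh_ip.
split=> //.
- move=> t u e e0; have e2 : 0 < e / 2 by lra.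
  have [x hx] := de u _ e2; have e4 : 0 < e / 2 by lra.
  have [l hl] := st_dense hP hi hc a0 z1 x t e4.
  exists [seq (emb p.1, p.2) | p <- l]; rewrite big_map.
  under eq_bigr do rewrite vE.
  by apply: le_lt_trans (rnorm_tri (emb x) _ _) _; rewrite (splitr e); exact: ltr_leD hx hl.
- move=> s t x y y'; move: x.
  apply: (@lip_eq _ _ _ emb (fun x => v (s + t) x (ps_mul y y')) (fun x => v t (v s x y) y')
    (rnorm (ps_mul y y')) (rnorm y' * rnorm y) _ _ de).
  + exact: rnorm_ge0.
  + by rewrite mulr_ge0 ?rnorm_ge0.
  + by move=> p q; exact: vlip.
  + move=> p q; apply: le_trans (vlip _ _ _ _) _.
    by rewrite -mulrA; apply: ler_wpM2l; [exact: rnorm_ge0|exact: vlip].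
  + move=> X; rewrite !vE; apply: (emb_eq hP hi a0 z1 (T := rpval (s + t))) => r hr.
    have [h|[r' ->]] := shiftP (s + t) r; first by exfalso; lra.
    rewrite /= rshE (section_cast _ (esym (addrA r' s t))) !rshE.
    by rewrite -(ps_mulA hP) castK.
- move=> x b; move: x.
  apply: (@lip_eq _ _ _ emb (fun x => v 0 x (ps_id P b)) (fun x => ract x b)
    (rnorm (ps_id P b)) (rnorm b) _ _ de).
  + exact: rnorm_ge0.
  + exact: rnorm_ge0.
  + by move=> p q; exact: vlip.
  + move=> p q; have -> : ract p b - ract q b = ract (p - q) b.
      by rewrite ractDl -[- q]scaleN1r ractZl scaleN1r.
    by rewrite mulrC; exact: rnorm_ract.
  + move=> X; rewrite vE -emb_ract; apply: (emb_eq hP hi a0 z1 (T := 0)) => r _ /=.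
    by rewrite (section_cast (rsh _ _) (addr0 r)) rshE (ps_mul0r hP).
- move=> x Y t0 e Yc e0; have e3 : 0 < e / 3 by lra.
  have [d1 d10 h1] := scont_norm hi (Yc t0) ltr01.
  have C0 : 0 <= rnorm (Y t0) + 1 by have := rnorm_ge0 (Y t0); lra.
  have [c [c0 _ ce]] := small_mul C0 e3.
  have [X hX] := de x _ c0.
  have [d2 d20 h2] := st_cont hP hi hc a0 z1 X t0 Yc e3.
  exists (Num.min d1 d2); first by rewrite lt_min d10.
  move=> t; rewrite lt_min => /andP[/h1 k1 /h2 k2].
  have l1 s : rnorm (Y s) < rnorm (Y t0) + 1 ->
      rnorm (v s x (Y s) - v s (emb X) (Y s)) <= (rnorm (Y t0) + 1) * c.
    move=> ks; apply: le_trans (vlip _ _ _ _) _.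
    by apply: ler_pM; rewrite ?rnorm_ge0//; exact: ltW.
  have k3 := l1 _ k1; have k4 := l1 t0 (ltr_pwDr ltr01 (lexx _)).
  rewrite !vE in k3 k4.
  apply: le_lt_trans (rnorm_tri (emb (st_rsh hP hi hc X (Y t))) _ _) _.
  have tri := rnorm_tri (emb (st_rsh hP hi hc X (Y t0))) (emb (st_rsh hP hi hc X (Y t)))
    (v t0 x (Y t0)).
  apply: le_lt_trans (lerD k3 tri) _; rewrite [X in _ + (_ + X)]rnormB.
  apply: le_lt_trans (lerD (lexx _) (lerD k2 k4)) _.
  by move: ((rnorm (Y t0) + 1) * c) ce => q; lra.
Qed.


End LeftDilation.

(** * Boundedness of adjointable operators *)

Section Bounded.
Context {R : realType} {B : unitalCStarAlgType R} {E : hilbertModType B}.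
Implicit Types (a b : adjointable E) (x y : E).

Lemma op0 a : op a 0 = 0.
Proof. by rewrite -(scale0r (0 : E)) opZ !scale0r. Qed.

Lemma opB a x y : op a (x - y) = op a x - op a y.
Proof. by rewrite opD opN. Qed.

Lemma op_sum a I (l : seq I) (F : I -> E) :
  op a (\sum_(j <- l) F j) = \sum_(j <- l) op a (F j).
Proof. exact: (big_morph (op a) (opD a) (op0 a)). Qed.

(* Hellinger-Toeplitz, by a gliding hump: were [a] unbounded on unit vectors x_n,
   the functionals <a x_n, .> would be pointwise bounded (by |a^* y|), yet for
   each direction u one of y + u, y - u makes <a x_n, .> as large as at u. *)
Lemma adj_bounded a : exists2 C : R, 0 <= C & forall x, rnorm (op a x) <= C * rnorm x.
Proof.
apply: contrapT => nb.
have big (C : R) : 0 <= C -> exists x, rnorm x <= 1 /\ C < rnorm (op a x).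
  move=> C0; apply: contrapT => h; apply: nb; exists C => // x.
  have := rnorm_ge0 x; rewrite le_eqVlt => /predU1P[x0|x0].
    by rewrite (rnorm0_eq0 (esym x0)) op0 !rnorm0 mulr0.
  rewrite leNgt; apply/negP => hx; apply: h; exists ((rnorm x)^-1%:C *: x).
  rewrite opZ !rnormZr gtr0_norm ?invr_gt0// mulVf ?gt_eqF//; split=> //.
  by rewrite mulrC ltr_pdivlMr.
(* With ratio 1/4 the later humps move y by at most (4/3) q^(n+1) = q^n / 3. Two thirds of the n-th
   hump remain, and the x_n are chosen so that this hump, q^n |a x_n|, exceeds n. *)
pose q : R := 4^-1.
have q0 : 0 < q by rewrite invr_gt0.
have qn0 n : 0 < q ^+ n by rewrite exprn_gt0.
have /choice[x hx] : forall n : nat, exists x, rnorm x <= 1 /\ n%:R / q ^+ n < rnorm (op a x).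
  by move=> n; apply: big; rewrite divr_ge0// ltW.
pose N n := rnorm (op a (x n)).
have N0 n : 0 < N n.
  by have [_] := hx n; apply: le_lt_trans; rewrite divr_ge0// ltW.
pose u n : E := (q ^+ n / N n)%:C *: op a (x n).
have un n : rnorm (u n) = q ^+ n.
  by rewrite rnormZr gtr0_norm ?divr_gt0// divfK// gt_eqF.
pose T n y : B := inner (op a (x n)) y.
have TB n y y' : T n (y - y') = T n y - T n y' by exact: innerBr.
have Tu n : rnorm (T n (u n)) = q ^+ n * N n.
  rewrite /T innerZr rnormZr gtr0_norm ?divr_gt0// -rnorm_inner -/(N n).
  by rewrite expr2 mulrA divfK// gt_eqF.
pose f n y := if q ^+ n * N n <= rnorm (T n (y + u n)) then y + u n else y - u n.
have fT n y : q ^+ n * N n <= rnorm (T n (f n y)).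
  rewrite /f; case: (leP (q ^+ n * N n) (rnorm (T n (y + u n)))) => // h.
  have : T n (u n) + T n (u n) = T n (y + u n) - T n (y - u n).
    by rewrite -TB opprB [y + u n + _]addrC subrKA /T innerDr.
  move=> /(congr1 (@rnorm _ _)).
  have -> : T n (u n) + T n (u n) = (2 : R)%:C *: T n (u n).
    by rewrite -mulr2n -[LHS]scaler_nat rmorph_nat.
  rewrite rnormZr ger0_norm// Tu => h2.
  have := rnormD (T n (y + u n)) (- T n (y - u n)); rewrite rnormN; lra.
have fd n y : rnorm (f n y - y) = q ^+ n.
  by rewrite /f; case: ifP => _; rewrite addrC addKr ?rnormN un.
pose fix w n : E := if n is m.+1 then f m (w m) else 0.
have wd n k : rnorm (w (k + n)%N - w n) <= (4 / 3) * (q ^+ n - q ^+ (k + n)).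
  elim: k => [|k IH]; first by rewrite !subrr rnorm0 mulr0.
  have := rnorm_tri (w (k + n)%N) (w (k.+1 + n)%N) (w n).
  rewrite addSn [w (k + n).+1]/= fd exprS; rewrite /q in IH *; lra.
have wd' n k : rnorm (w (k + n)%N - w n) <= (4 / 3) * q ^+ n.
  apply: le_trans (wd n k) _; have := qn0 (k + n)%N; lra.
have q1 : q < 1 by rewrite /q; lra.
have [y hy] : exists y, rlim w y.
  apply: rcauchy_cvg => e e0.
  have [|n0 hn0] := geom_small (ltW q0) q1 (_ : 0 < e / 4); first lra.
  have main n m : (n0 <= n)%N -> (n <= m)%N -> rnorm (w m - w n) < e.
    move=> n0n nm; rewrite -(subnK nm); apply: le_lt_trans (wd' _ _) _.
    have : q ^+ n <= q ^+ n0 by apply: ler_wiXn2l => //; exact: ltW.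
    lra.
  exists n0 => n m Nn Nm; case: (leqP n m) => nm; last by apply: main => //; exact: ltnW.
  by rewrite rnormB; apply: main.
have yd n : rnorm (y - w n) <= (4 / 3) * q ^+ n.
  apply/ler_addgt0Pr => e /hy[M hM].
  have := hM (M + n)%N (leq_addr _ _); have := wd' n M.
  have := rnorm_tri (w (M + n)%N) y (w n); have := rnormB y (w (M + n)%N); lra.
have lower n : 2^-1 * n%:R <= rnorm (opadj a y).
  have h1 : rnorm (T n y) <= rnorm (opadj a y).
    rewrite /T op_inner; apply: le_trans (CS _ _) _.
    by rewrite ler_piMl ?rnorm_ge0//; have [] := hx n.
  have h2 := fT n (w n); have h3 := yd n.+1.
  have h4 : rnorm (T n (y - w n.+1)) <= N n * rnorm (y - w n.+1) by exact: CS.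
  have h5 := rnorm_sub (T n (w n.+1)) (T n y).
  rewrite rnormB -TB in h5.
  have h6 : N n * rnorm (y - w n.+1) <= N n * (4 / 3 * q ^+ n.+1).
    by rewrite ler_wpM2l// ltW.
  have [_ h7] := hx n; rewrite ltr_pdivrMr// -/(N n) in h7.
  rewrite exprS in h6; rewrite -/(w n.+1) in h2.
  have h8 : N n * (4 / 3 * (q * q ^+ n)) = 3^-1 * (N n * q ^+ n) by rewrite /q; field.
  have h9 : q ^+ n * N n = N n * q ^+ n by rewrite mulrC.
  have h10 := @ler0n R n.
  rewrite h8 in h6; rewrite h9 in h2.
  move: (N n * q ^+ n) h2 h6 h7 => p h2 h6 h7.
  lra.
have := lower (Num.truncn (2 * rnorm (opadj a y))).+1.
have := truncnS_gt (2 * rnorm (opadj a y)); lra.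
Qed.

Lemma opadj_bounded a (C : R) : 0 <= C -> (forall x, rnorm (op a x) <= C * rnorm x) ->
  forall x, rnorm (opadj a x) <= C * rnorm x.
Proof.
move=> C0 aC x.
have h : rnorm (opadj a x) ^+ 2 <= (C * rnorm x) * rnorm (opadj a x).
  rewrite rnorm_inner opadj_inner; apply: le_trans (CS _ _) _.
  by rewrite [C * _]mulrC -mulrA ler_wpM2l ?rnorm_ge0.
have := rnorm_ge0 (opadj a x); rewrite le_eqVlt => /predU1P[<-|p].
  by rewrite mulr_ge0 ?rnorm_ge0.
by move: h; rewrite expr2 ler_pM2r.
Qed.

Lemma op_lip a (C : R) : (forall x, rnorm (op a x) <= C * rnorm x) ->
  forall x y, rnorm (op a x - op a y) <= C * rnorm (x - y).
Proof. by move=> h x y; rewrite -opB. Qed.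

End Bounded.

(** * The semigroup of a left dilation *)

Section Calculus.
Context {R : realType} {B : unitalCStarAlgType R} {P : ps_data B}.
Context {Ehat E : hilbertModType B} {i : forall t, P t -> Ehat}
  {v : forall t : Rplus R, E -> P t -> E} (ld : left_dilation i v).
Arguments v : clear implicits.
Implicit Types (r s t : Rplus R) (a b c : adjointable E) (x u w : E).

(** Lists of pairs play the role of formal sums of elementary tensors; different lists may represent
    the same vector. *)
Definition vsum t (l : seq (E * P t)) : E := \sum_(p <- l) v t p.1 p.2.

Definition vsum_op t (a : E -> E) (l : seq (E * P t)) : E :=
  \sum_(p <- l) v t (a p.1) p.2.

Lemma v_inj t u w : (forall x y, inner (v t x y) u = inner (v t x y) w) -> u = w.
Proof.
move=> h; apply: (@dense_inner_inj _ _ _ (range (@vsum t))).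
  by move=> x d /(ld_dense ld t x)[l hl]; exists (vsum l) => //; exists l.
move=> _ [l _ <-]; rewrite !inner_suml; apply: eq_bigr => p _; exact: h.
Qed.

Lemma vDl t x x' (y : P t) : v t (x + x') y = v t x y + v t x' y.
Proof. apply: (@v_inj t) => u w; rewrite innerDr. by rewrite !(ld_inner ld) innerDr lactDl innerDr. Qed.

Lemma vDr t x (y y' : P t) : v t x (y + y') = v t x y + v t x y'.
Proof. by apply: (@v_inj t) => u w; rewrite innerDr !(ld_inner ld) opD innerDr. Qed.

Lemma vZl t k x (y : P t) : v t (k *: x) y = k *: v t x y.
Proof. by apply: (@v_inj t) => u w; rewrite innerZr !(ld_inner ld) innerZr lactZl innerZr. Qed.

Lemma vZr t k x (y : P t) : v t x (k *: y) = k *: v t x y.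
Proof. by apply: (@v_inj t) => u w; rewrite innerZr !(ld_inner ld) opZ innerZr. Qed.

Lemma v_ractr t x (y : P t) (b : B) : v t x (ract y b) = ract (v t x y) b.
Proof. by apply: (@v_inj t) => u w; rewrite inner_ractr !(ld_inner ld) op_ract inner_ractr. Qed.

Lemma v_ractl t x (y : P t) (b : B) : v t (ract x b) y = v t x (op (lact (P t) b) y).
Proof. by apply: (@v_inj t) => u w; rewrite !(ld_inner ld) inner_ractr lactMl. Qed.

Lemma vBl t x x' (y : P t) : v t (x - x') y = v t x y - v t x' y.
Proof. by rewrite vDl -scaleN1r vZl scaleN1r. Qed.

Lemma vBr t x (y y' : P t) : v t x (y - y') = v t x y - v t x y'.
Proof. by rewrite vDr -scaleN1r vZr scaleN1r. Qed.

Lemma v0r t x : v t x (0 : P t) = 0.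
Proof. by rewrite -(subrr 0) vBr subrr. Qed.

Lemma v_norm t x (y : P t) : rnorm (v t x y) <= rnorm x * rnorm y.
Proof.
apply: le_of_sqr; first by rewrite mulr_ge0 ?rnorm_ge0.
rewrite exprMn rnorm_inner (ld_inner ld); apply: le_trans (CS _ _) _.
have := rnorm_lact (inner x x) y; rewrite -rnorm_inner => h.
apply: le_trans (_ : rnorm y * (rnorm x ^+ 2 * rnorm y) <= _).
  by rewrite ler_wpM2l ?rnorm_ge0.
by rewrite mulrCA -expr2.
Qed.

Lemma vsum_op_inner t a (l l' : seq (E * P t)) :
  inner (vsum_op (op a) l) (vsum l') = inner (vsum l) (vsum_op (opadj a) l').
Proof.
rewrite /vsum_op /vsum !inner_suml; apply: eq_bigr => p _.
rewrite !inner_sumr; apply: eq_bigr => p' _.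
by rewrite !(ld_inner ld) op_inner.
Qed.

Lemma vsum_op_comp t (f g : E -> E) (l : seq (E * P t)) :
  vsum_op f [seq (g p.1, p.2) | p <- l] = vsum_op (f \o g) l.
Proof. by rewrite /vsum_op big_map. Qed.

Lemma vsum_opE t (f : E -> E) (l : seq (E * P t)) :
  vsum_op f l = vsum [seq (f p.1, p.2) | p <- l].
Proof. by rewrite /vsum big_map. Qed.

Lemma vsum_op_crude t (f : E -> E) (C : R) (l : seq (E * P t)) :
  (forall x, rnorm (f x) <= C * rnorm x) ->
  rnorm (vsum_op f l) <= C * \sum_(p <- l) rnorm p.1 * rnorm p.2.
Proof.
move=> fC; apply: le_trans (rnorm_sum _ _ _) _; rewrite mulr_sumr.
apply: ler_sum => p _; apply: le_trans (v_norm _ _) _.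
by rewrite mulrA ler_wpM2r ?rnorm_ge0.
Qed.

(* With w_k = |H^(2^k) z| Cauchy-Schwarz gives w_k^2 <= |z| w_(k+1), so the crude
   bound w_k = O(A^(2^k)) already forces w_0 <= A |z|. *)
Lemma power_trick (w : nat -> R) (A K v0 : R) : 0 <= A -> 0 <= v0 ->
  (forall k, 0 <= w k) -> (forall k, w k ^+ 2 <= v0 * w k.+1) ->
  (forall k, w k <= A ^+ (2 ^ k) * K) -> w 0%N <= A * v0.
Proof.
move=> A0; rewrite le_eqVlt => /predU1P[<-|v0p] w0 wS wK.
  rewrite mulr0; have := wS 0%N; have := w0 0%N; nra.
rewrite leNgt; apply/negP => h; pose rho := w 0%N / v0.
have rhoA : A < rho by rewrite ltr_pdivlMr.
have rho0 : 0 < rho by lra.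
(* If w_0 = rho v0 with rho > A, the recursion forces w_k to grow like rho^(2^k), which eventually
   exceeds the crude bound A^(2^k) K. *)
have wl k : v0 * rho ^+ (2 ^ k) <= w k.
  elim: k => [|k IH]; first by rewrite expn0 expr1 mulrC divfK// gt_eqF.
  rewrite -(ler_pM2l v0p); apply: le_trans (wS k).
  rewrite expnS mulnC exprM mulrA -expr2 -exprMn.
  by rewrite ler_pXn2r ?nnegrE ?mulr_ge0 ?exprn_ge0// ltW.
have K0 : 0 < K.
  have h1 := wl 0%N; have h2 := wK 0%N; rewrite !expn0 !expr1 in h1 h2.
  have h3 : 0 < v0 * rho by rewrite mulr_gt0.
  rewrite ltNge; apply/negP => Kn; nra.
have q0 : 0 <= A / rho by rewrite divr_ge0// ltW.
have q1 : A / rho < 1 by rewrite ltr_pdivrMr// mul1r.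
have [m hm] := geom_small q0 q1 (divr_gt0 v0p K0).
have hm2 : (A / rho) ^+ (2 ^ m) < v0 / K.
  apply: le_lt_trans hm; apply: ler_wiXn2l => //; first exact: ltW.
  by apply: ltnW; apply: ltn_expl.
have := le_trans (wl m) (wK m); rewrite leNgt => /negP; apply.
move: hm2; rewrite expr_div_n ltr_pdivrMr ?exprn_gt0// mulrAC ltr_pdivlMr//.
Qed.

(** The triangle inequality only bounds the result by a quantity depending on the list. Passing to
    powers of H = a^* a, with |H^m l|^2 <= |l| |H^(2m) l|, removes this dependence by [power_trick]
    and leaves the factor C^2 for H, hence C for a. *)
Lemma vsum_op_bound t a (C : R) (l : seq (E * P t)) : 0 <= C ->
  (forall x, rnorm (op a x) <= C * rnorm x) ->
  rnorm (vsum_op (op a) l) <= C * rnorm (vsum l).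
Proof.
move=> C0 aC; have aC' := opadj_bounded C0 aC.
pose H := ba_mul (ba_star a) a.
pose Hn m : adjointable E := iter m (ba_mul H) (ba_one E).
have HnD m n x : op (Hn (m + n)%N) x = op (Hn m) (op (Hn n) x).
  by elim: m => //= m IH; rewrite IH.
have Hnadj m x : opadj (Hn m) x = op (Hn m) x.
  elim: m x => //= m IH x; rewrite IH.
  have : op (Hn (m + 1)%N) x = op (Hn (1 + m)%N) x by rewrite addnC.
  by rewrite !HnD.
have HnB m x : rnorm (op (Hn m) x) <= (C ^+ 2) ^+ m * rnorm x.
  elim: m x => [|m IH] x; first by rewrite expr0 mul1r.
  rewrite /=; apply: le_trans (aC' _) _; apply: le_trans (ler_wpM2l C0 (aC _)) _.
  rewrite mulrA -expr2 [_ ^+ m.+1]exprS -[X in _ <= X]mulrA.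
  by apply: ler_wpM2l; [exact: sqr_ge0|exact: IH].
pose w k := rnorm (vsum_op (op (Hn (2 ^ k)%N)) l).
have step m : rnorm (vsum_op (op (Hn m)) l) ^+ 2 <=
    rnorm (vsum l) * rnorm (vsum_op (op (Hn (m + m)%N)) l).
  rewrite rnorm_inner [X in inner _ X]vsum_opE vsum_op_inner vsum_op_comp.
  have -> : vsum_op (opadj (Hn m) \o op (Hn m)) l = vsum_op (op (Hn (m + m)%N)) l.
    by apply: eq_bigr => p _ /=; rewrite Hnadj -HnD.
  exact: CS.
have w0 : w 0%N <= C ^+ 2 * rnorm (vsum l).
  apply: (@power_trick w _ (\sum_(p <- l) rnorm p.1 * rnorm p.2)).
  - exact: sqr_ge0.
  - exact: rnorm_ge0.
  - by move=> k; exact: rnorm_ge0.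
  - by move=> k; rewrite /w expnS mul2n -addnn; exact: step.
  - by move=> k; apply: vsum_op_crude; exact: HnB.
apply: le_of_sqr; first by rewrite mulr_ge0 ?rnorm_ge0.
rewrite rnorm_inner [X in inner _ X]vsum_opE vsum_op_inner vsum_op_comp.
apply: le_trans (CS _ _) _.
have -> : vsum_op (opadj a \o op a) l = vsum_op (op (Hn (2 ^ 0)%N)) l.
  by apply: eq_bigr.
apply: le_trans (ler_wpM2l (rnorm_ge0 _) w0) _.
by rewrite exprMn mulrCA -expr2.
Qed.

Lemma vsum_dense t u (d : R) : 0 < d -> exists l : seq (E * P t), rnorm (u - vsum l) < d.
Proof. by move=> d0; exact: (ld_dense ld t u d0). Qed.

Lemma vsum_op_lip t a (C : R) (l l' : seq (E * P t)) : 0 <= C ->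
  (forall x, rnorm (op a x) <= C * rnorm x) ->
  rnorm (vsum_op (op a) l - vsum_op (op a) l') <= C * rnorm (vsum l - vsum l').
Proof.
move=> C0 aC; pose m := l ++ [seq (- p.1, p.2) | p <- l'].
have vN x (y : P t) : v t (- x) y = - v t x y by rewrite -scaleN1r vZl scaleN1r.
have -> : vsum l - vsum l' = vsum m.
  rewrite /vsum /m big_cat big_map /= -sumrN; congr (_ + _).
  by apply: eq_bigr => p _; rewrite vN.
have -> : vsum_op (op a) l - vsum_op (op a) l' = vsum_op (op a) m.
  rewrite /vsum_op /m big_cat big_map /= -sumrN; congr (_ + _).
  by apply: eq_bigr => p _; rewrite opN vN.
exact: vsum_op_bound.
Qed.

(** Both a and its adjoint are extended from finite sums, and adjointness extends by density. The
    bound is transferred for every C, since strictness requires one bound for a whole bounded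
    set. *)
Lemma theta_ex t a : exists T : adjointable E,
  (forall x y, op T (v t x y) = v t (op a x) y) /\
  (forall C : R, 0 <= C -> (forall x, rnorm (op a x) <= C * rnorm x) ->
     forall x, rnorm (op T x) <= C * rnorm x).
Proof.
have ext b : exists h : E -> E, (forall l : seq (E * P t), h (vsum l) = vsum_op (op b) l) /\
    forall C : R, 0 <= C -> (forall x, rnorm (op b x) <= C * rnorm x) ->
      forall u w, rnorm (h u - h w) <= C * rnorm (u - w).
  have [C C0 bC] := adj_bounded b.
  have [h [h1 h2]] := lip_ext C0 (@vsum_dense t) (fun l l' => vsum_op_lip l l' C0 bC).
  exists h; split; first exact: h1.
  move=> D D0 bD u w.
  (* The extension built with the constant D agrees with h on the dense sums, hence everywhere, so h
     inherits the bound D. *)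
  have [h' [h1' h2']] := lip_ext D0 (@vsum_dense t) (fun l l' => vsum_op_lip l l' D0 bD).
  have hh : forall x, h x = h' x.
    by apply: (lip_eq C0 D0 (@vsum_dense t) h2 h2') => l; rewrite h1 h1'.
  by rewrite !hh.
have [h [h1 h2]] := ext a; have [k [k1 k2]] := ext (ba_star a).
have [C C0 aC] := adj_bounded a; have aC' := opadj_bounded C0 aC.
have hk x y : inner (h x) y = inner x (k y).
  move: x; apply: (@lip_eq _ _ _ _ (@vsum t) (fun x => inner (h x) y) (fun x => inner x (k y))
    (C * rnorm y) (rnorm (k y)) _ _ (@vsum_dense t)).
  - by rewrite mulr_ge0 ?rnorm_ge0.
  - exact: rnorm_ge0.
  - move=> u w; rewrite -innerBl; apply: le_trans (CS _ _) _.
    by rewrite mulrAC ler_wpM2r ?rnorm_ge0// h2.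
  - by move=> u w; rewrite -innerBl mulrC; exact: CS.
  move=> l; rewrite h1; move: y; apply: (@lip_eq _ _ _ _ (@vsum t)
    (fun y => inner (vsum_op (op a) l) y) (fun y => inner (vsum l) (k y))
    (rnorm (vsum_op (op a) l)) (rnorm (vsum l) * C) _ _ (@vsum_dense t)).
  - exact: rnorm_ge0.
  - by rewrite mulr_ge0 ?rnorm_ge0.
  - by move=> u w; rewrite -innerBr; exact: CS.
  - move=> u w; rewrite -innerBr; apply: le_trans (CS _ _) _.
    by rewrite -mulrA ler_wpM2l ?rnorm_ge0// k2.
  by move=> l'; rewrite k1 vsum_op_inner.
exists (Adjointable hk); split=> /= [x y|D D0 aD x].
  by have := h1 [:: (x, y)]; rewrite /vsum /vsum_op !big_seq1.
have h0 : h 0 = 0 by have := h1 [::]; rewrite /vsum /vsum_op !big_nil.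
by have := h2 _ D0 aD x 0; rewrite h0 !subr0.
Qed.

End Calculus.

(** * Strict convergence as strong convergence of operators and adjoints *)

Section StrictTopology.
Context {R : realType} {B : unitalCStarAlgType R} {E : hilbertModType B}.
Implicit Types (a b : adjointable E) (x : E).

Let pts : adjointable E -> {ptws E -> (E * E)%type} := fun a x => (op a x, opadj a x).

Lemma strict_near a x (e : R) : 0 < e -> \forall b \near a,
  rnorm (op a x - op b x) < e /\ rnorm (opadj a x - opadj b x) < e.
Proof.
move=> e0; apply/(@nbhs_initialP _ _ pts).
have ec : 0 < e%:C :> complex R by rewrite ltcR.
exists ((fun f : {ptws E -> (E * E)%type} => f x) @^-1`
    (ball (op a x) e%:C `*` ball (opadj a x) e%:C)).
  have := @proj_continuous E (fun=> (E * E)%type) x (pts a); apply.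
  by exists (ball (op a x) e%:C, ball (opadj a x) e%:C) => //=; split; exact: nbhsx_ballx.
by move=> b [] /=; rewrite -!ball_normE /= !rnormE !ltcR.
Qed.

Lemma strict_cvg T (F : set_system T) (FF : Filter F) (f : T -> adjointable E) a :
  (forall x (e : R), 0 < e -> \forall t \near F, rnorm (op a x - op (f t) x) < e) ->
  (forall x (e : R), 0 < e -> \forall t \near F, rnorm (opadj a x - opadj (f t) x) < e) ->
  f @ F --> a.
Proof.
move=> h h'; move=> A /(@nbhs_initialP _ _ pts)[C fC CA].
have : pts \o f @ F --> (pts a : {ptws E -> (E * E)%type}).
  apply/pointwise_cvgP => x.
  have := @cvg_pair _ _ _ F (nbhs (op a x)) (nbhs (opadj a x)) FF _ _
    (fun t => op (f t) x) (fun t => opadj (f t) x); apply.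
    by apply/(@cvg_rnormP _ _ _ _ FF) => e; exact: h.
  by apply/(@cvg_rnormP _ _ _ _ FF) => e; exact: h'.
move=> hC; exact: (@filterS _ F FF ((pts \o f) @^-1` C) (f @^-1` A)
  (fun t ht => CA (f t) ht) (hC C fC)).
Qed.

End StrictTopology.

(** * The semigroup axioms, strictness and strict continuity *)

Section Semigroup.
Context {R : realType} {B : unitalCStarAlgType R} {P : ps_data B}
  (hP : is_product_system P).
Context {Ehat E : hilbertModType B} {i : forall t, P t -> Ehat}
  (hi : forall t, isometric_embedding (i t)) (hc : is_continuous_ps i).
Context {v : forall t : Rplus R, E -> P t -> E} (ld : left_dilation i v).
Arguments v : clear implicits.
Implicit Types (r s t : Rplus R) (a b c : adjointable E) (x u w : E).

Definition theta t a : adjointable E := projT1 (cid (theta_ex ld t a)).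

Lemma thetaE t a x y : op (theta t a) (v t x y) = v t (op a x) y.
Proof. by rewrite /theta; case: cid => T [h _] /=; exact: h. Qed.

Lemma theta_bound t a (C : R) : 0 <= C -> (forall x, rnorm (op a x) <= C * rnorm x) ->
  forall x, rnorm (op (theta t a) x) <= C * rnorm x.
Proof. by rewrite /theta; case: cid => T [_ h] /=; exact: h. Qed.

Lemma op_vsum t a (l : seq (E * P t)) (f : E -> E) :
  (forall x y, op a (v t x y) = v t (f x) y) -> op a (vsum (v := v) l) = vsum_op (v := v) f l.
Proof. by move=> h; rewrite /vsum op_sum; apply: eq_bigr => p _; rewrite h. Qed.

Lemma adj_ext t a b : (forall x y, op a (v t x y) = op b (v t x y)) -> a = b.
Proof.
move=> h; apply: adjointableP; have [C C0 aC] := adj_bounded a.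
have [D D0 bD] := adj_bounded b.
apply: (lip_eq C0 D0 (@vsum_dense _ _ _ _ _ _ _ ld t) (op_lip aC) (op_lip bD)) => l.
by rewrite /vsum !op_sum; apply: eq_bigr => p _; exact: h.
Qed.

Lemma theta_star t a : theta t (ba_star a) = ba_star (theta t a).
Proof.
apply: (@adj_ext t) => x y; rewrite thetaE; apply: (v_inj ld (t := t)) => x' y' /=.
by rewrite -op_inner thetaE !(ld_inner ld) op_inner.
Qed.

Lemma theta_adjE t a x y : opadj (theta t a) (v t x y) = v t (opadj a x) y.
Proof. by rewrite -[LHS]/(op (ba_star (theta t a)) _) -theta_star thetaE. Qed.

Lemma theta0 a : theta 0 a = a.
Proof.
apply: (@adj_ext 0) => x y; rewrite thetaE.
have [_ /(_ y)[b <-] _] := ps_id_unitary hP.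
by rewrite !(ld_id ld) op_ract.
Qed.

Lemma thetaD s t a : theta (s + t) a = theta s (theta t a).
Proof.
(* In v_(t+s)(x, y w) = v_s(v_t(x, y), w) the factor from [P t] is absorbed first, so the inner
   endomorphism is the one at t. *)
rewrite addrC; apply: (@adj_ext (t + s)) => x q.
have [C C0 h1] := adj_bounded (theta (t + s) a).
have [D D0 h2] := adj_bounded (theta s (theta t a)).
have lip (T : adjointable E) (K : R) : 0 <= K -> (forall x, rnorm (op T x) <= K * rnorm x) ->
    forall p q, rnorm (op T (v (t + s) x p) - op T (v (t + s) x q)) <= (K * rnorm x) * rnorm (p - q).
  move=> K0 TK p p'; rewrite -opB -(vBr ld); apply: le_trans (TK _) _.
  by rewrite -mulrA ler_wpM2l// (v_norm ld).
have Cx : 0 <= C * rnorm x by rewrite mulr_ge0 ?rnorm_ge0.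
have Dx : 0 <= D * rnorm x by rewrite mulr_ge0 ?rnorm_ge0.
move: q; apply: (lip_eq Cx Dx (@pm_dense _ _ _ hP t s) (lip _ _ C0 h1) (lip _ _ D0 h2)) => l.
have -> : v (t + s) x (\sum_(p <- l) ps_mul p.1 p.2) = \sum_(p <- l) v s (v t x p.1) p.2.
  rewrite (big_morph (v (t + s) x) (vDr ld x) (v0r ld (t + s) x)).
  by apply: eq_bigr => p _; rewrite (ld_mul ld).
rewrite !op_sum; apply: eq_bigr => p _.
by rewrite -(ld_mul ld) thetaE !(ld_mul ld) !thetaE.
Qed.

Lemma theta_linear t : linear (theta t).
Proof.
move=> k a b; apply: (@adj_ext t) => x y.
by rewrite thetaE /= !thetaE (vDl ld) (vZl ld).
Qed.

Lemma theta_monoid t : monoid_morphism (theta t).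
Proof.
split; first by apply: (@adj_ext t) => x y; rewrite thetaE.
by move=> a b; apply: (@adj_ext t) => x y; rewrite thetaE /= !thetaE.
Qed.

Lemma ba_boundedP (S : set (adjointable E)) : ba_bounded S -> exists2 C : R, 0 <= C &
  forall a, S a -> forall x, rnorm (op a x) <= C * rnorm x.
Proof.
move=> [M SM]; exists `|complex.Re M|; first exact: normr_ge0.
move=> a Sa x; have := SM a Sa x; rewrite !rnormE => h.
have := rnorm_leC (v := op a x) (M := M * (rnorm x)%:C); rewrite rnormE => /(_ h).
case: M {SM} h => p q /=; rewrite mulr0 subr0 => _ /le_trans; apply.
by rewrite ler_wpM2r ?rnorm_ge0 ?ler_norm.
Qed.

Lemma theta_strict t : strict (theta t).
Proof.
move=> S /ba_boundedP[C C0 SC].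
apply/subspace_continuousP => a Sa.
have SC' b : S b -> forall x, rnorm (opadj b x) <= C * rnorm x.
  by move=> Sb; apply: opadj_bounded => //; exact: SC.
have TC b : S b -> forall x, rnorm (op (theta t b) x) <= C * rnorm x.
  by move=> Sb; apply: theta_bound => //; exact: SC.
have TC' b : S b -> forall x, rnorm (opadj (theta t b) x) <= C * rnorm x.
  by move=> Sb; apply: opadj_bounded => //; exact: TC.
(* Stated once for operators and for adjoints. On a finite sum of elementary products, strong
   convergence of b suffices; the bound C, uniform on S, controls the rest. *)
have key (f : adjointable E -> E -> E) (g : adjointable E -> E -> E) :
    (forall b, S b -> forall u w, rnorm (g b u - g b w) <= C * rnorm (u - w)) ->
    (forall b (l : seq (E * P t)), S b -> g b (vsum (v := v) l) = vsum_op (v := v) (f b) l) ->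
    (forall x (e : R), 0 < e -> \forall b \near a, rnorm (f a x - f b x) < e) ->
    forall x (e : R), 0 < e -> \forall b \near within S (nbhs a), rnorm (g a x - g b x) < e.
  move=> glip gV fnear x e e0; have e3 : 0 < e / 3 by lra.
  have [d [d0 _ de]] := small_mul C0 e3.
  have [l hl] := vsum_dense ld t x d0.
  have near_l (m : seq (E * P t)) (c : R) : 0 < c -> \forall b \near a,
      rnorm (vsum_op (v := v) (f a) m - vsum_op (v := v) (f b) m) < c.
    elim: m c => [|p m IH] c c0.
      by apply: filterE => b; rewrite /vsum_op !big_nil subrr rnorm0.
    have c2 : 0 < c / 2 by lra.
    have [c' [c'0 _ c'c]] := small_mul (rnorm_ge0 p.2) c2.
    apply: filterS2 (IH _ c2) (fnear p.1 _ c'0) => b h1 h2.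
    rewrite /vsum_op !big_cons opprD addrACA -(vBl ld).
    apply: le_lt_trans (rnormD _ _) _; rewrite [c]splitr; apply: ltrD => //.
    apply: le_lt_trans (v_norm ld _ _) _; apply: le_lt_trans c'c.
    by rewrite mulrC ler_wpM2l ?rnorm_ge0// ltW.
  apply: filterS (near_l l _ e3) => b hb Sb.
  rewrite -!gV// in hb.
  have lipx c : S c -> rnorm (g c x - g c (vsum (v := v) l)) < e / 3.
    move=> Sc; apply: le_lt_trans (glip _ Sc _ _) _; apply: le_lt_trans de.
    by rewrite ler_wpM2l// ltW.
  have := rnorm_tri (g a (vsum (v := v) l)) (g a x) (g b x).
  have := rnorm_tri (g b (vsum (v := v) l)) (g a (vsum (v := v) l)) (g b x).
  have := rnormB (g b (vsum (v := v) l)) (g b x); have := lipx a Sa; have := lipx b Sb.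
  lra.
apply: strict_cvg.
  apply: (key (fun b => op b) (fun b => op (theta t b))).
  - by move=> b Sb; apply: op_lip; exact: TC.
  - by move=> b l _; apply: op_vsum => x y; exact: thetaE.
  - by move=> x e e0; apply: filterS (strict_near a x e0) => b [].
apply: (key (fun b => opadj b) (fun b => opadj (theta t b))).
- by move=> b Sb; apply: (@op_lip _ _ _ (ba_star (theta t b))); exact: TC'.
- move=> b l _; rewrite -[LHS]/(op (ba_star (theta t b)) _); apply: op_vsum => x y.
  exact: theta_adjE.
- by move=> x e e0; apply: filterS (strict_near a x e0) => b [].
Qed.

Definition theta_sg : E0_semigroup E :=
  E0Semigroup theta0 thetaD theta_linear theta_monoid theta_star theta_strict.

Lemma vsum_cont (f : E -> E) (l : seq (E * @csec R B P Ehat i)) t0 (e : R) :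
  0 < e -> exists2 d : R, 0 < d & forall t, `|rpval t - rpval t0| < d ->
    rnorm (\sum_(p <- l) v t (f p.1) (sval p.2 t) -
           \sum_(p <- l) v t0 (f p.1) (sval p.2 t0)) < e.
Proof.
elim: l e => [|p l IH] e e0.
  by exists 1 => // t _; rewrite !big_nil subrr rnorm0.
have e2 : 0 < e / 2 by lra.
have [d d0 hd] := IH _ e2.
have [d' d'0 hd'] := ld_cont ld (f p.1) t0 (svalP p.2) e2.
exists (Num.min d d'); first by rewrite lt_min d0.
move=> t; rewrite lt_min => /andP[/hd h1 /hd' h2].
rewrite !big_cons opprD addrACA; apply: le_lt_trans (rnormD _ _) _.
by rewrite [e]splitr; exact: ltrD.
Qed.

(** Near t0, x is approximated by finite sums of v_t(x_k, Y_k(t)) with continuous sections Y_k. On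
    these the operator at time t acts explicitly, and both the sums and their images move
    continuously with t. *)
Lemma theta_cont x a t0 (e : R) : 0 < e -> exists2 d : R, 0 < d &
  forall t, `|rpval t - rpval t0| < d -> rnorm (op (theta t0 a) x - op (theta t a) x) < e.
Proof.
move=> e0; have e4 : 0 < e / 4 by lra.
have [C C0 aC] := adj_bounded a.
have TC t : forall u w, rnorm (op (theta t a) u - op (theta t a) w) <= C * rnorm (u - w).
  by apply: op_lip; exact: theta_bound.
have [c [c0 _ ce]] := small_mul C0 e4.
have [l hl] := vsum_dense ld t0 x c0.
have /choice[Y hY] (y : P t0) : exists Y : @csec R B P Ehat i, sval Y t0 = y.
  by have [Y Yc Yy] := scont_ex hc y; exists (exist _ Y Yc).
pose L := [seq (p.1, Y p.2) | p <- l].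
pose V (f : E -> E) t := \sum_(p <- L) v t (f p.1) (sval p.2 t).
have V0 : V id t0 = vsum (v := v) l.
  by rewrite /V /L big_map /=; apply: eq_bigr => p _; rewrite hY.
have TV t : op (theta t a) (V id t) = V (op a) t.
  by rewrite /V op_sum; apply: eq_bigr => p _; rewrite thetaE.
have [d1 d10 h1] := vsum_cont id L t0 c0.
have [d2 d20 h2] := vsum_cont (op a) L t0 e4.
exists (Num.min d1 d2); first by rewrite lt_min d10.
move=> t; rewrite lt_min => /andP[/h1 k1 /h2 k2].
rewrite -/(V id t) -/(V id t0) in k1; rewrite -/(V (op a) t) -/(V (op a) t0) in k2.
have n0 : rnorm (op (theta t0 a) x - V (op a) t0) < e / 4.
  rewrite -TV V0; apply: le_lt_trans (TC _ _ _) _; apply: le_lt_trans ce.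
  by rewrite ler_wpM2l// ltW.
have n1 : rnorm (V (op a) t - op (theta t a) x) < e / 2.
  rewrite -TV; apply: le_lt_trans (TC _ _ _) _.
  have : rnorm (V id t - x) <= 2 * c.
    have := rnorm_tri (V id t0) (V id t) x; have := rnormB x (V id t0).
    by rewrite V0 in k1 *; lra.
  move=> /(ler_wpM2l C0); lra.
have := rnorm_tri (V (op a) t0) (op (theta t0 a) x) (op (theta t a) x).
have := rnorm_tri (V (op a) t) (V (op a) t0) (op (theta t a) x).
have := rnormB (V (op a) t) (V (op a) t0); lra.
Qed.

Lemma theta_strictly_continuous : strictly_continuous theta_sg.
Proof.
move=> a t0; apply: (strict_cvg (nbhs_filter t0)) => x e e0; apply/nbhs_rpP.
  exact: theta_cont.
have [d d0 hd] := theta_cont x (ba_star a) t0 e0; exists d => // t /hd.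
by rewrite !theta_star.
Qed.

End Semigroup.

(** * Identification of the product system *)

Section Identification.
Context {R : realType} {B : unitalCStarAlgType R} {P : ps_data B}
  (hP : is_product_system P).
Context {Ehat E : hilbertModType B} {i : forall t, P t -> Ehat}
  (hi : forall t, isometric_embedding (i t)) (hc : is_continuous_ps i).
Context {v : forall t : Rplus R, E -> P t -> E} (ld : left_dilation i v).
Context {xi : E} (xi1 : unit_vector xi).
Arguments v : clear implicits.
Implicit Types (r s t : Rplus R).

Local Notation th := (theta_sg hP ld).

Lemma theta_rank1 t (x : E) (y : P t) (w : E) :
  op (theta ld t (rank1 w xi)) (v t x y) = v t w (op (lact (P t) (inner xi x)) y).
Proof. by rewrite thetaE /= (v_ractl ld). Qed.

Lemma theta_rank1_xi t (y : P t) (w : E) :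
  op (theta ld t (rank1 w xi)) (v t xi y) = v t w y.
Proof. by rewrite theta_rank1 xi1 lact1. Qed.

Fact phi_subproof t (y : P t) : v t xi y \in fixed_pred (th t (rank1 xi xi)).
Proof. by rewrite unfold_in /= theta_rank1_xi. Qed.

Definition phi t (y : P t) : sg_ps th xi1 t := FixedMod (phi_subproof y).

Lemma v_xi_inner t (y y' : P t) : inner (v t xi y) (v t xi y') = inner y y'.
Proof. by rewrite (ld_inner ld) xi1 lact1. Qed.

Lemma v_xi_dist t (y y' : P t) : rnorm (v t xi y - v t xi y') = rnorm (y - y').
Proof.
rewrite -(vBr ld); apply/eqP; rewrite -(@eqrXn2 _ 2%N) ?rnorm_ge0//.
by rewrite !rnorm_inner v_xi_inner.
Qed.

(** On elementary products the projection sends v_t(x, y) to v_t(xi, <xi, x> y). The assignment to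
    the second factor is Lipschitz because v_t(xi, .) is isometric, so it extends to all u by
    completeness of [P t]. *)
Lemma theta_proj_range t (u : E) : exists y : P t,
  v t xi y = op (theta ld t (rank1 xi xi)) u.
Proof.
set T := theta ld t _; have [C C0 TC] := adj_bounded T.
pose g (l : seq (E * P t)) : P t := \sum_(p <- l) op (lact (P t) (inner xi p.1)) p.2.
have gT l : v t xi (g l) = op T (vsum (v := v) l).
  rewrite /g (big_morph (v t xi) (vDr ld xi) (v0r ld t xi)) /vsum op_sum.
  by apply: eq_bigr => p _; rewrite theta_rank1.
have glip l l' : rnorm (g l - g l') <= C * rnorm (vsum (v := v) l - vsum (v := v) l').
  by rewrite -v_xi_dist !gT; exact: op_lip.
have [h [h1 h2]] := lip_ext C0 (@vsum_dense _ _ _ _ _ _ _ ld t) glip.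
exists (h u); move: u.
apply: (@lip_eq _ _ _ _ (@vsum _ _ _ _ v t) (fun u => v t xi (h u)) (op T) C C C0 C0
  (@vsum_dense _ _ _ _ _ _ _ ld t)) => [u w||l].
- by rewrite v_xi_dist; exact: h2.
- exact: op_lip.
- by rewrite h1 gT.
Qed.

Lemma phi_surj t (y : sg_ps th xi1 t) : exists x : P t, phi x = y.
Proof.
have /eqP py : op (th t (rank1 xi xi)) (fval y) == fval y := fvalP y.
have [x xE] := theta_proj_range t (fval y).
by exists x; apply: val_inj; rewrite /= xE.
Qed.

Lemma phi_iso : @ps_isomorphism R B P (sg_ps th xi1) phi.
Proof.
split=> [t|s t x y|b].
- split; first split.
  + by move=> x y; apply: val_inj; exact: (vDr ld).
  + by move=> x b; apply: val_inj; exact: (v_ractr ld).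
  + by move=> x y; exact: v_xi_inner.
  + exact: phi_surj.
  + move=> b x; apply: val_inj => /=.
    by rewrite theta_rank1_xi (v_ractl ld).
- by apply: val_inj => /=; rewrite theta_rank1_xi (ld_mul ld).
- by apply: val_inj => /=; exact: (ld_id ld).
Qed.

(** For the converse inclusion, x is compared near t0 with a continuous section Y through x t0. The
    images of x and Y are both continuous in [E] and agree at t0, so by isometry x t - Y t is small,
    and continuity of Y under [i] carries over to x. *)
Lemma phi_sections :
  [set (fun t => phi (x t)) | x in cont_sections i] = cont_sections (sg_embed th xi1).
Proof.
apply/seteqP; split=> [_ [x /cont_sectionsP xc <-]|z /cont_rpP zc].
  by apply/cont_rpP => t e e0; have [d d0 hd] := ld_cont ld xi t xc e0; exists d.
pose x t : P t := projT1 (cid (phi_surj (z t))).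
have xz t : phi (x t) = z t := projT2 (cid (phi_surj (z t))).
exists x; last by apply: functional_extensionality_dep => t; exact: xz.
apply/cont_rpP => t0 e e0; have e3 : 0 < e / 3 by lra.
have [Y Yc Yx] := scont_ex hc (x t0).
have [d1 d10 h1] := zc t0 _ e3.
have [d2 d20 h2] := ld_cont ld xi t0 Yc e3.
have [d3 d30 h3] := Yc t0 _ e3.
exists (Num.min d1 (Num.min d2 d3)); first by rewrite !lt_min d10 d20.
move=> t; rewrite !lt_min => /and3P[/h1 k1 /h2 k2 /h3 k3].
rewrite /sg_embed -!xz /= -Yx in k1.
have k4 : rnorm (x t - Y t) < e / 3 + e / 3.
  rewrite -v_xi_dist; apply: le_lt_trans (rnorm_tri (v t0 xi (Y t0)) _ _) _.
  by apply: ltrD => //; rewrite rnormB.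
have := rnorm_tri (i (Y t)) (i (x t)) (i (x t0)).
rewrite -(isoB (hi t)) (iso_norm (hi t)) -Yx; lra.
Qed.

End Identification.

Theorem theorem4p10 (R : realType) (B : unitalCStarAlgType R)
    (P : ps_data B) (hP : is_product_system P)
    (Ehat : hilbertModType B) (i : forall t : Rplus R, P t -> Ehat)
    (hi : forall t : Rplus R, isometric_embedding (i t))
    (hc : is_continuous_ps i) :
  exists (E : hilbertModType B) (xi : E) (xi1 : unit_vector xi)
         (theta : E0_semigroup E),
    strictly_continuous theta /\
    exists phi : forall t : Rplus R, P t -> sg_ps theta xi1 t,
      ps_isomorphism phi /\
      [set (fun t => phi t (x t)) | x in cont_sections i] =
        cont_sections (sg_embed theta xi1).
Proof.
have [E [v [xi [xi1 ld]]]] := dilation_exists hP hi hc.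
exists E, xi, xi1, (theta_sg hP ld); split.
  exact: theta_strictly_continuous.
exists (phi hP ld xi1); split; first exact: phi_iso.
exact: phi_sections.
Qed.
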